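(* Let $W \subseteq \mathbb{F}_2^n$ be a linear subspace and $X, Y, D \subseteq W$. Define $\delta_X = |X|/|W|$, $\delta_Y = |Y|/|W|$, $\delta_D = |D|/|W|$, and $\delta = \delta_X\delta_Y\delta_D$. Let $\varepsilon>0$, $\alpha>0$, and let $r \ge \Omega(\varepsilon^{-8}\log(1/(\alpha\delta))^8 + \varepsilon^{-8}\log(1/\delta_D)^{16})$ be an integer (with a sufficiently large absolute implied constant), such that at least one of $X$ or $Y$ is $(r, \varepsilon/8)$-algebraically spread within $W$. Let $A \subseteq S(X, Y, D)$ with $|A| \ge \alpha\delta|W|^2$. Then there are a linear subspace $W' \subseteq W$, shifts $x,y \in W$, and sets $X'\subseteq W' + x$, $Y' \subseteq W' + y$, $D' \subseteq W' + x + y$ such that, with $A' \coloneqq A \cap S(X', Y', D')$: \begin{enumerate} \item $\dim(W') \ge \dim(W) - O\left(r\varepsilon^{-2}\log(1/(\varepsilon \alpha\delta))^2\log(1/(\varepsilon\alpha\delta_D)) + r\varepsilon^{-2}\log(1/(\varepsilon\alpha\delta_D))^5\right)$; \item $\frac{|D'|}{|W'|} \ge (\varepsilon\alpha/2)\delta_D$; \item $\frac{|X'||Y'|}{|W'|^2} \geq 2^{-O(\log(1/(\varepsilon\alpha\delta_D))^2)}\delta_X\delta_Y$; \item $X'$ and $Y'$ are $(r, \varepsilon)$-algebraically spread in $W' + x$ and $W' + y$, respectively; \item $|A'| \ge (1-5\varepsilon)\alpha\delta_{X'}\delta_{Y'}\delta_{D'}|W'|^2$, where $\delta_{X'} = \frac{|X'|}{|W'|}$,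 $\delta_{Y'} = \frac{|Y'|}{|W'|}$, $\delta_{D'} = \frac{|D'|}{|W'|}$. \end{enumerate}
   Context: For sets $X,Y,D$ contained in $W$ (or in cosets of subspaces of $W$), $S(X,Y,D) \coloneqq \{(x,y) \in W \times W : x\in X,\ y\in Y,\ x+y\in D\}$. For an affine subspace $V \subseteq \mathbb{F}_2^n$, a set $X \subseteq V$ is $(r,\varepsilon)$-algebraically spread within $V$ if for every affine subspace $V' \subseteq V$ with $\dim V' \ge \dim V - r$ we have $|X\cap V'|/|V'| \le (1+\varepsilon)|X|/|V|$. $O(\cdot)$ and $\Omega(\cdot)$ hide absolute constants.
   Formalization: The formal theorem also assumes εαδ_D ≤ 1 (automatic for ε ≤ 1); for larger ε the claim fails, e.g. X=Y=D=W, A=W², α=1, ε=100 would require |D'|/|W'| ≥ 50, and log(1/(εαδ_D)) in the O-bounds is negative. *)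

(* Defs.v *)
From mathcomp Require Import all_boot all_order all_algebra.
From mathcomp Require Import reals exp.
Set Implicit Arguments.
Unset Strict Implicit.
Unset Printing Implicit Defensive.
Import Order.TTheory GRing.Theory Num.Theory.
Local Open Scope ring_scope.

Definition density (R : realType) (T : finType) (X V : {pred T}) : R :=
  #|X|%:R / #|V|%:R.

(* The translate U + v. *)
Definition coset (n : nat) (U : {vspace 'rV['F_2]_n}) (v : 'rV['F_2]_n) :
    {set 'rV['F_2]_n} :=
  [set w | w - v \in U].

(* X is (r, eps)-algebraically spread within the affine subspace U + v; the
   nonempty affine subspaces are the cosets U' + v', of dimension \dim U'. *)
Definition alg_spread (R : realType) (n : nat)
    (U : {vspace 'rV['F_2]_n}) (v : 'rV['F_2]_n)
    (r : nat) (eps : R) (X : {set 'rV['F_2]_n}) : Prop :=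
  forall (U' : {vspace 'rV['F_2]_n}) (v' : 'rV['F_2]_n),
    coset U' v' \subset coset U v ->
    (\dim U <= \dim U' + r)%N ->
    density R (X :&: coset U' v') (coset U' v')
      <= (1 + eps) * density R X (coset U v).

(* S(X, Y, D); the condition (x, y) \in W * W is implied by X, Y \subset W,
   which holds wherever S is used. *)
Definition triple_set (n : nat) (X Y D : {set 'rV['F_2]_n}) :
    {set 'rV['F_2]_n * 'rV['F_2]_n} :=
  [set p | [&& p.1 \in X, p.2 \in Y & p.1 + p.2 \in D]].

(* Main.v *)
Require Import Defs.
From mathcomp Require Import all_boot all_order all_algebra finfield.
From mathcomp Require Import boolp reals sequences exp ring lra zify.
Set Implicit Arguments.
Unset Strict Implicit.
Unset Printing Implicit Defensive.
Import Order.TTheory GRing.Theory Num.Theory.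
Local Open Scope ring_scope.

(* Argue by contradiction with a functional mu(x, y) = 1_A(x, y) minus an affine function of
   1_D(x + y), chosen so that its sum over a box X' * Y' of spread sets is nonpositive unless
   the box is as required, while its sum over X * Y is large.  Decomposing X and Y
   recursively into spread pieces bounds the sum over X * Y by a geometrically decaying
   multiple of |X||Y| plus a contribution of boxes of small density, a contradiction.

   Spreadness enters through counting.  The number of (x, y) with x + y in D is controlled
   from above by almost periodicity (Croot-Sisask sampling followed by a Bogolyubov argument)
   applied to a sifted pair of sets, from below by passing to even moments of the
   autocorrelations of X and Y, and, when all densities are close to 1, by Parseval.  In that
   last case mu uses the complement of D, so that mu <= 2h where exp(-h) = alpha * delta:
   this saves the factor h that the hypothesis on r demands. *)

(** Two things shape the proof. A box needs both sides spread on cosets of one subspace, but cutting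
    [X] and [Y] separately gives pieces on different subspaces. Cutting a piece of [X] along the
    smaller subspace of a piece of [Y] keeps it spread except where its density drops; such cosets
    carry little of it and go to the next level. Counting costs codimension about [e ^ 6 * J ^ 8],
    up to logarithms of [e], for relative error [1 / e] and densities at least [2 ^- J]. Write [H]
    for the logarithm of [1 / (alpha * delta)]. If [H >= 1 / 10], take [e] near [1 / eps] and [J] of
    order [ln (1 / eps) + H]; powers of [ln (1 / eps)] are paid for by raising [eps ^- 6] to
    [eps ^- 8]. If [H] is small, [r] may be only a multiple of [(H / eps) ^ 8], so whatever enters
    [r] may depend on [H / eps] alone: hence relative error [eps / (10 * H)] for the complement of
    [D], and a number of levels logarithmic in [H / eps]. When [dX * dY >= 1 - 5 * eps] the space
    [W] itself answers, so otherwise [H >= 5 * eps]. *)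

Section Sums.
Variables (R : realType) (I : finType).
Implicit Types f g : I -> R.

Lemma sum_sqr_ge0 (P : pred I) f : 0 <= \sum_(i | P i) f i ^+ 2.
Proof. by apply: sumr_ge0 => i _; exact: sqr_ge0. Qed.

Lemma cauchy_schwarz (P : pred I) f g :
  (\sum_(i | P i) f i * g i) ^+ 2
    <= (\sum_(i | P i) f i ^+ 2) * (\sum_(i | P i) g i ^+ 2).
Proof.
have H : 0 <= \sum_(i | P i) \sum_(j | P j) (f i * g j - f j * g i) ^+ 2.
  by apply: sumr_ge0 => i _; exact: sum_sqr_ge0.
have E1 : \sum_(i | P i) \sum_(j | P j) (f i * g j - f j * g i) ^+ 2 =
   2 * ((\sum_(i | P i) f i ^+ 2) * (\sum_(i | P i) g i ^+ 2))
   - 2 * (\sum_(i | P i) f i * g i) ^+ 2.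
  transitivity (\sum_(i | P i) \sum_(j | P j)
     (f i ^+ 2 * g j ^+ 2 + g i ^+ 2 * f j ^+ 2
       - 2 * ((f i * g i) * (f j * g j)))).
    by apply: eq_bigr => i _; apply: eq_bigr => j _; ring.
  under eq_bigr => i _ do rewrite !big_split /= sumrN -!mulr_sumr.
  rewrite !big_split /= sumrN -!mulr_sumr -!mulr_suml. ring.
rewrite E1 in H. lra.
Qed.

Lemma cauchy_schwarz_sqrt (P : pred I) f g :
  \sum_(i | P i) `|f i * g i|
    <= Num.sqrt (\sum_(i | P i) f i ^+ 2) * Num.sqrt (\sum_(i | P i) g i ^+ 2).
Proof.
rewrite -sqrtrM ?sum_sqr_ge0 //.
rewrite -[X in X <= _]ger0_norm ?sumr_ge0 // -sqrtr_sqr ler_wsqrtr //.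
under eq_bigr => i _ do rewrite normrM.
apply: le_trans (cauchy_schwarz _ _ _) _.
by apply: ler_pM; rewrite ?sum_sqr_ge0 //; apply: ler_sum => i _;
  rewrite real_normK ?num_real.
Qed.

(** A power is convex on the half-line, so it lies above its tangent at [a]; each induction step
    leaves over the nonnegative term [n.+1%:R * a ^+ n * (x - a) ^+ 2]. *)
Lemma bernoulli_tangent (x a : R) n : 0 <= x -> 0 <= a ->
  a ^+ n.+1 + n.+1%:R * a ^+ n * (x - a) <= x ^+ n.+1.
Proof.
move=> x0 a0; elim: n => [|n IH]; first by rewrite !expr1 expr0; lra.
have H1 : 0 <= x * (x ^+ n.+1 - (a ^+ n.+1 + n.+1%:R * a ^+ n * (x - a))).
  by rewrite mulr_ge0 ?subr_ge0.
have H2 : 0 <= n.+1%:R * a ^+ n * (x - a) ^+ 2.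
  by apply: mulr_ge0; rewrite ?sqr_ge0 // mulr_ge0 ?exprn_ge0.
rewrite -subr_ge0.
have -> : x ^+ n.+2 - (a ^+ n.+2 + n.+2%:R * a ^+ n.+1 * (x - a)) =
  x * (x ^+ n.+1 - (a ^+ n.+1 + n.+1%:R * a ^+ n * (x - a)))
  + n.+1%:R * a ^+ n * (x - a) ^+ 2.
  by rewrite !exprS -!natr1; ring.
exact: addr_ge0.
Qed.

(** Jensen's inequality by summing the tangent at [a]. The slope of the tangent is nonnegative, so a
    lower bound [a] for the mean suffices. *)
Lemma power_mean (P : pred I) f (a : R) n : 0 <= a ->
  (forall i, P i -> 0 <= f i) ->
  #|P|%:R * a <= \sum_(i | P i) f i ->
  #|P|%:R * a ^+ n <= \sum_(i | P i) f i ^+ n.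
Proof.
move=> a0 f0 H; case: n => [|n].
  under eq_bigr => i _ do rewrite expr0.
  by rewrite expr0 mulr1 sumr_const.
apply: (@le_trans _ _
  (\sum_(i | P i) (a ^+ n.+1 + n.+1%:R * a ^+ n * (f i - a)))); last first.
  by apply: ler_sum => i Pi; apply: bernoulli_tangent => //; exact: f0.
rewrite big_split /= sumr_const -mulr_sumr big_split /= sumr_const.
rewrite mulNrn -[a *+ _]mulr_natl.
by rewrite mulr_natl lerDl mulr_ge0 ?mulr_ge0 ?exprn_ge0 ?subr_ge0.
Qed.

End Sums.

(** * Real characters of F_2^m and Fourier analysis *)

Section Characters.
Variables (R : realType) (m : nat).
Local Notation E := 'rV['F_2]_m.
Implicit Types (a x y z : E) (f g h : E -> R).

Lemma addvv x : x + x = 0.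
Proof.
apply/rowP => i; rewrite !mxE; case: (x 0 i) => -[|[|//]] ? ; exact/val_inj.
Qed.

Lemma oppv x : - x = x.
Proof. by apply/eqP; rewrite eq_sym -addr_eq0 addvv. Qed.

Lemma addvK x y : x + y + y = x.
Proof. by rewrite -addrA addvv addr0. Qed.

Lemma addKv x y : x + (x + y) = y.
Proof. by rewrite addrA addvv add0r. Qed.

Lemma sum_shift (T : nmodType) y (F : E -> T) :
  \sum_x F (x + y) = \sum_x F x.
Proof.
rewrite [RHS](reindex (fun x => x + y)) //.
by exists (fun x => x + y) => x _; exact: addvK.
Qed.

Lemma sum_shiftl (T : nmodType) y (F : E -> T) :
  \sum_x F (y + x) = \sum_x F x.
Proof. by rewrite -[RHS](sum_shift y); apply: eq_bigr => x _; rewrite addrC. Qed.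

Definition dot a x : 'F_2 := (a *m x^T) 0 0.

Lemma dotC a x : dot a x = dot x a.
Proof. 
rewrite /dot; have -> : x *m a^T = (a *m x^T)^T by rewrite trmx_mul trmxK.
by rewrite [RHS]mxE. Qed.

Lemma dotDr a x y : dot a (x + y) = dot a x + dot a y.
Proof. by rewrite /dot linearD /= mulmxDr mxE. Qed.

Lemma dot0l x : dot 0 x = 0. Proof. by rewrite /dot mul0mx mxE. Qed.
Lemma dot_delta i x : dot (delta_mx 0 i) x = x 0 i.
Proof. by rewrite /dot -rowE !mxE. Qed.

Definition chi a x : R := if dot a x == 0 then 1 else -1.

Lemma chiC a x : chi a x = chi x a. Proof. by rewrite /chi dotC. Qed.

Lemma chiD a x y : chi a (x + y) = chi a x * chi a y.
Proof.
rewrite /chi dotDr.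
case: (dot a x) (dot a y) => -[|[|//]] ? [[|[|//]] ?] /=; rewrite -?val_eqE /=; ring.
Qed.

Lemma chiDl a b x : chi (a + b) x = chi a x * chi b x.
Proof. by rewrite chiC chiD !(chiC x). Qed.

Lemma chi0l x : chi 0 x = 1. Proof. by rewrite /chi dot0l eqxx. Qed.
Lemma chi0r x : chi x 0 = 1. Proof. by rewrite chiC chi0l. Qed.

Lemma chi_norm a x : `|chi a x| = 1.
Proof. by rewrite /chi; case: ifP; rewrite ?normrN normr1. Qed.

Lemma chi_sqr a x : chi a x * chi a x = 1.
Proof. by rewrite -chiD addvv chi0r. Qed.

Lemma sum_chi x : \sum_a chi a x = if x == 0 then #|E|%:R else 0.
Proof.
case: eqVneq => [->|x0].
  by under eq_bigr do rewrite chi0r; rewrite sumr_const.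
have [i xi] : exists i, x 0 i != 0.
  apply/existsP; apply: contraNT x0; rewrite negb_exists => /forallP H.
  by apply/eqP/rowP => i; rewrite mxE; apply/eqP; rewrite -[_ == _]negbK.
have : \sum_a chi a x = - \sum_a chi a x.
  rewrite -[LHS](sum_shift (delta_mx 0 i)) -sumrN; apply: eq_bigr => a _.
  by rewrite chiDl [chi (delta_mx _ _) _]/chi dot_delta (negbTE xi) mulrN1.
move=> ?; lra.
Qed.

Definition ft f a : R := \sum_x f x * chi a x.

Lemma ft0 f : ft f 0 = \sum_x f x.
Proof. by apply: eq_bigr => x _; rewrite chi0l mulr1. Qed.

Lemma parseval f g : \sum_a ft f a * ft g a = #|E|%:R * \sum_x f x * g x.
Proof.
transitivity (\sum_x \sum_y f x * g y * \sum_a chi a (x + y)).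
  under eq_bigr => a _ do rewrite /ft big_distrlr /=.
  rewrite exchange_big; apply: eq_bigr => x _.
  rewrite exchange_big; apply: eq_bigr => y _.
  rewrite mulr_sumr; apply: eq_bigr => a _; rewrite chiD; ring.
rewrite mulr_sumr; apply: eq_bigr => x _.
rewrite (bigD1 x) //= addvv sum_chi eqxx big1 => [|y yx]; first ring.
rewrite sum_chi addr_eq0 oppv eq_sym (negbTE yx); ring.
Qed.

Lemma parseval_sqr f : \sum_a ft f a ^+ 2 = #|E|%:R * \sum_x f x ^+ 2.
Proof. exact: parseval. Qed.

Lemma ft_inversion f x : #|E|%:R * f x = \sum_a ft f a * chi a x.
Proof.
under eq_bigr => a _ do rewrite mulr_suml.
rewrite exchange_big /= (bigD1 x) //= [X in _ + X]big1 => [|y yx].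
  rewrite addr0 (eq_bigr (fun=> f x)) => [|a _].
    by rewrite sumr_const mulr_natl.
  by rewrite -mulrA chi_sqr mulr1.
rewrite (eq_bigr (fun a => f y * chi a (y + x))) => [|a _].
  by rewrite -mulr_sumr sum_chi addr_eq0 oppv (negbTE yx) mulr0.
by rewrite -mulrA chiD.
Qed.

(** In characteristic 2 [z + x] is [z - x], so this is the usual convolution, unnormalised. *)
Definition conv f g z : R := \sum_x f x * g (z + x).

Lemma ft_conv f g a : ft (conv f g) a = ft f a * ft g a.
Proof.
rewrite /ft big_distrlr /= /conv.
under eq_bigr do rewrite mulr_suml.
rewrite exchange_big; apply: eq_bigr => x _.
rewrite -(sum_shift x); apply: eq_bigr => y _.
rewrite addvK chiD; ring.
Qed.

(* The number of (x, y) weighted by f x g y h (x + y) on the Fourier side. *)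
Lemma ft_triple f g h :
  \sum_a ft f a * (ft g a * ft h a)
    = #|E|%:R * \sum_x f x * \sum_y g y * h (x + y).
Proof.
under eq_bigr do rewrite -ft_conv; exact: parseval.
Qed.

(** Supremum bound on one factor, Cauchy-Schwarz and Parseval for the other two. Taken over all
    frequencies it bounds the Fourier mass of [conv3]; over the nonzero ones it bounds a counting
    error. *)
Lemma ft_triple_bound (P : pred E) f g h c :
  0 <= c -> (forall a, P a -> `|ft f a| <= c) ->
  \sum_(a | P a) `|ft f a * (ft g a * ft h a)|
    <= c * (#|E|%:R * (Num.sqrt (\sum_x g x ^+ 2) * Num.sqrt (\sum_x h x ^+ 2))).
Proof.
move=> c0 H.
apply: (@le_trans _ _ (c * \sum_(a | P a) `|ft g a * ft h a|)).
  rewrite mulr_sumr; apply: ler_sum => a Pa.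
  by rewrite normrM ler_wpM2r ?normr_ge0 // H.
rewrite ler_wpM2l //.
apply: (@le_trans _ _ (\sum_a `|ft g a * ft h a|)).
  by rewrite [X in _ <= X](bigID P) /= lerDl sumr_ge0.
apply: le_trans (cauchy_schwarz_sqrt _ _ _) _.
rewrite !parseval_sqr !sqrtrM ?ler0n //.
rewrite (_ : _ * _ = Num.sqrt (#|E|%:R) ^+ 2 *
  (Num.sqrt (\sum_x g x ^+ 2) * Num.sqrt (\sum_x h x ^+ 2))); last by ring.
by rewrite sqr_sqrtr.
Qed.

End Characters.

(** * Cosets, hyperplane sections and pseudorandom pieces *)

Section Subspaces.
Variables (R : realType) (n : nat).
Local Notation E := 'rV['F_2]_n.
Implicit Types (U V : {vspace E}) (u v x y a : E).

Lemma card_vspace2 V : #|V| = (2 ^ \dim V)%N.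
Proof. by rewrite card_vspace card_Fp. Qed.

Lemma card_vspace2_gt0 V : (0 < #|V|)%N.
Proof. by rewrite card_vspace2 expn_gt0. Qed.

Lemma card_space : #|E| = (2 ^ n)%N.
Proof. by rewrite card_mx card_Fp ?mul1n. Qed.

Lemma card_fullv : #|(fullv : {vspace E})| = #|E|.
Proof. exact: card_vspacef. Qed.

Lemma mem_coset V v x : (x \in coset V v) = (x - v \in V).
Proof. by rewrite inE. Qed.

Lemma coset_id V v : v \in coset V v.
Proof. by rewrite mem_coset subrr mem0v. Qed.

Lemma coset_sym V x y : (x \in coset V y) = (y \in coset V x).
Proof. by rewrite !mem_coset -memvN opprB. Qed.

Lemma coset_trans V x y z : x \in coset V y -> y \in coset V z -> x \in coset V z.
Proof. by rewrite !mem_coset => xy /(memvD xy); rewrite addrA addrNK. Qed.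

Lemma coset_sub (U V : {vspace E}) u v :
  (U <= V)%VS -> u \in coset V v -> coset U u \subset coset V v.
Proof.
move=> /subvP UV uv; apply/subsetP => x; rewrite mem_coset => /UV xu.
by apply: coset_trans uv; rewrite mem_coset.
Qed.

Lemma subset_coset (U V : {vspace E}) u v :
  coset U u \subset coset V v -> (U <= V)%VS /\ u \in coset V v.
Proof.
move=> /subsetP H; have uV := H _ (coset_id _ _); split=> //.
apply/subvP => x xU; have : x + u \in coset V v.
  by apply: H; rewrite mem_coset addrK.
by move=> xu; have := coset_trans xu (etrans (coset_sym _ _ _) uV);
  rewrite mem_coset addrK.
Qed.

Lemma coset0 V : coset V 0 =i V.
Proof. by move=> x; rewrite mem_coset subr0. Qed.

Lemma coset_fullv v : coset fullv v = [set: E].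
Proof. by apply/setP => x; rewrite mem_coset memvf inE. Qed.

Lemma card_coset V v : #|coset V v| = #|V|.
Proof.
rewrite -[RHS](card_imset _ (addIr v)); apply: eq_card => x.
rewrite mem_coset; apply/idP/imsetP => [xv|[y]].
  by exists (x - v); rewrite ?subrK.
by move=> yV ->; rewrite addrK.
Qed.

(** Cosets of [U] are indexed by all points of [V + v] instead of by representatives, so each one is
    counted [#|U|] times. *)
Lemma sum_cosets (T : nmodType) (U V : {vspace E}) v (F : E -> T) : (U <= V)%VS ->
  \sum_(c in coset V v) \sum_(y in coset U c) F y
    = (\sum_(y in coset V v) F y) *+ #|U|.
Proof.
move=> UV.
under eq_bigr do rewrite big_mkcond.
rewrite exchange_big /= -sumrMnl [RHS]big_mkcond; apply: eq_bigr => y _.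
rewrite -big_mkcondr; case: ifP => yV.
  rewrite -(card_coset U y) -sumr_const; apply: eq_bigl => c.
  rewrite [y \in _]coset_sym andb_idl // => cy.
  by apply: (subsetP (coset_sub UV yV)).
rewrite big1 // => c /andP[cV yc].
by rewrite (subsetP (coset_sub UV cV) _ yc) in yV.
Qed.

Definition perp a : {vspace E} := lker (linfun (mulmxr a^T : E -> 'M_(1, 1))).

Lemma mem_perp a x : (x \in perp a) = (dot a x == 0).
Proof.
rewrite memv_ker lfunE /= dotC /dot; apply/eqP/eqP => [->|H]; first by rewrite mxE.
by apply/matrixP => i j; rewrite !ord1 H mxE.
Qed.

Lemma dim_capv_perp V a : (\dim V <= \dim (V :&: perp a)%VS + 1)%N.
Proof.
rewrite -(limg_ker_dim (linfun (mulmxr a^T : E -> 'M_(1, 1))) V) leq_add2l.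
by apply: leq_trans (dimvS (subvf _)) _; rewrite dimvf /dim /= muln1.
Qed.

Lemma dot_F2 a x : dot a x != 0 -> dot a x = 1.
Proof. by case: (dot a x) => -[|[|//]] ? // _; apply/val_inj. Qed.

(* A character that is not constant on V + v takes each sign on one half. *)
Lemma character_half V v (P : {set E}) a :
  P \subset coset V v -> ~~ [forall x in V, dot a x == 0] ->
  let V' := (V :&: perp a)%VS in
  exists v', [/\ coset V' v' \subset coset V v, (#|V| = 2 * #|V'|)%N &
    `|\sum_(x in P) chi R a x| = 2 * #|P :&: coset V' v'|%:R - #|P|%:R].
Proof.
move=> PV /forallPn[u]; rewrite negb_imply => /andP[uV /dot_F2 au] V'.
have half b : b \in coset V v -> coset V' b \subset coset V v.
  by apply: coset_sub; exact: capvSl.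
have mem b : b \in coset V v -> forall x, x \in coset V v ->
    (x \in coset V' b) = (dot a x == dot a b).
  move=> bV x xV; rewrite mem_coset memv_cap mem_perp dotDr oppv.
  have -> : x + b \in V.
    have : x \in coset V b by rewrite coset_sym in bV; exact: coset_trans bV.
    by rewrite mem_coset oppv.
  by rewrite addr_eq0; congr (_ == _); case: (dot a b) => -[|[|//]] ?; apply/val_inj.
have uvV : u + v \in coset V v by rewrite mem_coset addrK.
have vV := coset_id V v.
have dotuv : dot a (u + v) = 1 + dot a v by rewrite dotDr au.
have F2 (c d : 'F_2) : (d == c) = ~~ (d == 1 + c).
  by move: c d => -[[|[|//]] ?] [[|[|//]] ?].
have cardV' : (#|V| = 2 * #|V'|)%N.
  rewrite -(card_coset V v) -(cardsID (coset V' v)) mul2n -addnn.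
  rewrite (setIidPr (half _ vV)) card_coset; congr (_ + _)%N.
  rewrite -(card_coset V' (u + v)); apply: eq_card => x; rewrite in_setD.
  case xV: (x \in coset V v); first by rewrite !mem // dotuv F2 negbK andbT.
  rewrite andbF; apply/esym/negbTE; apply: contraFN xV.
  exact: (subsetP (half _ uvV)).
pose n0 := #|P :&: coset V' v|; pose n1 := #|P :&: coset V' (u + v)|.
have cardP : #|P| = (n0 + n1)%N.
  rewrite -(cardsID (coset V' v) P); congr (_ + _)%N; apply: eq_card => x.
  rewrite in_setD in_setI andbC; case xP: (x \in P) => //=.
  by rewrite !mem // ?(subsetP PV) // dotuv F2 negbK.
have sumP : \sum_(x in P) chi R a x = chi R a v * (n0%:R - n1%:R).
  rewrite (bigID (fun x => x \in coset V' v)) /= mulrBr; congr (_ + _).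
    rewrite mulr_natr -sumr_const; apply: eq_big => [x|x /andP[xP]].
      by rewrite in_setI.
    by rewrite mem // ?(subsetP PV) // /chi => /eqP ->.
  rewrite -mulNr mulr_natr -sumr_const.
  apply: eq_big => [x|x /andP[xP]].
    by rewrite in_setI; case xP: (x \in P) => //=; rewrite !mem // ?(subsetP PV) // dotuv F2 negbK.
  rewrite mem // ?(subsetP PV) // /chi F2 negbK => /eqP ->.
  by case: (dot a v) => -[|[|//]] ? /=; rewrite ?opprK.
rewrite sumP normrM chi_norm mul1r.
(* The difference of [n0] and [n1] is, in absolute value, twice the larger one minus [n0 + n1]; the
   half that holds more of [P] is the witness. *)
have [le01|/ltW le10] := lerP (n0%:R : R) n1%:R.
  exists (u + v); split; [exact: half | exact: cardV' |].
  by rewrite -/n1 cardP natrD; ring.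
exists v; split; [exact: half | exact: cardV' |].
by rewrite -/n0 cardP natrD; ring.
Qed.

(** Density increment on [P]. A character that is nontrivial on [V] and has bias above [1 / 2] puts
    more than [3 / 4] of [P] on one half of the coset, which multiplies the density by more than
    [3 / 2]. Density never exceeds 1, so fewer than [K] halvings occur. *)
Lemma pseudorandom_piece K V v (P : {set E}) :
  P \subset coset V v -> (#|V|%:R : R) < #|P|%:R * (3 / 2) ^+ K ->
  exists V' v', [/\ coset V' v' \subset coset V v, (\dim V <= \dim V' + K)%N,
   P :&: coset V' v' != set0 & forall a, [forall x in V', dot a x == 0] \/
     `|\sum_(x in P :&: coset V' v') chi R a x| <= #|P :&: coset V' v'|%:R / 2].
Proof.
elim: K V v P => [|K IH] V v P PV.
  rewrite expr0 mulr1 ltr_nat => H.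
  by have := subset_leq_card PV; rewrite card_coset leqNgt H.
move=> H.
have P0 : P != set0.
  by apply: contraTneq H => ->; rewrite cards0 mul0r -leNgt ler0n.
pose bad a := ~~ [forall x in V, dot a x == 0] &&
  ((#|P|%:R / 2 : R) < `|\sum_(x in P) chi R a x|).
case: (pickP bad) => [a /andP[aV]|nobad]; last first.
  exists V, v; rewrite (setIidPl PV); split; rewrite ?leq_addr // => a.
  move/negbT: (nobad a); rewrite negb_and negbK -leNgt => /orP[]; by [left|right].
have [v' [sub cV ->]] := character_half PV aV.
set V' := (V :&: perp a)%VS in sub cV * => big.
have [||V2 [v2 [sub2 dimV2]]] := IH V' v' (P :&: coset V' v').
- exact: subsetIr.
- rewrite cV natrM exprS in H.
  have : 0 < (3 / 2 : R) ^+ K by rewrite exprn_gt0 //; lra.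
  move: (#|P :&: coset V' v'|%:R : R) (#|P|%:R : R) ((3/2 : R) ^+ K) (#|V'|%:R : R) big H.
  move=> p q w z big H w0; have : q * (3 / 4) * w < p * w.
    by rewrite ltr_pM2r //; lra.
  have -> : q * (3 / 4) * w = (q * (3 / 2 * w)) / 2 by field.
  by lra.
rewrite -setIA (setIidPr sub2) => ne H2; exists V2, v2; split=> //.
  exact: subset_trans sub.
have := dim_capv_perp V a; rewrite -/V'; move: dimV2; clear; lia.
Qed.

End Subspaces.

(** * Chernoff bounds for random sampling *)

Section Sampling.
Variables (R : realType).

(** From [1 - x <= expR (- x)] one gets [expR x * (1 - x) <= 1], and
    [(1 + x + 2 * x ^+ 2) * (1 - x)] exceeds 1 by [x ^+ 2 * (1 - 2 * x)]. *)
Lemma expR_quadratic (x : R) : x <= 1 / 2 -> expR x <= 1 + x + 2 * x ^+ 2.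
Proof.
move=> x2; have := expR_ge1Dx (- x); rewrite expRN => H.
have e0 := expR_gt0 x.
have H2 : expR x * (1 - x) <= 1.
  by rewrite -[X in _ <= X](divff (lt0r_neq0 e0)) ler_pM2l.
have H3 : 1 <= (1 + x + 2 * x ^+ 2) * (1 - x) by nra.
have : expR x * (1 - x) <= (1 + x + 2 * x ^+ 2) * (1 - x) by lra.
by rewrite ler_pM2r //; lra.
Qed.

Variables (T : finType) (A : {set T}).

(** The exponential of a sum over coordinates factors, so the sum over [k]-tuples is the [k]-th
    power of a sum over [A], in which the linear term vanishes because [g] has mean zero. *)
Lemma mgf_bound (g : T -> R) (l : R) k :
  (forall a, `|g a| <= 1) -> \sum_(a in A) g a = 0 -> 0 <= l -> l <= 1 / 2 ->
  \sum_(s in ffun_on_mem 'I_k (mem A)) expR (l * \sum_i g (s i))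
    <= #|A|%:R ^+ k * expR (2 * l ^+ 2 * k%:R).
Proof.
move=> g1 g0 l0 l2.
rewrite (eq_bigr (fun s : {ffun 'I_k -> T} => \prod_i expR (l * g (s i)))); last first.
  by move=> s _; rewrite mulr_sumr expR_sum.
rewrite -(bigA_distr_big (mem A) (fun=> fun a => expR (l * g a))) /=.
rewrite prodr_const card_ord expRM_natr -exprMn lerXn2r ?nnegrE ?mulr_ge0 ?expR_ge0 //.
  by apply: sumr_ge0 => a _; exact: expR_ge0.
apply: (@le_trans _ _ (\sum_(a in A) (1 + l * g a + 2 * l ^+ 2))).
  apply: ler_sum => a _; have := g1 a; rewrite ler_norml => /andP[ga1 ga2].
  apply: le_trans (expR_quadratic _) _; first by nra.
  rewrite lerD2l ler_pM2l // exprMn ler_piMr ?sqr_ge0 //.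
  by rewrite -real_normK ?num_real // exprn_ile1.
rewrite !big_split /= -mulr_sumr g0 mulr0 addr0 !sumr_const -mulr_natl.
rewrite -[X in _ + X]mulr_natl mulr1 -[X in X + _]mulr1 -mulrDr ler_wpM2l //.
exact: expR_ge1Dx.
Qed.

(** Chernoff's bound for both signs at [l = e / 4]: the exponent is [2 * l ^+ 2 * k - l * k * e = -
    k * e ^+ 2 / 8], and [e <= 2] ensures [l <= 1 / 2]. *)
Lemma sample_tail (g : T -> R) (e : R) k :
  (forall a, `|g a| <= 1) -> \sum_(a in A) g a = 0 -> 0 < e -> e <= 2 ->
  #|[set s in ffun_on_mem 'I_k (mem A) | k%:R * e < `|\sum_i g (s i)|]|%:R
    <= #|A|%:R ^+ k * (2 * expR (- (k%:R * e ^+ 2 / 8))).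
Proof.
move=> g1 g0 e0 e2; pose l := e / 4.
have l0 : 0 <= l by rewrite /l; lra.
have l2 : l <= 1 / 2 by rewrite /l; lra.
have g1' : forall a, `|- g a| <= 1 by move=> a; rewrite normrN.
have g0' : \sum_(a in A) - g a = 0 by rewrite sumrN g0 oppr0.
have := lerD (mgf_bound k g1 g0 l0 l2) (mgf_bound k g1' g0' l0 l2).
rewrite -big_split /= -mulr2n -[X in _ <= X]mulr_natl => H.
have ex := expR_gt0 (l * (k%:R * e)).
rewrite -(ler_pM2r ex); apply: le_trans (le_trans _ H) _; last first.
  rewrite (_ : expR (2 * l ^+ 2 * k%:R) =
    expR (- (k%:R * e ^+ 2 / 8)) * expR (l * (k%:R * e))); first by lra.
  by rewrite -expRD; congr expR; rewrite /l; field.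
rewrite [X in X <= _]mulr_natl -sumr_const [X in _ <= X](bigID (fun s : {ffun 'I_k -> T} =>
  k%:R * e < `|\sum_i g (s i)|)) /=.
rewrite -[X in X <= _]addr0 lerD //; last first.
  by apply: sumr_ge0 => s _; rewrite addr_ge0 ?expR_ge0.
rewrite [X in X <= _]big_mkcond [X in _ <= X]big_mkcond /=.
apply: ler_sum => s _; rewrite inE; case: ifP => // /andP[_ H1].
have [s0|s0] := lerP 0 (\sum_i g (s i)).
  rewrite ger0_norm // in H1.
  apply: (@le_trans _ _ (expR (l * \sum_i g (s i)))); last by rewrite lerDl expR_ge0.
  by rewrite ler_expR ler_wpM2l // ltW.
rewrite ltr0_norm // in H1.
apply: (@le_trans _ _ (expR (l * \sum_i - g (s i)))); last by rewrite lerDr expR_ge0.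
by rewrite ler_expR ler_wpM2l // sumrN ltW.
Qed.

End Sampling.

(** * Almost-periods by Croot-Sisask sampling *)

Section AlmostPeriodicity.
Variables (R : realType) (m : nat).
Local Notation E := 'rV['F_2]_m.
Local Notation N := (#|E|%:R : R).
Implicit Types (A B T P Q : {set E}).

Definition ind A (x : E) : R := (x \in A)%:R.

Lemma ind_ge0 A x : 0 <= ind A x. Proof. exact: ler0n. Qed.
Lemma ind_le1 A x : ind A x <= 1. Proof. by rewrite /ind lern1 leq_b1. Qed.

Lemma sum_ind A (F : E -> R) : \sum_x ind A x * F x = \sum_(x in A) F x.
Proof.
rewrite [RHS]big_mkcond; apply: eq_bigr => x _.
by rewrite /ind; case: (x \in A); rewrite ?mul1r ?mul0r.
Qed.

Lemma sum_ind1 A : \sum_x ind A x = #|A|%:R.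
Proof.
rewrite -sumr_const -sum_ind; apply: eq_bigr => x _; by rewrite mulr1.
Qed.

Lemma ind_sqr A x : ind A x ^+ 2 = ind A x.
Proof. by rewrite /ind; case: (x \in A); rewrite ?expr1n ?expr0n. Qed.

Lemma N_gt0 : 0 < N.
Proof. by rewrite ltr0n card_space expn_gt0. Qed.

Definition hit A T z : R := (\sum_(a in A) ind T (z + a)) / #|A|%:R.

Lemma hit_ge0 A T z : 0 <= hit A T z.
Proof. by rewrite divr_ge0 // sumr_ge0 // => *; exact: ind_ge0. Qed.

Lemma hit_le1 A T z : hit A T z <= 1.
Proof.
have [->|/set0Pn[a aA]] := eqVneq A set0; first by rewrite /hit big_set0 mul0r ler01.
have A0 : 0 < #|A|%:R :> R by rewrite ltr0n; apply/card_gt0P; exists a.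
rewrite /hit ler_pdivrMr // mul1r -sumr_const.
by apply: ler_sum => b _; exact: ind_le1.
Qed.

Definition sample k T (s : {ffun 'I_k -> E}) z : R := (\sum_i ind T (z + s i)) / k%:R.

Definition bad_set k A T (e : R) (s : {ffun 'I_k -> E}) : {set E} :=
  [set z | e < `|sample T s z - hit A T z|].

(** Each point is bad for at most a fraction [nu] of the tuples, so a tuple has at most [nu * N] bad
    points on average; by Markov's inequality at least half of the tuples have at most twice as
    many. *)
Lemma good_samples k A T (e nu : R) : (0 < k)%N -> A != set0 -> 0 < e -> e <= 2 ->
  nu = 2 * expR (- (k%:R * e ^+ 2 / 8)) ->
  #|A|%:R ^+ k <= 2 * #|[set s in ffun_on_mem 'I_k (mem A) |
     #|bad_set A T e s|%:R <= 2 * nu * N]|%:R :> R.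
Proof.
move=> k0 A0 e0 e2 nuE.
have kR : 0 < k%:R :> R by rewrite ltr0n.
have A0' : 0 < #|A|%:R :> R by rewrite ltr0n card_gt0.
have nu0 : 0 < nu by rewrite nuE mulr_gt0 ?expR_gt0.
set Ak := ffun_on_mem _ _; set G := [set s in Ak | _].
have total : \sum_(s in Ak) #|bad_set A T e s|%:R <= N * (#|A|%:R ^+ k * nu) :> R.
  rewrite (eq_bigr (fun s => \sum_z ind (bad_set A T e s) z)); last first.
    by move=> s _; rewrite sum_ind1.
  rewrite exchange_big /= mulr_natl -sumr_const; apply: ler_sum => z _.
  pose g a := ind T (z + a) - hit A T z.
  have g1 a : `|g a| <= 1.
    rewrite ler_norml /g; have := ind_ge0 T (z + a); have := ind_le1 T (z + a).
    have := hit_ge0 A T z; have := hit_le1 A T z; lra.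
  have g0 : \sum_(a in A) g a = 0.
    rewrite /g big_split /= sumr_const -mulr_natl /hit mulrN mulrCA divff ?mulr1 ?subrr //.
    by rewrite lt0r_neq0.
  rewrite nuE; apply: le_trans _ (sample_tail k g1 g0 e0 e2).
  rewrite -sumr_const big_mkcond [X in _ <= X]big_mkcond /=; apply: ler_sum => s _.
  rewrite !inE; case: ifP => //= sA; rewrite /ind inE /sample.
  have -> : \sum_i g (s i) = k%:R * ((\sum_i ind T (z + s i)) / k%:R - hit A T z).
    rewrite /g big_split /= sumr_const card_ord -mulr_natl; field.
    by rewrite lt0r_neq0.
  by rewrite normrM (gtr0_norm kR) ltr_pM2l //; case: ifP.
have cardAk : #|Ak|%:R = #|A|%:R ^+ k :> R by rewrite card_ffun_on card_ord natrX.
pose B := [set s in Ak | ~~ (#|bad_set A T e s|%:R <= 2 * nu * N)].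
have cardB : #|Ak| = (#|G| + #|B|)%N.
  rewrite -(cardID (fun s => #|bad_set A T e s|%:R <= 2 * nu * N) Ak).
  by congr (_ + _)%N; apply: eq_card => s; rewrite !inE // andbC.
have split : #|Ak|%:R = #|G|%:R + #|B|%:R :> R by rewrite cardB natrD.
have : #|B|%:R * (2 * nu * N) <= N * (#|A|%:R ^+ k * nu).
  apply: le_trans _ total; rewrite mulr_natl -sumr_const.
  rewrite [X in _ <= X](bigID (fun s => s \in B)) /= -[X in X <= _]addr0 lerD ?sumr_ge0 //.
  rewrite (eq_bigl (fun s => (s \in Ak) && (s \in B))); last first.
    by move=> s; rewrite inE; case: (s \in Ak).
  by apply: ler_sum => s /andP[_]; rewrite inE => /andP[_]; rewrite -ltNge => /ltW.
rewrite (_ : _ * _ = (#|B|%:R * 2) * (nu * N)); last by ring.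
rewrite (_ : N * _ = #|A|%:R ^+ k * (nu * N)); last by ring.
rewrite ler_pM2r ?mulr_gt0 ?N_gt0 // -cardAk split; lra.
Qed.

(** The average of [ind T] over all [t + a + b]: a triple convolution normalised in [A] and [B]. *)
Definition conv3 A B T t : R := (\sum_(b in B) hit A T (b + t)) / #|B|%:R.

(* Croot-Sisask sampling: two translates of one tuple that both sample A well are
   almost-periods of each other, and by pigeonhole some tuple has many such translates. *)
Lemma almost_periods k A B T (e nu : R) :
  (0 < k)%N -> A != set0 -> B != set0 -> 0 < e -> e <= 2 ->
  nu = 2 * expR (- (k%:R * e ^+ 2 / 8)) ->
  exists P : {set E}, #|A|%:R ^+ k * N <= 2 * #|P|%:R * N ^+ k /\
    forall s t t', t \in P -> t' \in P ->
      `|conv3 A B T (s + t) - conv3 A B T (s + t')| <= 2 * e + 4 * nu * N / #|B|%:R.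
Proof.
move=> k0 A0 B0 e0 e2 nuE.
have := good_samples T k0 A0 e0 e2 nuE; set G := [set s in _ | _] => HG.
pose tr (w : {ffun 'I_k -> E}) t := [ffun i => w i + t].
pose P w := [set t | tr w t \in G].
have B0' : 0 < #|B|%:R :> R by rewrite ltr0n card_gt0.
have sumP : \sum_w #|P w|%:R = N * #|G|%:R :> R.
  rewrite (eq_bigr (fun w => \sum_t (tr w t \in G)%:R)); last first.
    move=> w _; rewrite -sum_ind1; apply: eq_bigr => t _; by rewrite /ind inE.
  rewrite exchange_big /= mulr_natl -sumr_const; apply: eq_bigr => t _.
  rewrite -sumr_const [RHS]big_mkcond /=.
  rewrite [RHS](reindex (fun w => tr w t)) /=; last first.
    exists (fun w => tr w t) => w _; apply/ffunP => i; rewrite !ffunE; exact: addvK.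
  by apply: eq_bigr => w _; case: ifP.
(* Pigeonhole: by [sumP] the sets [P w] have total size [N * #|G|], shared among [N ^+ k] tuples. *)
have [w Hw] : exists w, #|G|%:R * N <= #|P w|%:R * N ^+ k.
  apply/existsP; apply: contraPT sumP => /existsPn H.
  apply/eqP; rewrite lt_eqF //.
  have Nk : 0 < N ^+ k by rewrite exprn_gt0 ?N_gt0.
  rewrite -(ltr_pM2r Nk) mulr_suml.
  have cE : #|{ffun 'I_k -> E}|%:R = N ^+ k by rewrite card_ffun card_ord natrX.
  apply: (@lt_le_trans _ _ (\sum_(w : {ffun 'I_k -> E}) #|G|%:R * N)); last first.
    rewrite sumr_const -[_ *+ #|_|]mulr_natl.
    have -> : #|{: {ffun 'I_k -> E}}|%:R = N ^+ k by exact: cE.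
    by rewrite le_eqVlt; apply/orP; left; apply/eqP; ring.
  apply: ltr_sum => [|w _]; last by rewrite ltNge H.
  by apply/hasP; exists [ffun=> 0] => //; rewrite mem_index_enum.
exists (P w); split.
  have := ler_wpM2r (ltW N_gt0) HG; move: Hw; lra.
(* Sampling at [b + t] with the tuple shifted by [t] returns the sample of [w] at [b], since both
   shifts cancel. This value depends on [b] alone and links the translates by [t] and [t']. *)
have close t b : t \in P w -> b + t \notin bad_set A T e (tr w t) ->
    `|hit A T (b + t) - sample T w b| <= e.
  rewrite !inE => _; rewrite -leNgt distrC; apply: le_trans.
  rewrite le_eqVlt; apply/orP; left; apply/eqP; congr `|_ - _|; congr (_ / _).
  by apply: eq_bigr => i _; rewrite ffunE addrACA addvv addr0.
move=> s t t' tP t'P.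
have bad t1 : t1 \in P w ->
    \sum_(b in B) ind (bad_set A T e (tr w t1)) (b + s + t1) <= 2 * nu * N.
  rewrite inE inE => /andP[_]; apply: le_trans.
  rewrite -sum_ind1 -(sum_shift (s + t1) (ind _)) [X in _ <= X](bigID (mem B)) /=.
  rewrite -[X in X <= _]addr0 lerD ?sumr_ge0 // => *; rewrite ?ind_ge0 //.
  by apply: ler_sum => b _; rewrite addrA.
rewrite /conv3 -mulrBl normrM [X in _ * X]gtr0_norm ?invr_gt0 //.
rewrite ler_pdivrMr // mulrDl divfK ?lt0r_neq0 // -sumrB.
apply: le_trans (ler_norm_sum _ _ _) _.
apply: (@le_trans _ _ (\sum_(b in B) (2 * e +
   (ind (bad_set A T e (tr w t)) (b + s + t)
     + ind (bad_set A T e (tr w t')) (b + s + t'))))); last first.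
  rewrite big_split /= sumr_const -[_ *+ #|B|]mulr_natr lerD2l big_split /=.
  by have := bad _ tP; have := bad _ t'P; lra.
apply: ler_sum => b _; rewrite !addrA.
have h01 x : 0 <= hit A T x /\ hit A T x <= 1 by split; [exact: hit_ge0|exact: hit_le1].
have far : `|hit A T (b + s + t) - hit A T (b + s + t')| <= 1.
  by rewrite ler_norml; have := h01 (b + s + t); have := h01 (b + s + t'); lra.
have i0 := ind_ge0 (bad_set A T e (tr w t)) (b + s + t).
have i0' := ind_ge0 (bad_set A T e (tr w t')) (b + s + t').
have [b1|b1] := boolP (b + s + t \in bad_set A T e (tr w t)).
  have -> : ind (bad_set A T e (tr w t)) (b + s + t) = 1 by rewrite /ind b1.
  lra.
have [b2|b2] := boolP (b + s + t' \in bad_set A T e (tr w t')).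
  have -> : ind (bad_set A T e (tr w t')) (b + s + t') = 1 by rewrite /ind b2.
  lra.
have := close _ _ tP b1; have := close _ _ t'P b2.
rewrite !ler_norml; lra.
Qed.

End AlmostPeriodicity.

(** * From almost-periods to a subspace *)

Section Bogolyubov.
Variables (R : realType) (m : nat).
Local Notation E := 'rV['F_2]_m.
Local Notation N := (#|E|%:R : R).
Implicit Types (A B T P Q : {set E}) (V : {vspace E}) (F f : E -> R).

Definition trivial_on V a := [forall x in V, dot a x == 0].

Lemma sum_chi_vspace V a :
  \sum_(x in V) chi R a x = if trivial_on V a then #|V|%:R else 0.
Proof.
case: ifPn => [/forall_inP H|/forallPn[u]].
  by rewrite -sumr_const; apply: eq_bigr => x xV; rewrite /chi H.
rewrite negb_imply => /andP[uV au].
have : \sum_(x in V) chi R a x = - \sum_(x in V) chi R a x.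
  rewrite [LHS]big_mkcond -[LHS](sum_shift u) [in RHS]big_mkcond -sumrN.
  apply: eq_bigr => x _; rewrite (rpredDr x uV) addrC chiD [chi R a u]/chi (negbTE au).
  by case: ifP; rewrite ?mulN1r ?oppr0.
move=> ?; lra.
Qed.

Definition smooth Q f s : R := (\sum_(q in Q) f (s + q)) / #|Q|%:R.

Lemma smooth_close Q f (eta : R) s : Q != set0 ->
  (forall t q, q \in Q -> `|f (t + q) - f t| <= eta) -> `|smooth Q f s - f s| <= eta.
Proof.
move=> Q0 H; have Q0' : 0 < #|Q|%:R :> R by rewrite ltr0n card_gt0.
rewrite /smooth -[X in _ - X](divfK (lt0r_neq0 Q0')) mulrAC -mulrBl normrM.
rewrite [X in _ * X]gtr0_norm ?invr_gt0 // ler_pdivrMr // !mulr_natr.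
rewrite -[eta *+ _]sumr_const -[f s *+ _]sumr_const -sumrB.
by apply: le_trans (ler_norm_sum _ _ _) _; apply: ler_sum => q qQ; apply: H.
Qed.

Lemma smooth_period Q f (eta : R) u : Q != set0 ->
  (forall t, `|f (t + u) - f t| <= eta) ->
  forall t, `|smooth Q f (t + u) - smooth Q f t| <= eta.
Proof.
move=> Q0 H t; have Q0' : 0 < #|Q|%:R :> R by rewrite ltr0n card_gt0.
rewrite /smooth -mulrBl normrM [X in _ * X]gtr0_norm ?invr_gt0 // ler_pdivrMr //.
rewrite mulr_natr -sumr_const -sumrB; apply: le_trans (ler_norm_sum _ _ _) _.
by apply: ler_sum => q qQ; rewrite addrAC.
Qed.

Lemma iter_smooth_close Q f (eta : R) l s : Q != set0 ->
  (forall t q, q \in Q -> `|f (t + q) - f t| <= eta) ->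
  `|iter l (smooth Q) f s - f s| <= l%:R * eta.
Proof.
move=> Q0 H.
have per : forall t q, q \in Q ->
    `|iter l (smooth Q) f (t + q) - iter l (smooth Q) f t| <= eta.
  move=> t q qQ; elim: l t => [|l IH] t /=; first exact: H.
  exact: smooth_period.
elim: l per => [|l IH] per /=; first by rewrite subrr normr0 mul0r.
have per' : forall t q, q \in Q ->
    `|iter l (smooth Q) f (t + q) - iter l (smooth Q) f t| <= eta.
  move=> t q qQ; elim: {per IH} l t => [|l IH] t /=; first exact: H.
  exact: smooth_period.
have := smooth_close s Q0 per'; have := IH per'.
rewrite -natr1 mulrDl mul1r => h1 h2.
rewrite -(subrKA (iter l (smooth Q) f s)).
by apply: le_trans (ler_normD _ _) _; rewrite addrC lerD.
Qed.

Lemma ft_smooth Q f a :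
  ft (smooth Q f) a = (\sum_(q in Q) chi R a q) / #|Q|%:R * ft f a.
Proof.
rewrite /ft /smooth; under eq_bigr => x _ do rewrite mulrAC mulr_suml.
rewrite -mulr_suml mulrAC; congr (_ / _).
rewrite exchange_big mulr_suml /=; apply: eq_bigr => q _.
rewrite -(sum_shift q) mulr_sumr; apply: eq_bigr => x _.
rewrite addvK chiD; ring.
Qed.

Lemma ft_iter_smooth Q f a l :
  ft (iter l (smooth Q) f) a = ((\sum_(q in Q) chi R a q) / #|Q|%:R) ^+ l * ft f a.
Proof.
elim: l => [|l IH] /=; first by rewrite expr0 mul1r.
by rewrite ft_smooth IH exprS mulrA.
Qed.

Lemma sum_vspace_ft V f :
  N * \sum_(v in V) f v = #|V|%:R * \sum_(a | trivial_on V a) ft f a.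
Proof.
rewrite mulr_sumr; under eq_bigr do rewrite ft_inversion.
rewrite exchange_big /= mulr_sumr [RHS]big_mkcond; apply: eq_bigr => a _.
by rewrite -mulr_sumr sum_chi_vspace; case: ifP => _; rewrite ?mulr0 // mulrC.
Qed.

(** Restrict [P] to a piece that is pseudorandom relative to a subspace [V] and translate it into
    [V], giving [Q]. Smoothing [l] times along [Q] moves [F 0] by at most [l * eta]. On the Fourier
    side it fixes the frequencies trivial on [V], which make up the average of [F] over [V], and
    damps every other one by [(1 / 2) ^+ l]. *)
Lemma periods_to_subspace F P (eta : R) K l :
  N < #|P|%:R * (3 / 2) ^+ K ->
  (forall s t t', t \in P -> t' \in P -> `|F (s + t) - F (s + t')| <= eta) ->
  exists V, (m <= \dim V + K)%N /\
    `|F 0 - (\sum_(v in V) F v) / #|V|%:R|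
       <= l%:R * eta + (1 / 2) ^+ l * (\sum_a `|ft F a|) / N.
Proof.
move=> bigP per.
have PV : P \subset coset fullv 0 by rewrite coset_fullv subsetT.
have bigP' : (#|fullv : {vspace E}|%:R : R) < #|P|%:R * (3 / 2) ^+ K.
  by rewrite card_fullv.
have [V [v [_ dimV ne H]]] := pseudorandom_piece PV bigP'.
exists V; split; first by move: dimV; rewrite dimvf /dim /= mul1n.
have [p0 p0P] := set0Pn _ ne; move: (p0P); rewrite inE => /andP[p0P1 p0V].
set P' := P :&: coset V v in H ne p0P.
pose Q := [set q | q + p0 \in P'].
have memQ q : (q \in Q) = (q + p0 \in P') by rewrite in_set.
have cardQ : #|Q| = #|P'|.
  rewrite -(card_imset _ (addIr p0)); apply: eq_card => x; apply/imsetP/idP => [[q]|xP].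
    by rewrite memQ => ? ->.
  by exists (x + p0); rewrite ?memQ addvK.
have Q0 : Q != set0 by apply/set0Pn; exists 0; rewrite memQ add0r.
have QV q : q \in Q -> q \in V.
  rewrite memQ inE => /andP[_ qV]; have : q + p0 \in coset V p0.
    by rewrite coset_sym in p0V; exact: coset_trans p0V.
  by rewrite mem_coset addrK.
(* Apply [per] at [s = t + p0] to the two elements [q + p0] and [p0] of [P]; the shifts by [p0]
   cancel. *)
have perQ t q : q \in Q -> `|F (t + q) - F t| <= eta.
  rewrite memQ inE => /andP[qP _].
  have := per (t + p0) _ _ qP p0P1.
  by rewrite addvK addrA -[t + p0 + q]addrA [p0 + q]addrC addrA addvK.
have close := iter_smooth_close l 0 Q0 perQ.
pose mu a := (\sum_(q in Q) chi R a q) / #|Q|%:R.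
have Q0' : 0 < #|Q|%:R :> R by rewrite ltr0n card_gt0.
have V0 : 0 < #|V|%:R :> R by rewrite ltr0n card_vspace2_gt0.
have N0 := N_gt0 R m.
have mu1 a : trivial_on V a -> mu a = 1.
  move=> /forall_inP aV; rewrite /mu (eq_bigr (fun=> 1)) => [|q /QV qV].
    by rewrite sumr_const divff // lt0r_neq0.
  by rewrite /chi aV.
have mu2 a : ~~ trivial_on V a -> `|mu a| <= 1 / 2.
  rewrite /trivial_on; case: (H a) => [->//|Ha _].
  rewrite /mu normrM [X in _ * X]gtr0_norm ?invr_gt0 // ler_pdivrMr //.
  rewrite cardQ (_ : 1 / 2 * _ = #|P'|%:R / 2); last by field.
  have -> : \sum_(q in Q) chi R a q = chi R a p0 * \sum_(x in P') chi R a x.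
    rewrite mulr_sumr [LHS]big_mkcond [RHS]big_mkcond -[RHS](sum_shift p0).
    apply: eq_bigr => x _; rewrite memQ; case: ifP => // _.
    by rewrite chiD mulrCA chi_sqr mulr1.
  by rewrite normrM chi_norm mul1r.
have E1 : N * (iter l (smooth Q) F 0 - (\sum_(v in V) F v) / #|V|%:R) =
    \sum_(a | ~~ trivial_on V a) mu a ^+ l * ft F a.
  rewrite mulrBr ft_inversion mulrA sum_vspace_ft mulrAC divff ?mul1r ?lt0r_neq0 //.
  rewrite (bigID (trivial_on V)) /= addrAC -[X in X + _]subr0.
  rewrite (_ : \sum_(i | trivial_on V i) _ = \sum_(a | trivial_on V a) ft F a).
    rewrite subr0 subrr add0r; apply: eq_bigr => a _.
    by rewrite chi0r mulr1 ft_iter_smooth.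
  by apply: eq_bigr => a /mu1 mua; rewrite chi0r mulr1 ft_iter_smooth -/(mu a) mua expr1n mul1r.
have E2 : `|iter l (smooth Q) F 0 - (\sum_(v in V) F v) / #|V|%:R|
    <= (1 / 2) ^+ l * (\sum_a `|ft F a|) / N.
  rewrite ler_pdivlMr // mulrC -[X in X * _](gtr0_norm N0) -normrM E1.
  apply: le_trans (ler_norm_sum _ _ _) _; rewrite mulr_sumr [X in _ <= X](bigID (trivial_on V)) /=.
  rewrite -[X in X <= _]add0r lerD ?sumr_ge0 // => [a _|].
    by rewrite mulr_ge0 ?exprn_ge0 //; lra.
  apply: ler_sum => a /mu2 mua; rewrite normrM normrX ler_wpM2r //.
  by apply: lerXn2r; rewrite ?nnegrE //; lra.
rewrite -(subrKA (iter l (smooth Q) F 0)).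
by apply: le_trans (ler_normD _ _) _; rewrite lerD // distrC.
Qed.

Lemma ft_ind_bound T a : `|ft (ind R T) a| <= N.
Proof.
apply: le_trans (ler_norm_sum _ _ _) _; rewrite -sumr_const.
apply: ler_sum => x _; rewrite normrM chi_norm mulr1 ger0_norm ?ind_ge0 //.
exact: ind_le1.
Qed.

Lemma sum_ind_sqr A : \sum_x ind R A x ^+ 2 = #|A|%:R.
Proof. by rewrite -(sum_ind1 R); apply: eq_bigr => x _; rewrite ind_sqr. Qed.

Lemma ft_conv3 A B T c :
  ft (conv3 R A B T) c =
  ft (ind R T) c * (ft (ind R A) c * ft (ind R B) c) / (#|A|%:R * #|B|%:R).
Proof.
have ftA D : ft (ind R D) c = \sum_(a in D) chi R c a by rewrite /ft sum_ind.
rewrite /ft /conv3 /hit.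
rewrite (eq_bigr (fun t => (\sum_(b in B) \sum_(a in A)
    ind R T (b + t + a) * chi R c t) / (#|A|%:R * #|B|%:R))); last first.
  move=> t _; rewrite -mulr_suml; under [X in _ = X / _]eq_bigr do rewrite -mulr_suml.
  rewrite -mulr_suml invfM; ring.
rewrite -mulr_suml; congr (_ / _).
rewrite -/(ft (ind R A) c) -/(ft (ind R B) c) !ftA mulrC [X in X * _]mulrC big_distrlr /=.
rewrite exchange_big mulr_suml /=; apply: eq_bigr => b _.
rewrite exchange_big mulr_suml /=; apply: eq_bigr => a _.
rewrite mulr_sumr -(sum_shift (a + b)); apply: eq_bigr => t _.
rewrite (_ : b + (t + (a + b)) + a = t) ?chiD; first by ring.
rewrite [a + b]addrC addrA addrA [b + t]addrC addvK; exact: addvK.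
Qed.

(** The average of [conv3] over [V] is the average over pairs [(a, b)] of the density of [T] on the
    coset of [b + a]; some pair is at least average. *)
Lemma large_translate A B T V (c : R) : A != set0 -> B != set0 ->
  c <= (\sum_(v in V) conv3 R A B T v) / #|V|%:R ->
  exists v, c * #|V|%:R <= #|T :&: coset V v|%:R.
Proof.
move=> A0 B0 H.
have A0' : 0 < #|A|%:R :> R by rewrite ltr0n card_gt0.
have B0' : 0 < #|B|%:R :> R by rewrite ltr0n card_gt0.
have V0 : 0 < #|V|%:R :> R by rewrite ltr0n card_vspace2_gt0.
apply/existsP; apply: contraTT H => /existsPn H; rewrite -ltNge ltr_pdivrMr //.
have -> : \sum_(v in V) conv3 R A B T v =
  (\sum_(b in B) \sum_(a in A) #|T :&: coset V (b + a)|%:R) / (#|A|%:R * #|B|%:R).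
  rewrite /conv3 /hit.
  rewrite (eq_bigr (fun v => (\sum_(b in B) \sum_(a in A)
    ind R T (b + v + a)) / (#|A|%:R * #|B|%:R))); last first.
    by move=> t _; rewrite -mulr_suml invfM mulrA.
  rewrite -mulr_suml; congr (_ / _).
  rewrite exchange_big; apply: eq_bigr => b _.
  rewrite exchange_big; apply: eq_bigr => a _.
  rewrite -sum_ind1 [LHS]big_mkcond -(sum_shift (b + a)); apply: eq_bigr => v _.
  rewrite /ind inE mem_coset oppv (_ : b + (v + (b + a)) + a = v); last first.
    by rewrite [v + _]addrC -[b + a + v]addrA addKv [a + v]addrC addvK.
  by case: (v + (b + a) \in V) => //=; rewrite ?andbF ?andbT.
have AB : 0 < #|A|%:R * #|B|%:R :> R by exact: mulr_gt0.
rewrite ltr_pdivrMr //.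
rewrite (_ : c * _ * _ = \sum_(b in B) \sum_(a in A) c * #|V|%:R); last first.
  by rewrite sumr_const sumr_const -mulrnA -[RHS]mulr_natl natrM; ring.
have [a0 a0A] := set0Pn _ A0; have [b0 b0B] := set0Pn _ B0.
apply: ltr_sum => [|b _].
  by apply/hasP; exists b0; rewrite ?mem_index_enum.
apply: ltr_sum => [|a _]; last by rewrite ltNge H.
by apply/hasP; exists a0; rewrite ?mem_index_enum.
Qed.

End Bogolyubov.

(** * Bogolyubov-Sanders lemma with explicit codimension *)

Section BogolyubovSanders.
Variables (R : realType) (m : nat).
Local Notation E := 'rV['F_2]_m.
Local Notation N := (#|E|%:R : R).
Implicit Types (A B T : {set E}).

Lemma expRN_nat (k : nat) : expR (- k%:R : R) <= (1 / 2) ^+ k.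
Proof.
rewrite -mulN1r expRM_natr lerXn2r ?nnegrE ?expR_ge0 //; first by lra.
rewrite expRN -[X in _ <= X]invrK lef_pV2 ?posrE ?expR_gt0 //; last by lra.
by apply: le_trans (expR_ge1Dx _); rewrite invf_div; lra.
Qed.

Lemma natr_le_exp2 (k : nat) : k%:R <= 2 ^+ k :> R.
Proof. by rewrite -natrX ler_nat ltnW // ltn_expl. Qed.

Lemma half_exp2 (k : nat) : (1 / 2 : R) ^+ k = (2 ^+ k)^-1.
Proof. by rewrite exprMn expr1n mul1r exprVn. Qed.

(** The sample size makes the Chernoff exponent equal to [11 * q]. With [x = 2 ^+ q] the tail must
    absorb [1 / c <= x], [q * e <= x ^+ 2] and the constant [144 <= x ^+ 8], whence
    [11 = 1 + 2 + 8]. *)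
Lemma almost_period_error (e q : nat) (c eps : R) : (0 < e)%N -> (0 < q)%N ->
  (e <= 2 ^ q)%N -> 1 <= c * 2 ^+ q -> 0 < c ->
  eps = (18 * q%:R * e%:R)^-1 ->
  2 * eps + 4 * (2 * expR (- ((88 * q * (18 * q * e) ^ 2)%:R * eps ^+ 2 / 8))) / c <= 3 * eps.
Proof.
move=> e0 q0 eq c1 c0 epsE.
have eR : 0 < e%:R :> R by rewrite ltr0n.
have qR : 0 < q%:R :> R by rewrite ltr0n.
have -> : (88 * q * (18 * q * e) ^ 2)%:R * eps ^+ 2 / 8 = (11 * q)%:R.
  rewrite !natrM epsE; field.
  by rewrite !lt0r_neq0.
have H1 := expRN_nat (11 * q).
have x0 : 0 < 2 ^+ q :> R by rewrite exprn_gt0.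
have X11 : (1 / 2 : R) ^+ (11 * q) * (2 ^+ q) ^+ 11 = 1.
  by rewrite -!exprM mulnC -exprMn (_ : 1 / 2 * 2 = 1) ?expr1n //; field.
have qx : q%:R <= 2 ^+ q :> R by exact: natr_le_exp2.
have ex : e%:R <= 2 ^+ q :> R by rewrite -natrX ler_nat.
have x2 : 2 <= 2 ^+ q :> R by rewrite -[X in X <= _]expr1 ler_eXn2l //; clear; lra.
set x := (2 ^+ q : R) in x0 X11 qx ex x2 c1 *.
set y := (1 / 2 : R) ^+ (11 * q) in H1 X11.
suff : 4 * (2 * y) / c <= eps.
  move=> H; apply: le_trans (_ : 2 * eps + 4 * (2 * y) / c <= _); last by lra.
  by rewrite lerD2l ler_pM2r ?invr_gt0 // !ler_pM2l.
have y0 : 0 < y by rewrite exprn_gt0 //; lra.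
have cx : c^-1 <= x.
  by rewrite -[X in X <= _]mul1r ler_pdivrMr // mulrC.
apply: (@le_trans _ _ (4 * (2 * y) * x)).
  by rewrite ler_wpM2l //; lra.
rewrite epsE -[X in _ <= X]mul1r ler_pdivlMr; last by rewrite !mulr_gt0.
have -> : 4 * (2 * y) * x * (18 * q%:R * e%:R) = 144 * (q%:R * e%:R) * (y * x) by ring.
have qe : q%:R * e%:R <= x * x by apply: ler_pM => //; exact: ltW.
have x8 : 144 <= x ^+ 8.
  apply: le_trans (_ : 2 ^+ 8 <= _); first by rewrite -natrX ler_nat.
  by apply: lerXn2r => //; rewrite nnegrE; lra.
apply: (@le_trans _ _ (x ^+ 8 * (x * x) * (y * x))).
  by rewrite ler_pM2r ?mulr_gt0 // ler_pM ?mulr_ge0 // ltW.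
by rewrite le_eqVlt -X11; apply/orP; left; apply/eqP; ring.
Qed.

Lemma conv3_0 A B T :
  conv3 R A B T 0 = (\sum_(b in B) \sum_(a in A) ind R T (b + a)) / (#|A|%:R * #|B|%:R).
Proof.
rewrite /conv3 /hit -mulr_suml invfM mulrA; congr (_ / _ / _).
by apply: eq_bigr => b _; apply: eq_bigr => a _; rewrite addr0.
Qed.

Lemma sum_ft_conv3 A B T : A != set0 -> B != set0 ->
  (\sum_c `|ft (conv3 R A B T) c|) / N * Num.sqrt (#|A|%:R * #|B|%:R) <= N.
Proof.
move=> A0 B0.
have A0' : 0 < #|A|%:R :> R by rewrite ltr0n card_gt0.
have B0' : 0 < #|B|%:R :> R by rewrite ltr0n card_gt0.
have N0 := N_gt0 R m.
have AB : 0 < #|A|%:R * #|B|%:R :> R by exact: mulr_gt0.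
have H := ft_triple_bound (P := predT) (ind R A) (ind R B) (ltW N0)
  (fun c _ => ft_ind_bound R T c).
rewrite (eq_bigr (fun c => `|ft (ind R T) c * (ft (ind R A) c * ft (ind R B) c)|
   / (#|A|%:R * #|B|%:R))); last first.
  by move=> c _; rewrite ft_conv3 normrM [X in _ * X]gtr0_norm ?invr_gt0.
rewrite -mulr_suml; move: H; rewrite !sum_ind_sqr -sqrtrM ?ler0n //.
set s := Num.sqrt _ => H.
have s0 : 0 < s by rewrite sqrtr_gt0.
have -> : #|A|%:R * #|B|%:R = s * s by rewrite -expr2 sqr_sqrtr ?ltW.
rewrite (_ : _ / _ / _ * _ = (\sum_i `|ft (ind R T) i * (ft (ind R A) i * ft (ind R B) i)|) / (N * s)).
  by rewrite ler_pdivrMr ?mulr_gt0.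
by field; rewrite !lt0r_neq0.
Qed.

(** The inner factor [k = 88 * q * (18 * q * e) ^ 2] is the sample size, and the almost-periods have
    density at least [2 ^- (q * k) / 2]. As [(3 / 2) ^ 2 > 2], the term [2 * (q * k)] halvings pays
    for [2 ^ (q * k)] and the last 2 for the remaining factor 2. *)
Definition bogolyubov_codim (e q : nat) := (2 * (q * (88 * q * (18 * q * e) ^ 2)) + 2)%N.

(** [conv3] at 0 is at least [1 - 1 / e]. Almost periodicity replaces this value by an average over
    a subspace at a further loss of [1 / e], and some translate attains the average. *)
Lemma bogolyubov A B T (e q : nat) :
  (0 < e)%N -> (0 < q)%N -> (e <= 2 ^ q)%N ->
  N ^+ 2 <= #|A|%:R * #|B|%:R * 2 ^+ q ->
  (1 - e%:R^-1) * (#|A|%:R * #|B|%:R)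
    <= \sum_(b in B) \sum_(a in A) ind R T (b + a) ->
  exists (V : {vspace E}) v, (m <= \dim V + bogolyubov_codim e q)%N /\
    (1 - 2 / e%:R) * #|V|%:R <= #|T :&: coset V v|%:R :> R.
Proof.
move=> e0 q0 eq ABq HT.
have N0 := N_gt0 R m.
have x0 : 0 < 2 ^+ q :> R by rewrite exprn_gt0.
have cardN (D : {set E}) : #|D|%:R <= N by rewrite ler_nat max_card.
have nz (D D' : {set E}) : N ^+ 2 <= #|D|%:R * #|D'|%:R * 2 ^+ q -> D != set0.
  apply: contraTneq => ->; rewrite cards0 !mul0r -ltNge exprn_gt0 //.
have A0 := nz _ _ ABq.
have B0 : B != set0 by apply: (nz B A); rewrite [_ * #|A|%:R]mulrC.
have A0' : 0 < #|A|%:R :> R by rewrite ltr0n card_gt0.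
have B0' : 0 < #|B|%:R :> R by rewrite ltr0n card_gt0.
have eR : 0 < e%:R :> R by rewrite ltr0n.
have qR : 0 < q%:R :> R by rewrite ltr0n.
have dens (D D' : {set E}) : N ^+ 2 <= #|D|%:R * #|D'|%:R * 2 ^+ q ->
    N <= #|D|%:R * 2 ^+ q.
  move=> H; rewrite -(ler_pM2r N0) -expr2; apply: le_trans H _.
  by rewrite mulrAC ler_wpM2l // mulr_ge0 // ltW.
have NA := dens _ _ ABq.
have NB : N <= #|B|%:R * 2 ^+ q by apply: (dens B A); rewrite [_ * #|A|%:R]mulrC.
set k := (88 * q * (18 * q * e) ^ 2)%N.
have k0 : (0 < k)%N by rewrite !muln_gt0 e0 q0.
pose eps := (18 * q%:R * e%:R)^-1 : R.
have qe1 : 1 <= q%:R * e%:R :> R by rewrite -natrM ler1n muln_gt0 q0.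
have eps0 : 0 < eps by rewrite invr_gt0 !mulr_gt0.
have eps2 : eps <= 2.
  by rewrite /eps -mulrA -[X in X <= _]mul1r ler_pdivrMr; nra.
have [P [cardP per]] := almost_periods T k0 A0 B0 eps0 eps2 (erefl _).
have err := @almost_period_error e q (#|B|%:R / N) eps e0 q0 eq.
rewrite -/k in err.
have {}err : 2 * eps + 4 * (2 * expR (- (k%:R * eps ^+ 2 / 8))) * N / #|B|%:R <= 3 * eps.
  have -> : 4 * (2 * expR (- (k%:R * eps ^+ 2 / 8))) * N / #|B|%:R =
     4 * (2 * expR (- (k%:R * eps ^+ 2 / 8))) / (#|B|%:R / N).
    by field; rewrite !lt0r_neq0.
  apply: err => //; last by rewrite divr_gt0.
  by rewrite mulrAC ler_pdivlMr // mul1r.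
have {}per s t t' : t \in P -> t' \in P ->
    `|conv3 R A B T (s + t) - conv3 R A B T (s + t')| <= 3 * eps.
  by move=> tP t'P; apply: le_trans (per _ _ _ tP t'P) err.
have bigP : N < #|P|%:R * (3 / 2) ^+ (2 * (q * k) + 2).
  have Nk : 0 < N ^+ k by rewrite exprn_gt0.
  have H1 : N ^+ k <= #|A|%:R ^+ k * 2 ^+ (q * k).
    by rewrite exprM -exprMn lerXn2r ?nnegrE ?mulr_ge0 // ltW.
  have H2 : N <= 2 * #|P|%:R * 2 ^+ (q * k).
    rewrite -(ler_pM2r Nk).
    apply: (@le_trans _ _ (N * (#|A|%:R ^+ k * 2 ^+ (q * k)))); first by rewrite ler_pM2l.
    have z0 : 0 <= 2 ^+ (q * k) :> R by exact: exprn_ge0.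
    by have := ler_wpM2r z0 cardP; lra.
  have H3 : 2 ^+ (q * k) <= (3 / 2 : R) ^+ (2 * (q * k)).
    rewrite [X in _ <= X]exprM; apply: lerXn2r; rewrite ?nnegrE ?exprn_ge0 //; first lra.
    by rewrite expr2; lra.
  have P0 : 0 < #|P|%:R :> R.
    rewrite lt0r ler0n andbT; apply/eqP => P0.
    by move: H2; rewrite P0 mulr0 mul0r leNgt N0.
  rewrite exprD expr2; apply: le_lt_trans H2 _.
  rewrite mulrAC mulrC -mulrA ltr_pM2l //.
  have : 0 < (2 ^+ (q * k) : R) by rewrite exprn_gt0.
  by move=> ?; nra.
(* [3 * q] rounds balance two errors. The drift is [9 * q * eps = 1 / (2 * e)], which is where the
   18 in [eps] comes from; the damping [2 ^- (3 * q)] against Fourier mass at most [2 ^ q] also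
   leaves at most [1 / (2 * e)]. *)
have [V [dimV close]] := periods_to_subspace (3 * q) bigP per.
exists V; suff [v Hv] : exists v, (1 - 2 / e%:R) * #|V|%:R <= #|T :&: coset V v|%:R :> R.
  by exists v.
apply: (large_translate A0 B0).
have F0 : 1 - e%:R^-1 <= conv3 R A B T 0.
  by rewrite conv3_0 ler_pdivlMr ?mulr_gt0.
set S := (_ / _) in close *.
suff : (3 * q)%:R * (3 * eps) +
   (1 / 2) ^+ (3 * q) * (\sum_a `|ft (conv3 R A B T) a|) / N <= e%:R^-1.
  move=> H; have := le_trans close H; rewrite ler_norml => /andP[_].
  by clear -F0; lra.
have -> : (3 * q)%:R * (3 * eps) = e%:R^-1 / 2.
  by rewrite natrM /eps; field; rewrite !lt0r_neq0.
suff : (1 / 2) ^+ (3 * q) * (\sum_a `|ft (conv3 R A B T) a|) / N <= e%:R^-1 / 2 by clear; lra.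
have s0 : 0 < Num.sqrt (#|A|%:R * #|B|%:R : R) by rewrite sqrtr_gt0 mulr_gt0.
have Nx : N <= Num.sqrt (#|A|%:R * #|B|%:R) * 2 ^+ q.
  rewrite -[X in X <= _](gtr0_norm N0) -sqrtr_sqr.
  have -> : 2 ^+ q = Num.sqrt ((2 ^+ q) ^+ 2) :> R by rewrite sqrtr_sqr gtr0_norm.
  rewrite -sqrtrM ?mulr_ge0 // ler_wsqrtr //; apply: le_trans ABq _.
  rewrite ler_wpM2l ?mulr_ge0 // expr2 ler_pMl //.
  by rewrite -natrX ler1n expn_gt0.
have Sx : (\sum_a `|ft (conv3 R A B T) a|) / N <= 2 ^+ q.
  rewrite -(ler_pM2r s0); apply: le_trans (sum_ft_conv3 T A0 B0) _.
  by rewrite mulrC.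
rewrite -mulrA; apply: (@le_trans _ _ ((1 / 2) ^+ (3 * q) * 2 ^+ q)).
  by rewrite ler_wpM2l ?exprn_ge0 //; clear; lra.
rewrite -[2 ^+ q]mulr1 half_exp2 mulnC exprM.
have ex : e%:R <= 2 ^+ q :> R by rewrite -natrX ler_nat.
have x2 : 2 <= 2 ^+ q :> R by rewrite -[X in X <= _]expr1 ler_eXn2l //; clear; lra.
rewrite mulr1; set x := 2 ^+ q in x0 ex x2 *.
rewrite mulrC ler_pdivrMr ?exprn_gt0 //.
have -> : e%:R^-1 / 2 * x ^+ 3 = (x ^+ 3 / 2) / e%:R by field; rewrite lt0r_neq0.
rewrite ler_pdivlMr //; apply: (@le_trans _ _ (x * x)); first by rewrite ler_pM2l.
have : 0 <= x * x * (x - 2) by rewrite !mulr_ge0 ?subr_ge0 // ltW.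
by rewrite !exprS expr0; clear; lra.
Qed.

End BogolyubovSanders.

(** * Sifting: from a large moment to a dense coset *)

Section Sifting.
Variables (R : realType) (m : nat).
Local Notation E := 'rV['F_2]_m.
Local Notation N := (#|E|%:R : R).
Implicit Types (X Y : {set E}).

Definition rep X Y z : R := conv (ind R X) (ind R Y) z.

Lemma rep_ge0 X Y z : 0 <= rep X Y z.
Proof. by apply: sumr_ge0 => x _; rewrite mulr_ge0 ?ind_ge0. Qed.

Lemma repC X Y z : rep X Y z = rep Y X z.
Proof.
rewrite /rep /conv -[LHS](sum_shift z); apply: eq_bigr => x _.
by rewrite [x + z]addrC addKv mulrC.
Qed.

Lemma sum_rep X Y (phi : E -> R) :
  \sum_z phi z * rep X Y z = \sum_(x in X) \sum_(y in Y) phi (x + y).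
Proof.
rewrite -sum_ind /rep /conv; under eq_bigr do rewrite mulr_sumr.
rewrite exchange_big; apply: eq_bigr => x _.
rewrite -sum_ind mulr_sumr -(sum_shift x); apply: eq_bigr => y _.
rewrite addvK [x + y]addrC; ring.
Qed.

Definition sieve p X (s : {ffun 'I_p -> E}) : {set E} :=
  [set x | [forall i, x + s i \in X]].

Lemma ind_sieve p X (s : {ffun 'I_p -> E}) x :
  ind R (sieve X s) x = \prod_i ind R X (x + s i).
Proof.
rewrite /ind inE; have [/forallP H|/forallPn[i Hi]] := boolP [forall i, x + s i \in X].
  by rewrite big1 // => i _; rewrite H.
by rewrite (bigD1 i) //= (negbTE Hi) mul0r.
Qed.

(** Dependent random choice. There are [rep X Y (x + y)] shifts [u] with [x + u] in [X] and [y + u]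
    in [Y], so [p] independent shifts weight the pair by the [p]-th power, and sums with many
    representations dominate. *)
Lemma sum_sieve p X Y (phi : E -> R) :
  \sum_(s : {ffun 'I_p -> E}) \sum_(x in sieve X s) \sum_(y in sieve Y s) phi (x + y)
    = N * \sum_z phi z * rep X Y z ^+ p.
Proof.
transitivity (\sum_x \sum_y phi (x + y) * rep X Y (x + y) ^+ p); last first.
  rewrite mulr_natl -sumr_const; apply: eq_bigr => x _.
  by rewrite (sum_shiftl x (fun z => phi z * rep X Y z ^+ p)).
under eq_bigr do rewrite -sum_ind.
rewrite exchange_big; apply: eq_bigr => x _.
under eq_bigr do rewrite -sum_ind mulr_sumr.
rewrite exchange_big; apply: eq_bigr => y _.
have -> : rep X Y (x + y) = \sum_u ind R X (x + u) * ind R Y (y + u).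
  rewrite /rep /conv -(sum_shiftl x); apply: eq_bigr => u _.
  by rewrite addrA [x + y]addrC -[y + x + x]addrA addvv addr0.
rewrite -[p in RHS]card_ord -prodr_const bigA_distr_bigA mulr_sumr /=.
apply: eq_bigr => s _; rewrite !ind_sieve big_split /=; ring.
Qed.

(** The ratio of the bases is at most [1 - eps / 3], hence at most [expR (- (eps / 3))], so every
    block of [3 * e] factors gains [expR (- 1) <= 1 / 2]. *)
Lemma sieve_decay (eps : R) (e M : nat) : 0 < eps -> eps <= 1 / 2 -> 1 <= e%:R * eps ->
  (1 + eps / 2) ^+ (3 * e * M) * 2 ^+ M <= (1 + eps) ^+ (3 * e * M).
Proof.
move=> e0 e2 e1; rewrite [in X in X <= _]exprM [in X in _ <= X]exprM -exprMn.
apply: lerXn2r; rewrite ?nnegrE ?mulr_ge0 ?exprn_ge0 //; try lra.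
have H1 : 1 + eps / 2 <= (1 + eps) * (1 - eps / 3) by nra.
have H2 : (1 - eps / 3) ^+ (3 * e) * 2 <= 1.
  suff : (1 - eps / 3) ^+ (3 * e) <= 1 / 2 by lra.
  apply: (@le_trans _ _ (expR (- (eps / 3)) ^+ (3 * e))).
    apply: lerXn2r; rewrite ?nnegrE ?expR_ge0 //; first by lra.
    exact: expR_ge1Dx.
  rewrite -expRM_natr; apply: (@le_trans _ _ (expR (- 1))).
    by rewrite ler_expR natrM; lra.
  by have := expRN_nat R 1; rewrite expr1.
have d0 : 0 <= (1 - eps / 3) ^+ (3 * e) by rewrite exprn_ge0 //; lra.
apply: (@le_trans _ _ (((1 + eps) * (1 - eps / 3)) ^+ (3 * e) * 2)).
  by rewrite ler_pM2r //; apply: lerXn2r; rewrite ?nnegrE ?mulr_ge0 //; lra.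
by rewrite exprMn -mulrA ler_piMr // exprn_ge0 //; lra.
Qed.

Lemma ten_mul_le_exp e : (0 < e -> 10 * e <= 2 ^ (4 * e))%N.
Proof.
rewrite expnM; case: e => // e _; elim: e => [//|e IH].
rewrite [((2 ^ 4) ^ e.+2)%N]expnS; apply: (@leq_trans (2 ^ 4 * (10 * e.+1))); last first.
  by rewrite leq_mul2l IH orbT.
by rewrite (_ : 2 ^ 4 = 16)%N //; lia.
Qed.

(** The tolerance [1 / (10 * e)] makes the loss in [bogolyubov] equal to [2 / (10 * e) <= eps / 5].
    The sieved pair has density at least [2 ^- (M1 + 3 * e * M1 * M2)], which the second argument
    rounds. *)
Definition sift_codim (e M1 M2 : nat) := bogolyubov_codim (10 * e) (4 * e * M1 * M2).

(** Let [T] be where [rep] is at least [1 + eps / 2] times its mean [wbar]. The moment gives the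
    complement of [T] little weight, so some sieved pair is dense and has nearly all its sums in
    [T]. [bogolyubov] finds a coset where [T] has density [1 - eps / 5], and [(1 - eps / 5) * (1 +
    eps / 2) >= 1 + eps / 5]. *)
Lemma sift X Y (eps th : R) (e M1 M2 : nat) :
  0 < eps -> eps <= 1 / 5 -> 1 <= e%:R * eps -> 0 < th ->
  (0 < M1)%N -> (0 < M2)%N -> 20 * e%:R <= th * 2 ^+ M1 ->
  N ^+ 2 <= #|X|%:R * #|Y|%:R * 2 ^+ M2 ->
  let wbar := #|X|%:R * #|Y|%:R / N in
  N * th * ((1 + eps) * wbar) ^+ (3 * e * M1) <= \sum_z rep X Y z ^+ (3 * e * M1) ->
  exists (V : {vspace E}) v, (m <= \dim V + sift_codim e M1 M2)%N /\
    (1 + eps / 5) * wbar * #|V|%:R <= \sum_(z in coset V v) rep X Y z.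
Proof.
move=> eps0 eps5 e1 th0 M10 M20 thM XYM wbar H.
have N0 := N_gt0 R m.
have e0 : (0 < e)%N.
  by case: e e1 {thM H} => //; rewrite mul0r ler10.
have eR : 0 < e%:R :> R by rewrite ltr0n.
have einv : e%:R^-1 <= eps by rewrite -[X in X <= _]mul1r ler_pdivrMr // mulrC.
have XY0 : 0 < #|X|%:R * #|Y|%:R :> R.
  rewrite lt0r mulr_ge0 ?andbT //; apply/eqP => XY0.
  by move: XYM; rewrite XY0 mul0r leNgt exprn_gt0.
have w0 : 0 < wbar by rewrite divr_gt0.
set p := (3 * e * M1)%N in H.
pose T := [set z | (1 + eps / 2) * wbar <= rep X Y z].
pose tot := N * \sum_z rep X Y z ^+ p.
have totlb : N * (N * th * ((1 + eps) * wbar) ^+ p) <= tot by rewrite ler_pM2l.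
have decay := @sieve_decay eps e M1 eps0 (_ : eps <= 1 / 2) e1.
have {}decay : 20 * e%:R * ((1 + eps / 2) * wbar) ^+ p <= th * ((1 + eps) * wbar) ^+ p.
  rewrite ![(_ * wbar) ^+ _]exprMn !mulrA ler_pM2r ?exprn_gt0 //.
  have z0 : 0 < (1 + eps / 2) ^+ p by rewrite exprn_gt0 //; lra.
  apply: (@le_trans _ _ (th * 2 ^+ M1 * (1 + eps / 2) ^+ p)); first by rewrite ler_pM2r.
  rewrite -mulrA ler_pM2l // mulrC; apply: decay; lra.
pose bad := N * \sum_(z | z \notin T) rep X Y z ^+ p.
have badub : bad * (20 * e%:R) <= tot.
  apply: le_trans totlb; rewrite /bad -mulrA ler_pM2l // -mulrA.
  apply: (@le_trans _ _ (N * ((1 + eps / 2) * wbar) ^+ p * (20 * e%:R))); last first.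
    by rewrite -mulrA ler_pM2l // mulrC.
  rewrite ler_pM2r ?mulr_gt0 // mulr_natl -sumr_const.
  rewrite [X in _ <= X](bigID (fun z => z \notin T)) /= -[X in X <= _]addr0 lerD //.
    apply: ler_sum => z; rewrite inE -ltNge => /ltW ?.
    by apply: lerXn2r; rewrite ?nnegrE ?rep_ge0 // mulr_ge0 ?ltW //; lra.
  by apply: sumr_ge0 => z _; rewrite exprn_ge0 // mulr_ge0 ?ltW //; lra.
pose theta := th / (20 * e%:R) * (wbar / N) ^+ p.
have thetaub : N ^+ p * (theta * N ^+ 2) * (20 * e%:R) <= tot.
  apply: le_trans totlb; rewrite /theta exprMn exprVn.
  rewrite (_ : _ * _ = N ^+ 2 * th * wbar ^+ p); last first.
    by field; rewrite !lt0r_neq0 // exprn_gt0.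
  rewrite expr2 -!mulrA ler_pM2l // ler_pM2l // ler_pM2l //.
  apply: lerXn2r; rewrite ?nnegrE; [exact: ltW| |].
    by apply: mulr_ge0; [lra | exact: ltW].
  by apply: ler_peMl; [exact: ltW | lra].
(* Size and purity of the sieved pair are needed for the same [s], so one function combines them.
   Its sum over [s] is nonnegative because the bad pairs and the [theta] term each take at most half
   of [tot]. *)
pose f (s : {ffun 'I_p -> E}) := \sum_(x in sieve X s) \sum_(y in sieve Y s)
  (1 - 10 * e%:R * (x + y \notin T)%:R) - 10 * e%:R * (theta * N ^+ 2).
have [s fs] : exists s, 0 <= f s.
  apply/existsP; apply: contraT => /existsPn Hf; suff : 0 <= \sum_s f s.
    rewrite leNgt => /negP[]; rewrite (bigD1 [ffun=> 0]) //= -[X in _ < X]addr0.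
    by rewrite ltr_leD ?sumr_le0 // => [|s _]; rewrite ?ltW // ltNge Hf.
  rewrite /f big_split /= (sum_sieve _ X Y (fun z => 1 - 10 * e%:R * (z \notin T)%:R)).
  rewrite sumr_const -[X in _ + X]mulr_natl.
  have -> : #|{: {ffun 'I_p -> E}}|%:R = N ^+ p by rewrite card_ffun card_ord natrX.
  have -> : N * \sum_z (1 - 10 * e%:R * (z \notin T)%:R) * rep X Y z ^+ p =
     tot - 10 * e%:R * bad.
    rewrite /tot /bad [in X in _ = _ - X]big_mkcond /= [10 * _ * _]mulrCA -mulrBr.
    congr (_ * _); rewrite mulr_sumr -sumrB; apply: eq_bigr => z _; case: (z \notin T) => /=; ring.
  lra.
set A := sieve X s; set B := sieve Y s.
have AB : 10 * e%:R * (theta * N ^+ 2 + \sum_(x in A) \sum_(y in B) (x + y \notin T)%:R)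
    <= #|A|%:R * #|B|%:R.
  rewrite -subr_ge0; apply: le_trans fs _; rewrite /f -/A -/B le_eqVlt; apply/orP; left; apply/eqP.
  under eq_bigr do rewrite sumrB -mulr_sumr sumr_const.
  rewrite sumrB -mulr_sumr sumr_const -mulrnA mulnC natrM; ring.
have bad0 : 0 <= \sum_(x in A) \sum_(y in B) (x + y \notin T)%:R :> R.
  by apply: sumr_ge0 => x _; apply: sumr_ge0.
have theta0 : 0 < theta.
  apply: mulr_gt0; first by rewrite divr_gt0 // mulr_gt0.
  by rewrite exprn_gt0 // divr_gt0.
set Q := (4 * e * M1 * M2)%N.
have Q0 : (0 < Q)%N by rewrite !muln_gt0 e0 M10.
have eQ : (10 * e <= 2 ^ Q)%N.
  apply: (@leq_trans (2 ^ (4 * e))); first exact: ten_mul_le_exp.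
  by rewrite leq_exp2l // /Q -mulnA leq_pmulr // muln_gt0 M10.
have thetaQ : 1 <= theta * 2 ^+ Q.
  apply: (@le_trans _ _ (theta * 2 ^+ (M1 + M2 * p))); last first.
    rewrite ler_pM2l // ler_eXn2l ?ltr1n // /Q /p.
    rewrite (_ : (4 * e * M1 * M2 = e * M2 * M1 + M2 * (3 * e * M1))%N); last by ring.
    by rewrite leq_add2r leq_pmull // muln_gt0 e0.
  rewrite exprD exprM /theta mulrACA -exprMn.
  have h1 : 1 <= th / (20 * e%:R) * 2 ^+ M1.
    by rewrite mulrAC ler_pdivlMr ?mul1r // mulr_gt0.
  have h2 : 1 <= wbar / N * 2 ^+ M2.
    rewrite -(ler_pM2r (exprn_gt0 2 N0)) mul1r; apply: le_trans XYM _.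
    by rewrite le_eqVlt; apply/orP; left; apply/eqP; rewrite /wbar; field; rewrite lt0r_neq0.
  by rewrite -[X in X <= _]mulr1 ler_pM // exprn_ege1.
have e10 : (0 < 10 * e)%N by rewrite muln_gt0.
have e10R : 10 <= 10 * e%:R :> R by rewrite ler_peMr // ler1n.
have h1 : N ^+ 2 <= #|A|%:R * #|B|%:R * 2 ^+ Q.
  have : 1 * N ^+ 2 <= theta * 2 ^+ Q * N ^+ 2 by rewrite ler_pM2r ?exprn_gt0.
  rewrite mul1r => /le_trans; apply; rewrite mulrAC ler_pM2r ?exprn_gt0 //.
  apply: le_trans AB; have : 0 < theta * N ^+ 2 by rewrite mulr_gt0 ?exprn_gt0.
  by move: (theta * _) bad0; set S := \sum_(x in A) _; move=> y; nra.
have h2 : (1 - (10 * e)%:R^-1) * (#|A|%:R * #|B|%:R)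
    <= \sum_(b in B) \sum_(a in A) ind R T (b + a).
  have -> : \sum_(b in B) \sum_(a in A) ind R T (b + a) =
    #|A|%:R * #|B|%:R - \sum_(x in A) \sum_(y in B) (x + y \notin T)%:R.
    rewrite exchange_big /= -natrM mulnC natrM mulr_natr -sumr_const -sumrB.
    apply: eq_bigr => a _; rewrite -sumr_const -sumrB; apply: eq_bigr => b _.
    by rewrite /ind addrC; case: (_ \in T); rewrite ?subr0 ?subrr.
  rewrite natrM mulrBl mul1r lerD2l lerN2 mulrC ler_pdivlMr; last by rewrite mulr_gt0.
  apply: le_trans AB; rewrite mulrC ler_pM2l ?mulr_gt0 // lerDr mulr_ge0 ?ltW //.
  by rewrite exprn_gt0.
have [V [v [dimV HV]]] := bogolyubov e10 Q0 eQ h1 h2.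
exists V, v; split=> //.
have HV' : (1 - eps / 5) * #|V|%:R <= #|T :&: coset V v|%:R.
  apply: le_trans HV; rewrite ler_wpM2r // lerD2l lerN2 natrM invfM; lra.
apply: (@le_trans _ _ (#|T :&: coset V v|%:R * ((1 + eps / 2) * wbar))).
  apply: (@le_trans _ _ ((1 - eps / 5) * #|V|%:R * ((1 + eps / 2) * wbar))).
    rewrite (_ : (1 - _) * _ * _ = ((1 - eps / 5) * (1 + eps / 2)) * wbar * #|V|%:R); last by ring.
    by rewrite ler_wpM2r // ler_pM2r //; clear -eps0 eps5; nra.
  by rewrite ler_wpM2r // mulr_ge0 ?ltW //; clear -eps0; lra.
rewrite mulr_natl -sumr_const [X in _ <= X](bigID (mem T)) /= -[X in X <= _]addr0 lerD //.
  rewrite [X in _ <= X](eq_bigl (fun z => z \in T :&: coset V v)); last first.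
    by move=> z; rewrite in_setI andbC.
  by apply: ler_sum => z; rewrite in_setI inE => /andP[].
by apply: sumr_ge0 => z _; exact: rep_ge0.
Qed.

End Sifting.

(** * Density increments, moments of convolutions, unbalancing *)

Section Increments.
Variables (R : realType) (m : nat).
Local Notation E := 'rV['F_2]_m.
Local Notation N := (#|E|%:R : R).
Implicit Types (X Y D : {set E}) (f g u : E -> R).

Definition has_increment (K : nat) (c : R) X : Prop :=
  exists (V : {vspace E}) v, (m <= \dim V + K)%N /\
    c * #|X|%:R / N * #|V|%:R <= #|X :&: coset V v|%:R.

Lemma sum_const_space (c : R) : \sum_(z : E) c = N * c.
Proof. by rewrite sumr_const mulr_natl. Qed.

Lemma sum_coset_rep X Y (V : {vspace E}) v :
  \sum_(z in coset V v) rep R X Y z = \sum_(x in X) #|Y :&: coset V (v + x)|%:R.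
Proof.
rewrite -sum_ind sum_rep; apply: eq_bigr => x _.
rewrite -sum_ind1 big_mkcond; apply: eq_bigr => y _.
rewrite /ind in_setI !mem_coset !oppv [x + y]addrC -addrA [x + v]addrC.
by case: (y \in Y).
Qed.

Lemma rep_increment X Y (V : {vspace E}) v (c : R) : X != set0 ->
  c * (#|X|%:R * #|Y|%:R / N) * #|V|%:R <= \sum_(z in coset V v) rep R X Y z ->
  exists v', c * #|Y|%:R / N * #|V|%:R <= #|Y :&: coset V v'|%:R.
Proof.
move=> /set0Pn[x0 x0X] H; apply/existsP; apply: contraTT H => /existsPn H.
rewrite -ltNge sum_coset_rep.
rewrite (_ : c * _ * _ = \sum_(x in X) c * #|Y|%:R / N * #|V|%:R).
  apply: ltr_sum => [|x _]; last by rewrite ltNge H.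
  by apply/hasP; exists x0; rewrite ?mem_index_enum.
by rewrite sumr_const -[RHS]mulr_natl; ring.
Qed.

(** [rep] is symmetric, so the coset from [sift] gives an increment of both sets. Hence spreadness
    of just one of them excludes an excess in the count. *)
Lemma sift_increment X Y (eps th : R) (e M1 M2 : nat) :
  0 < eps -> eps <= 1 / 5 -> 1 <= e%:R * eps -> 0 < th ->
  (0 < M1)%N -> (0 < M2)%N -> 20 * e%:R <= th * 2 ^+ M1 ->
  N ^+ 2 <= #|X|%:R * #|Y|%:R * 2 ^+ M2 ->
  N * th * ((1 + eps) * (#|X|%:R * #|Y|%:R / N)) ^+ (3 * e * M1)
    <= \sum_z rep R X Y z ^+ (3 * e * M1) ->
  has_increment (sift_codim e M1 M2) (1 + eps / 5) X /\
  has_increment (sift_codim e M1 M2) (1 + eps / 5) Y.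
Proof.
move=> eps0 eps5 e1 th0 M10 M20 thM XYM H.
have nz (X' Y' : {set E}) : N ^+ 2 <= #|X'|%:R * #|Y'|%:R * 2 ^+ M2 -> X' != set0.
  by apply: contraTneq => ->; rewrite cards0 !mul0r -ltNge exprn_gt0 // N_gt0.
have X0 := nz _ _ XYM.
have Y0 : Y != set0 by apply: (nz Y X); rewrite [_ * #|X|%:R]mulrC.
have [V [v [dimV HV]]] := sift eps0 eps5 e1 th0 M10 M20 thM XYM H.
split.
  have [|v' Hv'] := @rep_increment Y X V v (1 + eps / 5) Y0; last by exists V, v'.
  rewrite [#|Y|%:R * _]mulrC; apply: le_trans HV _.
  by rewrite le_eqVlt; apply/orP; left; apply/eqP; apply: eq_bigr => z _; exact: repC.
by have [v' Hv'] := rep_increment X0 HV; exists V, v'.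
Qed.

(** An excess over [D] becomes, by the power mean over [D], a large moment over the whole space with
    [th] the density of [D]. *)
Lemma upper_count X Y D (eps : R) (e M1 M2 : nat) :
  0 < eps -> eps <= 1 / 5 -> 1 <= e%:R * eps ->
  (0 < M1)%N -> (0 < M2)%N -> 20 * e%:R * N <= #|D|%:R * 2 ^+ M1 ->
  N ^+ 2 <= #|X|%:R * #|Y|%:R * 2 ^+ M2 ->
  (1 + eps) * (#|X|%:R * #|Y|%:R / N) * #|D|%:R <= \sum_(z in D) rep R X Y z ->
  has_increment (sift_codim e M1 M2) (1 + eps / 5) X /\
  has_increment (sift_codim e M1 M2) (1 + eps / 5) Y.
Proof.
move=> eps0 eps5 e1 M10 M20 DM XYM H.
have N0 := N_gt0 R m.
have e0 : 0 < e%:R :> R.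
  by rewrite lt0r ler0n andbT; apply/eqP => e0; move: e1; rewrite e0 mul0r ler10.
have D0 : 0 < #|D|%:R :> R.
  rewrite lt0r ler0n andbT; apply/eqP => D0; move: DM.
  by rewrite D0 mul0r leNgt !mulr_gt0.
apply: (@sift_increment X Y eps (#|D|%:R / N)) => //; first exact: divr_gt0.
  by rewrite mulrAC ler_pdivlMr.
rewrite [N * _]mulrC divfK ?lt0r_neq0 //.
apply: (@le_trans _ _ (\sum_(z in D) rep R X Y z ^+ (3 * e * M1))).
  apply: power_mean; first by rewrite mulr_ge0 ?divr_ge0 ?mulr_ge0 //; lra.
    by move=> z _; exact: rep_ge0.
  by rewrite mulrC.
rewrite [X in _ <= X](bigID (mem D)) /= lerDl sumr_ge0 // => z _.
by rewrite exprn_ge0 ?rep_ge0.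
Qed.

(** Expanding the [p]-th power of a convolution gives an inner product of these correlations over
    [p]-tuples. So all moments of a self-convolution are nonnegative, odd ones included, and
    Cauchy-Schwarz separates [f] from [g]. *)
Definition translates p f (x : {ffun 'I_p -> E}) : R := \sum_t \prod_i f (t + x i).

Lemma sum_conv_exp p f g :
  N * \sum_z conv f g z ^+ p
    = \sum_(x : {ffun 'I_p -> E}) translates f x * translates g x.
Proof.
transitivity (\sum_t \sum_s conv f g (t + s) ^+ p).
  rewrite mulr_natl -sumr_const; apply: eq_bigr => t _.
  by rewrite (sum_shiftl t (fun z => conv f g z ^+ p)).
under [RHS]eq_bigr do rewrite big_distrlr /=.
rewrite [RHS]exchange_big; apply: eq_bigr => t _.
rewrite [RHS]exchange_big; apply: eq_bigr => s _.
have -> : conv f g (t + s) = \sum_y f (t + y) * g (s + y).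
  rewrite /conv -(sum_shiftl t); apply: eq_bigr => y _.
  by rewrite addrA [t + s]addrC -[s + t + t]addrA addvv addr0.
rewrite -[p in LHS]card_ord -prodr_const bigA_distr_bigA /=.
by apply: eq_bigr => x _; rewrite big_split.
Qed.

Lemma sum_conv_self_ge0 p f : 0 <= \sum_z conv f f z ^+ p.
Proof.
rewrite -(pmulr_rge0 _ (N_gt0 R m)) sum_conv_exp.
by apply: sumr_ge0 => x _; exact: sqr_ge0.
Qed.

Lemma conv_decoupling p f g :
  (\sum_z conv f g z ^+ p) ^+ 2
    <= (\sum_z conv f f z ^+ p) * (\sum_z conv g g z ^+ p).
Proof.
have N0 := N_gt0 R m.
have N2 : 0 < N ^+ 2 by rewrite exprn_gt0.
rewrite -(ler_pM2l N2).
have : (N * \sum_z conv f g z ^+ p) ^+ 2 <=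
    (N * \sum_z conv f f z ^+ p) * (N * \sum_z conv g g z ^+ p).
  by rewrite !sum_conv_exp; exact: cauchy_schwarz.
move=> /le_trans H; rewrite -exprMn; apply: H.
by rewrite mulrACA.
Qed.

(* Moments of a function bounded below by -1 with nonnegative odd moments: a large even
   moment is converted into a large moment of 1 + u. *)
Lemma unbalancing u (a : R) (h k j : nat) : k = (2 * h.+1).+1 ->
  (forall z, -1 <= u z) -> 0 < a -> a <= 1 ->
  N * a ^+ (2 * h.+1) <= \sum_z u z ^+ (2 * h.+1) ->
  0 <= \sum_z u z ^+ k ->
  N * ((a ^+ 2 / 9) ^+ k / 256) * (1 + a / 4) ^+ (2 * k * j)
    <= \sum_z (1 + u z) ^+ (2 * k * j).
Proof.
move=> kE u1 a0 a1 Hp Hk; set p := (2 * h.+1)%N in Hp kE *.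
have N0 := N_gt0 R m.
have xk (x : R) : x ^+ k = x * x ^+ p by rewrite kE exprS.
have u1' z : 0 <= 1 + u z by have := u1 z; lra.
have evp z : u z ^+ p = `|u z| ^+ p.
  by rewrite /p !exprM -[u z ^+ 2]real_normK ?num_real.
(* Points with [|u z|] below [a / 2] contribute at most [N * a ^+ p / 4] to the even moment;
   elsewhere the extra factor [|u z|] is at least [a / 2]. Adding the nonnegative odd moment then
   isolates the positive part of [u]. *)
have abs_k : N * a ^+ k / 4 <= \sum_z `|u z| ^+ k.
  apply: (@le_trans _ _ (\sum_z (a / 2 * (u z ^+ p - (a / 2) ^+ p)))).
    rewrite -mulr_sumr sumrB sum_const_space.
    have q4 : (a / 2) ^+ p <= a ^+ p / 4.
      rewrite exprMn ler_pM2l ?exprn_gt0 // /p exprM -[X in _ <= X]expr1.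
      rewrite (_ : 2^-1 ^+ 2 = 4^-1 :> R); last by field.
      by rewrite ler_wiXn2l //; lra.
    have := ler_wpM2l (ltW N0) q4.
    rewrite xk; have ap : 0 < a ^+ p by rewrite exprn_gt0.
    move=> Hq; rewrite (_ : N * (a * a ^+ p) / 4 = a / 2 * (N * a ^+ p / 2)); last by field.
    rewrite ler_pM2l; last by lra.
    have : 0 <= N * a ^+ p by rewrite mulr_ge0 ?ltW.
    lra.
  apply: ler_sum => z _; rewrite evp.
  have [ge|lt] := lerP (a / 2) `|u z|.
    apply: (@le_trans _ _ (a / 2 * `|u z| ^+ p)).
      rewrite ler_wpM2l //; first by lra.
      by rewrite gerBl exprn_ge0 //; lra.
    by rewrite xk ler_wpM2r // exprn_ge0.
  apply: (@le_trans _ _ 0); last by rewrite exprn_ge0.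
  rewrite mulr_ge0_le0 //; first by lra.
  by rewrite subr_le0; apply: lerXn2r; rewrite ?nnegrE //; lra.
pose T := [set z | a / 4 <= u z].
have posT z : z \in T -> 0 < u z by rewrite inE => ?; lra.
have sumT : N * a ^+ k / 16 <= \sum_(z in T) u z ^+ k.
  have h1 : N * a ^+ k / 8 <= \sum_z (`|u z| ^+ k + u z ^+ k) / 2.
    by rewrite -mulr_suml big_split /=; lra.
  have h2 : \sum_z (`|u z| ^+ k + u z ^+ k) / 2 <=
      \sum_(z in T) u z ^+ k + N * (a / 4) ^+ k.
    rewrite (bigID (mem T)) /= lerD //.
      apply: ler_sum => z /posT uz; rewrite gtr0_norm //; lra.
    rewrite mulr_natl -sumr_const [X in _ <= X](bigID (mem T)) /= -[X in X <= _]add0r lerD //.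
      by apply: sumr_ge0 => z _; rewrite exprn_ge0 //; lra.
    apply: ler_sum => z; rewrite inE -ltNge => uz.
    have [u0|u0] := ger0P (u z).
      rewrite (_ : _ / 2 = u z ^+ k); last by field.
      by apply: lerXn2r; rewrite ?nnegrE //; lra.
    have -> : (- u z) ^+ k = - u z ^+ k by rewrite !xk evp ltr0_norm // /p exprM sqrrN -exprM mulNr.
    rewrite addNr mul0r exprn_ge0 //; lra.
  have h3 : (a / 4) ^+ k <= a ^+ k / 16.
    rewrite exprMn ler_pM2l ?exprn_gt0 // xk.
    have : 4^-1 ^+ p <= 4^-1 :> R by rewrite -[X in _ <= X]expr1 ler_wiXn2l //; lra.
    lra.
  have := ler_wpM2l (ltW N0) h3; lra.
(* If the moment of order [2 * k] is huge, [-1 <= u] forces its large values to be positive and the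
   power mean concludes. Otherwise Cauchy-Schwarz turns [sumT] into a lower bound on [#|T|]; the 256
   is the square of 16. *)
have [small|large] := lerP (\sum_z u z ^+ (2 * k)) (N * 9 ^+ k); last first.
  have big4 : N * 4 ^+ k <= \sum_z (1 + u z) ^+ (2 * k).
    apply: (@le_trans _ _ (\sum_z (u z ^+ (2 * k) - 1))).
      rewrite sumrB sum_const_space mulr1.
      have : (4 ^+ k + 1 <= 9 ^+ k :> R).
        rewrite kE; elim: (p) => [|q IH]; first by rewrite !expr1; lra.
        rewrite !(exprS _ q.+1); have : 0 < (4 : R) ^+ q.+1 by rewrite exprn_gt0.
        lra.
      move=> h9; have := ler_wpM2l (ltW N0) h9; lra.
    apply: ler_sum => z _; have [u0|u0] := lerP 0 (u z).
      apply: (@le_trans _ _ (u z ^+ (2 * k))); first by lra.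
      by apply: lerXn2r; rewrite ?nnegrE //; have := u1' z; lra.
    apply: (@le_trans _ _ 0); last by rewrite exprn_ge0.
    rewrite subr_le0 exprM exprn_ile1 ?sqr_ge0 //.
    by rewrite -real_normK ?num_real // exprn_ile1 // ltr0_norm //; have := u1 z; lra.
  have b4 : #|{: E}|%:R * 4 ^+ k <= \sum_z (1 + u z) ^+ (2 * k) by [].
  have := @power_mean R _ predT (fun z => (1 + u z) ^+ (2 * k)) (4 ^+ k) j
    (exprn_ge0 _ (ler0n _ 4)) (fun z _ => exprn_ge0 _ (u1' z)) b4.
  under eq_bigr do rewrite -exprM.
  apply: le_trans; have -> : #|predT : pred E|%:R = N by [].
  rewrite -mulrA ler_pM2l //.
  apply: (@le_trans _ _ (1 * 2 ^+ (2 * k * j))); last first.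
    by rewrite mul1r !exprM -natrX.
  apply: ler_pM; rewrite ?exprn_ge0 //; try lra.
  - by rewrite divr_ge0 // exprn_ge0 // divr_ge0 // sqr_ge0.
  - rewrite ler_pdivrMr // mul1r; apply: (@le_trans _ _ 1); last by lra.
    by rewrite exprn_ile1 ?divr_ge0 ?sqr_ge0 //; nra.
  - by apply: lerXn2r; rewrite ?nnegrE; lra.
have cardT : N * ((a ^+ 2 / 9) ^+ k / 256) <= #|T|%:R.
  have cs := cauchy_schwarz (fun z => z \in T) (fun=> 1) (fun z => u z ^+ k).
  have : (N * a ^+ k / 16) ^+ 2 <= #|T|%:R * (N * 9 ^+ k).
    apply: (@le_trans _ _ ((\sum_(z in T) u z ^+ k) ^+ 2)).
      apply: lerXn2r; rewrite ?nnegrE //.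
        by rewrite divr_ge0 ?mulr_ge0 ?exprn_ge0 // ltW.
      by apply: le_trans _ sumT; rewrite divr_ge0 ?mulr_ge0 ?exprn_ge0 // ltW.
    under eq_bigr do rewrite -[_ ^+ k]mul1r.
    apply: le_trans cs _; rewrite (eq_bigr (fun=> 1)) => [|z _]; last by rewrite expr1n.
    rewrite sumr_const ler_wpM2l //; apply: le_trans small.
    under eq_bigr do rewrite -exprM mulnC.
    rewrite [X in _ <= X](bigID (mem T)) /= lerDl sumr_ge0 // => z _.
    by rewrite exprM exprn_ge0 // sqr_ge0.
  have nine : 0 < 9 ^+ k :> R by rewrite exprn_gt0.
  move=> cs2; rewrite mulrA -(ler_pM2r (mulr_gt0 N0 nine)); apply: le_trans _ cs2.
  rewrite le_eqVlt; apply/orP; left; apply/eqP.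
  rewrite expr_div_n -!exprM mulnC exprM; field.
  by rewrite lt0r_neq0.
apply: (@le_trans _ _ (#|T|%:R * (1 + a / 4) ^+ (2 * k * j))).
  by rewrite ler_wpM2r // exprn_ge0 //; lra.
rewrite mulr_natl -sumr_const [X in _ <= X](bigID (mem T)) /= -[X in X <= _]addr0 lerD //.
  apply: ler_sum => z; rewrite inE => uz.
  by apply: lerXn2r; rewrite ?nnegrE //; lra.
by apply: sumr_ge0 => z _; rewrite exprn_ge0.
Qed.

End Increments.

(** * Lower and Fourier counting lemmas on a full space *)

Section Counting.
Variables (R : realType) (m : nat).
Local Notation E := 'rV['F_2]_m.
Local Notation N := (#|E|%:R : R).
Implicit Types (X Y D : {set E}).

Definition balanced X x : R := ind R X x - #|X|%:R / N.

Lemma conv_balanced X Y z :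
  conv (balanced X) (balanced Y) z = rep R X Y z - #|X|%:R * #|Y|%:R / N.
Proof.
have N0 := N_gt0 R m.
rewrite /conv /balanced.
rewrite (eq_bigr (fun x => ind R X x * ind R Y (z + x) - #|Y|%:R / N * ind R X x
   - #|X|%:R / N * ind R Y (z + x) + #|X|%:R / N * (#|Y|%:R / N))); last first.
  by move=> x _; ring.
rewrite big_split /= !sumrB sum_const_space -!mulr_sumr.
rewrite (sum_shiftl z (ind R Y)) !sum_ind1 -/(conv (ind R X) (ind R Y) z) -/(rep R X Y z).
by field; rewrite lt0r_neq0.
Qed.

(** [8 * e] matches the accuracy [eps / 8] left by [unbalancing]. The second argument is
    [2 * k * (2 * l + 11)] with [k = (2 * J).+1], enough bits to make up for the small [th] found
    there; [2 * M] belongs to the pair of [X] with itself. *)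
Definition lower_codim (e l J M : nat) :=
  sift_codim (8 * e) (2 * (2 * J).+1 * (2 * l + 11)) (2 * M).

(** The odd moments of a balanced self-convolution are nonnegative, so [unbalancing] applies to the
    relative deviation of [rep X X] with [a = eps / 2]. It yields an excess of [eps / 8], from which
    [sift_increment] gains [eps / 40]. *)
Lemma self_increment X (eps : R) (e l J M : nat) :
  0 < eps -> eps <= 1 / 5 -> 1 <= e%:R * eps -> (e <= 2 ^ l)%N ->
  (0 < J)%N -> (0 < M)%N -> N <= #|X|%:R * 2 ^+ M ->
  N * (eps / 2) ^+ (2 * J) <=
    \sum_z (conv (balanced X) (balanced X) z / (#|X|%:R * #|X|%:R / N)) ^+ (2 * J) ->
  has_increment (lower_codim e l J M) (1 + eps / 40) X.
Proof.
move=> eps0 eps5 e1 el; case: J => // h _ M0 XM H.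
have N0 := N_gt0 R m.
have X0 : 0 < #|X|%:R :> R.
  rewrite lt0r ler0n andbT; apply/eqP => X0; move: XM.
  by rewrite X0 mul0r leNgt N0.
set w := _ / N in H; have w0 : 0 < w by rewrite divr_gt0 ?mulr_gt0.
set k := (2 * h.+1).+1; set u := fun z => conv (balanced X) (balanced X) z / w.
have uE z : 1 + u z = rep R X X z / w.
  rewrite /u conv_balanced -/w; field; exact: lt0r_neq0.
have u1 z : -1 <= u z.
  by rewrite -subr_ge0 opprK addrC uE divr_ge0 ?rep_ge0 ?ltW.
have a0 : 0 < eps / 2 by lra.
have a1 : eps / 2 <= 1 by lra.
have odd_ge0 : 0 <= \sum_z u z ^+ k.
  under eq_bigr do rewrite expr_div_n.
  by rewrite -mulr_suml mulr_ge0 ?sum_conv_self_ge0 // invr_ge0 exprn_ge0 // ltW.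
(* Chosen so that the exponent [2 * k * j] of [unbalancing] is the exponent [3 * (8 * e) * M1] that
   the sieve requires. *)
pose j := (24 * e * (2 * l + 11))%N.
have := @unbalancing R m u (eps / 2) h k j erefl u1 a0 a1 H odd_ge0.
under [X in _ <= X -> _]eq_bigr do rewrite uE expr_div_n.
rewrite -mulr_suml; set th := (_ / 256) => U.
have e0 : (0 < e)%N by case: e e1 {el j U} => //; rewrite mul0r ler10.
pose M1 := (2 * k * (2 * l + 11))%N.
have pE : (2 * k * j = 3 * (8 * e) * M1)%N by rewrite /j /M1; ring.
have th0 : 0 < th by rewrite divr_gt0 // exprn_gt0 // divr_gt0 // exprn_gt0.
rewrite (_ : 1 + eps / 40 = 1 + (eps / 8) / 5); last by field.
have [|||||||||HX _] := @sift_increment R m X X (eps / 8) th (8 * e) M1 (2 * M).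
- lra.
- lra.
- rewrite natrM; lra.
- exact: th0.
- by rewrite /M1 !muln_gt0 addn_gt0 orbT.
- by rewrite muln_gt0.
- have -> : 2 ^+ M1 = (2 ^+ (4 * l + 22)) ^+ k :> R.
    by rewrite -exprM; congr (_ ^+ _); rewrite /M1; ring.
  have -> : th * (2 ^+ (4 * l + 22)) ^+ k =
      ((eps / 2) ^+ 2 / 9 * 2 ^+ (4 * l + 22)) ^+ k / 256.
    by rewrite [(_ * 2 ^+ _) ^+ k]exprMn /th; ring.
  have l0 : 0 < 2 ^+ l :> R by rewrite exprn_gt0.
  have el2 : e%:R <= 2 ^+ l :> R by rewrite -natrX ler_nat.
  have epsl : 1 <= eps * 2 ^+ l.
    by apply: le_trans e1 _; rewrite mulrC ler_pM2l.
  have base : 2 ^+ l * 2 ^+ 16 <= (eps / 2) ^+ 2 / 9 * 2 ^+ (4 * l + 22).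
    have -> : (2 : R) ^+ (4 * l + 22) = (2 ^+ l) ^+ 4 * 2 ^+ 22.
      by rewrite exprD mulnC exprM.
    have h22 : 2 ^+ 16 <= 2 ^+ 22 / 36 :> R.
      rewrite (exprD _ 16 6) -mulrA ler_peMr ?exprn_ge0 //.
      by rewrite ler_pdivlMr // mul1r -natrX ler_nat.
    move: (2 ^+ 22 : R) (2 ^+ 16 : R) (exprn_ge0 16 (ler0n R 2)) h22 => c d d0 h22.
    have -> : (eps / 2) ^+ 2 / 9 * ((2 ^+ l) ^+ 4 * c) =
      (eps * 2 ^+ l) ^+ 2 * (2 ^+ l) ^+ 2 * (c / 36) by field.
    have l1 : 1 <= 2 ^+ l :> R by rewrite exprn_ege1 // ler1n.
    apply: ler_pM => //; first exact: ltW.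
    apply: (@le_trans _ _ (1 * (2 ^+ l) ^+ 2)); first by rewrite mul1r expr2 ler_peMr // ltW.
    by apply: ler_wpM2r; rewrite ?sqr_ge0 // exprn_ege1.
  have big : 2 ^+ l * 2 ^+ 16 <= ((eps / 2) ^+ 2 / 9 * 2 ^+ (4 * l + 22)) ^+ k.
    have l1 : 1 <= 2 ^+ l :> R by rewrite exprn_ege1 // ler1n.
    apply: (le_trans base); rewrite -[X in X <= _]expr1 ler_weXn2l //.
    apply: le_trans _ base; rewrite -[X in X <= _]mulr1; apply: ler_pM => //.
    by rewrite exprn_ege1 // ler1n.
  rewrite natrM ler_pdivlMr //; apply: le_trans big.
  have -> : (2 ^+ 16 : R) = 256 * 256 by rewrite (exprD _ 8 8) -natrX.
  lra.
- rewrite mulnC exprM -[X in _ <= X * _]expr2 -exprMn.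
  by apply: lerXn2r; rewrite ?nnegrE // mulr_ge0 ?exprn_ge0.
- rewrite -pE -/w [(_ * w) ^+ _]exprMn mulrA -ler_pdivlMr ?exprn_gt0 //.
  by apply: le_trans U; rewrite (_ : eps / 2 / 4 = eps / 8) //; field.
- exact: HX.
Qed.

(** The sieve detects only excesses, whereas here [rep] is too small. The deficit makes an even
    moment of the balanced convolution large; with exponent [2 * J] the density of [D] costs at most
    a factor 2 in the base. Cauchy-Schwarz passes the moment to [X] with itself or [Y] with itself,
    where it can be unbalanced into an excess. *)
Lemma lower_count X Y D (eps : R) (e l J M : nat) :
  0 < eps -> eps <= 1 / 5 -> 1 <= e%:R * eps -> (e <= 2 ^ l)%N ->
  (0 < J)%N -> (0 < M)%N -> N <= #|D|%:R * 2 ^+ J ->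
  N <= #|X|%:R * 2 ^+ M -> N <= #|Y|%:R * 2 ^+ M ->
  \sum_(z in D) rep R X Y z <= (1 - eps) * (#|X|%:R * #|Y|%:R / N) * #|D|%:R ->
  has_increment (lower_codim e l J M) (1 + eps / 40) X \/
  has_increment (lower_codim e l J M) (1 + eps / 40) Y.
Proof.
move=> eps0 eps5 e1 el J0 M0 DJ XM YM H.
have N0 := N_gt0 R m.
have pos (Z : {set E}) K : N <= #|Z|%:R * 2 ^+ K -> 0 < #|Z|%:R :> R.
  move=> ZK; rewrite lt0r ler0n andbT; apply/eqP => Z0; move: ZK.
  by rewrite Z0 mul0r leNgt N0.
have [X0 Y0] := (pos _ _ XM, pos _ _ YM).
set w := (_ / N) in H; have w0 : 0 < w by rewrite divr_gt0 ?mulr_gt0.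
have wX : 0 < #|X|%:R * #|X|%:R / N :> R by rewrite divr_gt0 ?mulr_gt0.
have wY : 0 < #|Y|%:R * #|Y|%:R / N :> R by rewrite divr_gt0 ?mulr_gt0.
pose u X Y z := conv (balanced X) (balanced Y) z / (#|X|%:R * #|Y|%:R / N).
have moment : N * (eps / 2) ^+ (2 * J) <= \sum_z u X Y z ^+ (2 * J).
  pose g z := Num.max 0 (- u X Y z).
  have g0 z : 0 <= g z by rewrite le_max lexx.
  have gD : #|D|%:R * eps <= \sum_(z in D) g z.
    apply: (@le_trans _ _ (\sum_(z in D) (1 - rep R X Y z / w))).
      rewrite sumrB sumr_const -mulr_suml lerBrDr -lerBrDl ler_pdivrMr //.
      by rewrite -[#|D|%:R]/(#|D|%:R); apply: le_trans H _; lra.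
    apply: ler_sum => z _; rewrite le_max; apply/orP; right.
    rewrite /u conv_balanced -/w le_eqVlt; apply/orP; left; apply/eqP; field.
    exact: lt0r_neq0.
  have pm := power_mean (2 * J) (ltW eps0) (fun z _ => g0 z) gD.
  apply: (@le_trans _ _ (#|D|%:R * eps ^+ (2 * J))).
    rewrite exprMn [X in N * X]mulrC mulrA ler_wpM2r //; first by rewrite exprn_ge0 // ltW.
    apply: (@le_trans _ _ (N / 2 ^+ J)); last by rewrite ler_pdivrMr ?exprn_gt0.
    rewrite ler_pM2l // exprVn lef_pV2 ?posrE ?exprn_gt0 //.
    by rewrite ler_eXn2l ?ltr1n // leq_pmull.
  apply: le_trans pm _; rewrite [X in _ <= X](bigID (mem D)) /= -[X in X <= _]addr0 lerD //.
    apply: ler_sum => z _; rewrite !exprM; apply: lerXn2r; rewrite ?nnegrE ?sqr_ge0 //.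
    by rewrite /g; case: (lerP 0 (- u X Y z)) => _; rewrite ?sqrrN // expr0n sqr_ge0.
  by apply: sumr_ge0 => z _; rewrite exprM exprn_ge0 ?sqr_ge0.
have cs : (\sum_z u X Y z ^+ (2 * J)) ^+ 2 <=
    (\sum_z u X X z ^+ (2 * J)) * (\sum_z u Y Y z ^+ (2 * J)).
  have uS Z Z' : \sum_z u Z Z' z ^+ (2 * J) =
     (\sum_z conv (balanced Z) (balanced Z') z ^+ (2 * J)) *
       ((#|Z|%:R * #|Z'|%:R / N) ^+ (2 * J))^-1.
    by rewrite mulr_suml; apply: eq_bigr => z _; rewrite /u expr_div_n.
  rewrite !uS [(_ * _) ^+ 2]exprMn [X in _ <= X]mulrACA.
  rewrite (_ : ((#|X|%:R * #|Y|%:R / N) ^+ (2 * J))^-1 ^+ 2 =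
    ((#|X|%:R * #|X|%:R / N) ^+ (2 * J))^-1 * ((#|Y|%:R * #|Y|%:R / N) ^+ (2 * J))^-1).
    apply: ler_wpM2r; last exact: conv_decoupling.
    by rewrite mulr_ge0 // invr_ge0 exprn_ge0 // ltW.
  rewrite -!exprVn -exprM mulnC exprM -exprMn; congr (_ ^+ _).
  by field; rewrite !lt0r_neq0.
have A0 : 0 <= N * (eps / 2) ^+ (2 * J) by rewrite mulr_ge0 ?exprn_ge0 ?ltW //; lra.
have [HX|HX] := lerP (N * (eps / 2) ^+ (2 * J)) (\sum_z u X X z ^+ (2 * J)).
  by left; apply: self_increment HX.
right; apply: (self_increment eps0 eps5 e1 el J0 M0 YM); rewrite leNgt; apply/negP => HY.
have sq0 (f : E -> R) : 0 <= \sum_z f z ^+ (2 * J).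
  by apply: sumr_ge0 => z _; rewrite exprM exprn_ge0 ?sqr_ge0.
have : (N * (eps / 2) ^+ (2 * J)) ^+ 2 <= (\sum_z u X X z ^+ (2 * J)) * (\sum_z u Y Y z ^+ (2 * J)).
  by apply: le_trans cs; apply: lerXn2r; rewrite ?nnegrE.
by rewrite leNgt expr2 ltr_pM.
Qed.

(* With only codimension-one information on X, Parseval bounds the counting error in L^2. *)
Lemma fourier_count X Y D (eps : R) : 0 <= eps ->
  (forall (V : {vspace E}) v, (m <= \dim V + 1)%N ->
     #|X :&: coset V v|%:R <= (1 + eps) * #|X|%:R / N * #|V|%:R) ->
  `|\sum_(z in D) rep R X Y z - #|X|%:R * #|Y|%:R / N * #|D|%:R|
    <= eps * #|X|%:R * Num.sqrt (#|Y|%:R * #|D|%:R).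
Proof.
move=> eps0 H.
have N0 := N_gt0 R m.
have coef a : a != 0 -> `|ft (ind R X) a| <= eps * #|X|%:R.
  move=> a0; rewrite /ft sum_ind.
  have XV : X \subset coset fullv 0 by rewrite coset_fullv subsetT.
  have nt : ~~ [forall x in (fullv : {vspace E}), dot a x == 0].
    apply: contra a0 => /forall_inP a0; apply/eqP/rowP => i.
    by have /eqP := a0 (delta_mx 0 i) (memvf _); rewrite dotC dot_delta mxE.
  have [v [_ cV ->]] := @character_half R m fullv 0 X a XV nt.
  set V := (fullv :&: perp a)%VS in cV *.
  have := H V v; have := dim_capv_perp fullv a; rewrite dimvf /dim /= mul1n -/V.
  move=> dimV /(_ dimV).
  have -> : N = 2 * #|V|%:R by rewrite -card_fullv cV natrM.
  have V0 : 0 < #|V|%:R :> R by rewrite ltr0n card_vspace2_gt0.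
  have -> : (1 + eps) * #|X|%:R / (2 * #|V|%:R) * #|V|%:R = (1 + eps) * #|X|%:R / 2.
    by field; rewrite lt0r_neq0.
  lra.
have tr := ft_triple (ind R X) (ind R Y) (ind R D).
have Ssum : \sum_(z in D) rep R X Y z =
    \sum_x ind R X x * \sum_y ind R Y y * ind R D (x + y).
  rewrite -sum_ind sum_rep -sum_ind; apply: eq_bigr => x _; by rewrite sum_ind.
rewrite -Ssum (bigD1 0) //= !ft0 !sum_ind1 in tr.
have bd := ft_triple_bound (P := fun a => a != 0) (ind R Y) (ind R D)
  (mulr_ge0 eps0 (ler0n R #|X|)) coef.
rewrite !sum_ind_sqr -sqrtrM ?ler0n // in bd.
rewrite -(ler_pM2l N0) -[X in X * `|_|](gtr0_norm N0) -normrM mulrBr -tr.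
rewrite (_ : _ + _ - _ = \sum_(i | i != 0) ft (ind R X) i * (ft (ind R Y) i * ft (ind R D) i)).
  apply: le_trans (ler_norm_sum _ _ _) _; apply: le_trans bd _.
  by rewrite le_eqVlt; apply/orP; left; apply/eqP; ring.
by field; rewrite lt0r_neq0.
Qed.

End Counting.

(** * Counting on cosets of an arbitrary subspace *)

Section Transport.
Variables (R : realType) (n : nat).
Local Notation E := 'rV['F_2]_n.
Implicit Types (U V : {vspace E}) (X Y D : {set E}).

Lemma vspace_coordinates U :
  exists f : 'Hom('rV['F_2]_(\dim U), E),
    injective f /\ forall v, v \in U <-> exists w, v = f w.
Proof.
pose B : 'M['F_2]_(\dim U, n) := \matrix_i (vbasis U)`_i.
pose f : 'Hom('rV['F_2]_(\dim U), E) := linfun (mulmxr B).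
have fE w : f w = \sum_i w 0 i *: (vbasis U)`_i.
  rewrite lfunE /= mulmx_sum_row; apply: eq_bigr => i _; by rewrite rowK.
exists f; split.
  apply/lker0P; rewrite -subv0; apply/subvP => w; rewrite memv_ker fE memv0 => /eqP w0.
  have /freeP fr := basis_free (vbasisP U).
  apply/eqP/rowP => i; rewrite mxE; exact: (fr (fun i => w 0 i)).
move=> v; split=> [vU|[w ->]].
  exists (\row_i coord (vbasis U) i v); rewrite fE [LHS](coord_vbasis vU).
  by apply: eq_bigr => i _; rewrite mxE.
rewrite fE; apply: memv_suml => i _; apply: memvZ.
exact/vbasis_mem/mem_nth/(leq_trans (ltn_ord i))/eq_leq/esym/size_tuple.
Qed.

Section Coordinates.
Variables (U : {vspace E}) (f : 'Hom('rV['F_2]_(\dim U), E)).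
Hypotheses (f_inj : injective f) (fP : forall v, v \in U <-> exists w, v = f w).
Local Notation F := 'rV['F_2]_(\dim U).

(** Coordinates on the coset [U + x] with origin [x]; they carry the counting lemmas from a full
    space to cosets. *)
Definition pull (x : E) X : {set F} := [set w | f w + x \in X].

Lemma card_F : #|F| = #|U|.
Proof. by rewrite card_space card_vspace2. Qed.

Lemma in_cosetP x z : reflect (exists w, z = f w + x) (z \in coset U x).
Proof.
rewrite mem_coset; apply: (iffP idP) => [/fP[w Hw]|[w ->]].
  by exists w; rewrite -Hw subrK.
by apply/fP; exists w; rewrite addrK.
Qed.

Lemma sum_pull (T : nmodType) x X (g : E -> T) : X \subset coset U x ->
  \sum_(z in X) g z = \sum_(w in pull x X) g (f w + x).
Proof.
move=> XU; have inj : injective (fun w => f w + x) by move=> a b /addIr /f_inj.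
rewrite -(big_imset (h := fun w => f w + x) (A := pull x X) g) /=; last by move=> a b _ _; exact: inj.
apply: eq_bigl => z; apply/idP/imsetP => [zX|[w]]; last by rewrite inE => ? ->.
have /in_cosetP[w zw] := subsetP XU _ zX.
by exists w => //; rewrite inE -zw.
Qed.

Lemma card_pull x X : X \subset coset U x -> #|pull x X| = #|X|.
Proof. by move=> XU; rewrite -!sum1_card (sum_pull _ XU). Qed.

Lemma card_pull_triple x y X Y D :
  X \subset coset U x -> Y \subset coset U y ->
  #|triple_set X Y D|%:R =
    \sum_(z in pull (x + y) D) rep R (pull x X) (pull y Y) z.
Proof.
move=> XU YU; rewrite -sum_ind sum_rep.
transitivity (\sum_(a in X) \sum_(b in Y) ind R D (a + b)).
  rewrite pair_big_dep /= -sum1_card natr_sum /=.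
  rewrite [LHS]big_mkcond [RHS]big_mkcond; apply: eq_bigr => -[a b] _ /=.
  by rewrite /ind inE /=; case: (a \in X) (b \in Y) (a + b \in D) => -[] [].
rewrite (sum_pull _ XU); apply: eq_bigr => a _.
rewrite (sum_pull _ YU); apply: eq_bigr => b _.
by rewrite /ind inE linearD /= addrACA.
Qed.

Lemma pull_increment x X r K (eps c : R) : X \subset coset U x -> X != set0 ->
  alg_spread U x r eps X -> (K <= r)%N -> 1 + eps < c ->
  ~ has_increment K c (pull x X).
Proof.
move=> XU X0 sp Kr epsc [V [v [dimV H]]].
have U0 : 0 < #|U|%:R :> R by rewrite ltr0n card_vspace2_gt0.
have ker0 : (V :&: lker f = 0)%VS.
  by move/lker0P/eqP: f_inj => ->; rewrite capv0.
have dimf : \dim (f @: V)%VS = \dim V by exact: limg_dim_eq.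
have sub : coset (f @: V) (f v + x) \subset coset U x.
  apply: coset_sub; last by apply/in_cosetP; exists v.
  by apply/subvP => z /memv_imgP[w _ ->]; apply/fP; exists w.
have cardc : #|X :&: coset (f @: V) (f v + x)| = #|pull x X :&: coset V v|.
  rewrite -(card_pull (subset_trans (subsetIr _ _) sub)); apply: eq_card => w.
  rewrite 2!inE [in RHS]inE [w \in pull _ _]inE; congr (_ && _).
  rewrite !mem_coset opprD addrACA subrr addr0 -linearB.
  apply/memv_imgP/idP => [[w' w'V /f_inj ->]//|wV]; by exists (w - v).
have := sp (f @: V)%VS (f v + x) sub; rewrite dimf.
move=> /(_ (leq_trans dimV (leq_add (leqnn _) Kr))).
rewrite /density cardc !card_coset card_vspace2 dimf -card_vspace2.
rewrite card_pull // card_F in H.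
have V0 : 0 < #|V|%:R :> R by rewrite ltr0n card_vspace2_gt0.
have X0' : 0 < #|X|%:R :> R by rewrite ltr0n card_gt0.
apply/negP; rewrite -ltNge ltr_pdivlMr //; apply: lt_le_trans H.
by rewrite ltr_pM2r // mulrA ltr_pM2r ?invr_gt0 // ltr_pM2r.
Qed.

End Coordinates.

Lemma card_triple_setC X Y D : #|triple_set Y X D| = #|triple_set X Y D|.
Proof.
have inj : injective (fun p : E * E => (p.2, p.1)) by move=> [a b] [c d] [-> ->].
rewrite -(card_imset _ inj); apply: eq_card => -[a b]; apply/imsetP/idP => [[[c d]]|].
  by rewrite !inE /= => /and3P[? ? ?] [-> ->]; apply/and3P; split; rewrite // addrC.
rewrite inE /= => /and3P[? ? ?]; exists (b, a) => //; rewrite inE /=.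
by apply/and3P; split; rewrite // addrC.
Qed.

Lemma spread_upper_count U x y X Y D r (epsS eps : R) (e M1 M2 : nat) :
  X \subset coset U x -> Y \subset coset U y -> D \subset coset U (x + y) ->
  alg_spread U x r epsS X \/ alg_spread U y r epsS Y ->
  (sift_codim e M1 M2 <= r)%N -> epsS < eps / 5 ->
  0 < eps -> eps <= 1 / 5 -> 1 <= e%:R * eps ->
  (0 < M1)%N -> (0 < M2)%N -> 20 * e%:R * #|U|%:R <= #|D|%:R * 2 ^+ M1 :> R ->
  #|U|%:R ^+ 2 <= #|X|%:R * #|Y|%:R * 2 ^+ M2 :> R ->
  #|triple_set X Y D|%:R <= (1 + eps) * (#|X|%:R * #|Y|%:R / #|U|%:R) * #|D|%:R.
Proof.
move=> XU YU DU sp Kr epsS5 eps0 eps5 e1 M10 M20 DM XYM.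
have nz (X' Y' : {set E}) : #|U|%:R ^+ 2 <= #|X'|%:R * #|Y'|%:R * 2 ^+ M2 :> R -> X' != set0.
  apply: contraTneq => ->; rewrite cards0 !mul0r -ltNge exprn_gt0 //.
  by rewrite ltr0n card_vspace2_gt0.
have X0 := nz _ _ XYM.
have Y0 : Y != set0 by apply: (nz Y X); rewrite [_ * #|X|%:R]mulrC.
have [f [f_inj fP]] := vspace_coordinates U.
rewrite (card_pull_triple f_inj fP D XU YU) leNgt; apply/negP => /ltW H.
have := @upper_count R _ (pull f x X) (pull f y Y) (pull f (x + y) D) eps e M1 M2.
rewrite (card_pull f_inj fP XU) (card_pull f_inj fP YU) (card_pull f_inj fP DU) card_F.
have c5 : 1 + epsS < 1 + eps / 5 by lra.
move=> /(_ eps0 eps5 e1 M10 M20 DM XYM H) [hX hY].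
case: sp => sp; first exact: (pull_increment f_inj fP XU X0 sp Kr c5).
exact: (pull_increment f_inj fP YU Y0 sp Kr c5).
Qed.

Lemma spread_lower_count U x y X Y D r (epsS eps : R) (e l J M : nat) :
  X \subset coset U x -> Y \subset coset U y -> D \subset coset U (x + y) ->
  alg_spread U x r epsS X -> alg_spread U y r epsS Y ->
  (lower_codim e l J M <= r)%N -> epsS < eps / 40 ->
  0 < eps -> eps <= 1 / 5 -> 1 <= e%:R * eps -> (e <= 2 ^ l)%N ->
  (0 < J)%N -> (0 < M)%N -> #|U|%:R <= #|D|%:R * 2 ^+ J :> R ->
  #|U|%:R <= #|X|%:R * 2 ^+ M :> R -> #|U|%:R <= #|Y|%:R * 2 ^+ M :> R ->
  (1 - eps) * (#|X|%:R * #|Y|%:R / #|U|%:R) * #|D|%:R <= #|triple_set X Y D|%:R.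
Proof.
move=> XU YU DU spX spY Kr epsS40 eps0 eps5 e1 el J0 M0 DJ XM YM.
have nz (Z : {set E}) : #|U|%:R <= #|Z|%:R * 2 ^+ M :> R -> Z != set0.
  apply: contraTneq => ->; rewrite cards0 mul0r -ltNge.
  by rewrite ltr0n card_vspace2_gt0.
have [f [f_inj fP]] := vspace_coordinates U.
rewrite (card_pull_triple f_inj fP D XU YU) leNgt; apply/negP => /ltW H.
have := @lower_count R _ (pull f x X) (pull f y Y) (pull f (x + y) D) eps e l J M.
rewrite (card_pull f_inj fP XU) (card_pull f_inj fP YU) (card_pull f_inj fP DU) card_F.
have c40 : 1 + epsS < 1 + eps / 40 by lra.
move=> /(_ eps0 eps5 e1 el J0 M0 DJ XM YM H) [].
  exact: (pull_increment f_inj fP XU (nz _ XM) spX Kr c40).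
exact: (pull_increment f_inj fP YU (nz _ YM) spY Kr c40).
Qed.

Lemma spread_fourier_count U x y X Y D r (eps : R) :
  X \subset coset U x -> Y \subset coset U y -> D \subset coset U (x + y) ->
  alg_spread U x r eps X -> (0 < r)%N -> 0 <= eps ->
  `|#|triple_set X Y D|%:R - #|X|%:R * #|Y|%:R / #|U|%:R * #|D|%:R|
    <= eps * #|X|%:R * Num.sqrt (#|Y|%:R * #|D|%:R).
Proof.
move=> XU YU DU spX r0 eps0.
have [f [f_inj fP]] := vspace_coordinates U.
have [X0|X0] := eqVneq X set0.
  have -> : triple_set X Y D = set0 by apply/setP => p; rewrite X0 !inE.
  by rewrite X0 !cards0 !mul0r mulr0 mul0r subrr normr0.
rewrite (card_pull_triple f_inj fP D XU YU).
have := @fourier_count R _ (pull f x X) (pull f y Y) (pull f (x + y) D) eps eps0.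
rewrite (card_pull f_inj fP XU) (card_pull f_inj fP YU) (card_pull f_inj fP DU) card_F.
apply => V v dimV; rewrite leNgt; apply/negP => H.
pose c := #|pull f x X :&: coset V v|%:R * #|U|%:R / (#|X|%:R * #|V|%:R) : R.
have U0 : 0 < #|U|%:R :> R by rewrite ltr0n card_vspace2_gt0.
have V0 : 0 < #|V|%:R :> R by rewrite ltr0n card_vspace2_gt0.
have X0' : 0 < #|X|%:R :> R by rewrite ltr0n card_gt0.
apply: (@pull_increment U f f_inj fP x X r 1 eps c XU X0 spX r0).
  rewrite /c ltr_pdivlMr ?mulr_gt0 // mulrA -ltr_pdivrMr // mulrAC.
  by rewrite [X in X * _ < _]mulrAC in H *.
exists V, v; split=> //; rewrite (card_pull f_inj fP XU) card_F /c.
rewrite le_eqVlt; apply/orP; left; apply/eqP; field.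
by rewrite !lt0r_neq0.
Qed.

End Transport.

(** * Decomposition of one set into spread pieces *)

Section Pieces.
Variables (R : realType) (n : nat).
Local Notation E := 'rV['F_2]_n.
Implicit Types (U V W : {vspace E}) (X Y : {set E}) (u v x y : E).

Lemma vspace_gt0 V : 0 < #|V|%:R :> R.
Proof. by rewrite ltr0n card_vspace2_gt0. Qed.

Lemma sum_const_coset V v (k : R) : \sum_(c in coset V v) k = #|V|%:R * k.
Proof. by rewrite sumr_const card_coset mulr_natl. Qed.

(** Each failure of spreadness gives a subcoset, at a cost of at most [r] dimensions, on which the
    density grows by a factor above [1 + e]. Since densities are at most 1, this happens fewer than
    [m] times. *)
Lemma spread_piece (r m : nat) (e : R) U u X : 0 <= e -> X \subset coset U u ->
  #|U|%:R < #|X|%:R * (1 + e) ^+ m ->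
  exists U' u', [/\ coset U' u' \subset coset U u, (\dim U <= \dim U' + r * m)%N,
    alg_spread U' u' r e (X :&: coset U' u') &
    #|X|%:R * #|U'|%:R <= #|X :&: coset U' u'|%:R * #|U|%:R :> R].
Proof.
move=> e0; elim: m U u X => [|m IH] U u X XU.
  rewrite expr0 mulr1 ltr_nat => H.
  by have := subset_leq_card XU; rewrite card_coset leqNgt H.
move=> H; have [sp|/existsNP[V /existsNP[v nsp]]] := EM (alg_spread U u r e X).
  by exists U, u; rewrite (setIidPl XU) leq_addr.
have [sub [dimV inc]] : coset V v \subset coset U u /\ (\dim U <= \dim V + r)%N /\
    (1 + e) * density R X (coset U u)
      < density R (X :&: coset V v) (coset V v).
  by move/not_implyP: nsp => -[? /not_implyP[? /negP]]; rewrite -ltNge.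
have [U0 V0] := (vspace_gt0 U, vspace_gt0 V).
move: inc; rewrite /density !card_coset ltr_pdivlMr // => inc.
have e1 : 0 < 1 + e by lra.
have [||U' [u' [sub' dimU' sp]]] := IH V v (X :&: coset V v).
- exact: subsetIr.
- rewrite exprSr mulrA in H.
  have em : 0 < (1 + e) ^+ m by rewrite exprn_gt0.
  apply: le_lt_trans (_ : (1 + e) * (#|X|%:R / #|U|%:R) * #|V|%:R * (1 + e) ^+ m < _); last first.
    by rewrite ltr_pM2r.
  have : 1 <= #|X|%:R * (1 + e) ^+ m * (1 + e) / #|U|%:R.
    by rewrite ler_pdivlMr // mul1r ltW.
  by move/(ler_wpM2r (ltW V0)); lra.
rewrite -!setIA (setIidPr sub') in sp *.
move=> dens; exists U', u'; split=> //.
- exact: subset_trans sub.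
- by rewrite mulnS; move: dimV dimU'; clear; lia.
have U'0 := vspace_gt0 U'.
have step : #|X|%:R * #|V|%:R <= #|X :&: coset V v|%:R * #|U|%:R :> R.
  rewrite -ler_pdivrMr // mulrAC; apply: le_trans (ltW inc).
  by rewrite -[X in _ <= X]mulrA ler_peMl ?mulr_ge0 ?invr_ge0 //; lra.
rewrite -(ler_pM2r V0) mulrAC.
apply: (@le_trans _ _ (#|X :&: coset V v|%:R * #|U|%:R * #|U'|%:R)); first by rewrite ler_wpM2r.
by rewrite [X in _ <= X]mulrAC [X in X <= _]mulrAC ler_wpM2r.
Qed.

(** Greedy exhaustion: while the rest of [X] has density at least [lam], split off a spread piece,
    paid by [k]; the final rest is paid by [b]. The hypotheses range over all subsets of [X] so that
    the induction on [#|X|] can go on with the rest. *)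
Lemma sum_over_pieces (r m : nat) (e lam k b : R) U u X (g : E -> R) :
  0 <= e -> 0 < lam -> 1 < lam * (1 + e) ^+ m -> 0 <= k -> X \subset coset U u ->
  (forall U' u' X', X' \subset X -> coset U' u' \subset coset U u ->
     (\dim U <= \dim U' + r * m)%N -> X' \subset coset U' u' ->
     alg_spread U' u' r e X' -> lam * #|U'|%:R <= #|X'|%:R ->
     \sum_(x in X') g x <= k * #|X'|%:R) ->
  (forall X1, X1 \subset X -> #|X1|%:R < lam * #|U|%:R -> \sum_(x in X1) g x <= b) ->
  \sum_(x in X) g x <= k * #|X|%:R + b.
Proof.
move=> e0 lam0 lamm k0; have U0 := vspace_gt0 U.
have [c] := ubnP #|X|; elim: c X => // c IH X cX XU Hpiece Hsmall.
have [small|big] := ltrP #|X|%:R (lam * #|U|%:R).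
  by apply: le_trans (Hsmall X (subxx _) small) _; rewrite lerDr mulr_ge0.
have [|U' [u' [sub dimU' sp dens]]] := @spread_piece r m e U u X e0 XU.
  have em : 0 < (1 + e) ^+ m by rewrite exprn_gt0 //; lra.
  apply: lt_le_trans (_ : lam * #|U|%:R * (1 + e) ^+ m <= _); last by rewrite ler_pM2r.
  by rewrite mulrAC -[X in X < _]mul1r ltr_pM2r.
set X' := X :&: coset U' u' in sp dens.
have X'X : X' \subset X by exact: subsetIl.
have lamX' : lam * #|U'|%:R <= #|X'|%:R.
  rewrite -(ler_pM2r U0) mulrAC; apply: le_trans dens.
  by rewrite ler_wpM2r.
have X'0 : (0 < #|X'|)%N.
  by rewrite -(ltr0n R); apply: lt_le_trans lamX'; rewrite mulr_gt0 ?vspace_gt0.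
have split (h : E -> R) : \sum_(x in X) h x = \sum_(x in X') h x + \sum_(x in X :\: X') h x.
  rewrite (bigID (mem X')) /=; congr (_ + _); apply: eq_bigl => x.
    by rewrite andb_idl // => /(subsetP X'X).
  by rewrite in_setD andbC.
have cardX : #|X|%:R = #|X'|%:R + #|X :\: X'|%:R :> R.
  by rewrite -!sumr_const split.
rewrite split cardX mulrDr -addrA lerD //.
  by apply: (Hpiece U' u') => //; exact: subsetIr.
have DX : X :\: X' \subset X by exact: subsetDl.
apply: IH.
- have := cardsID X' X; rewrite (setIidPr X'X); move: cX X'0; clear; lia.
- exact: subset_trans XU.
- by move=> V v Y YX; apply: Hpiece; exact: subset_trans DX.
- by move=> Y YX; apply: Hsmall; exact: subset_trans DX.
Qed.

Lemma sum_set_cosets U V v Y (h : E -> R) : (U <= V)%VS -> Y \subset coset V v ->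
  #|U|%:R * \sum_(y in Y) h y
    = \sum_(c in coset V v) \sum_(y in Y :&: coset U c) h y.
Proof.
move=> UV YV; have H := sum_cosets v (fun y => ind R Y y * h y) UV.
have -> : \sum_(y in Y) h y = \sum_(y in coset V v) ind R Y y * h y.
  rewrite -[LHS]sum_ind [RHS]big_mkcond; apply: eq_bigr => y _.
  case: ifPn => // yV; rewrite /ind (negbTE (contra (subsetP YV y) yV)); exact: mul0r.
rewrite mulr_natl -H; apply: eq_bigr => c _.
rewrite [LHS]big_mkcond [RHS]big_mkcond; apply: eq_bigr => y _.
by rewrite in_setI /ind; case: (y \in Y); rewrite /= ?mul1r ?mul0r //; case: ifP.
Qed.

End Pieces.

(** * Recursive decomposition of a box *)

Section Tree.
Variables (R : realType) (n : nat).
Local Notation E := 'rV['F_2]_n.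
Implicit Types (U V : {vspace E}) (X Y : {set E}) (u v x y c : E).
Variables (W : {vspace E}) (mu : E -> E -> R) (bound eps rho : R) (r m Kmax : nat).
(** Pieces of [X] are made spread at rank [r1] so that rank [r] remains after passing to the
    subspace of a piece of [Y], of codimension up to [r * m]. A level spends [r1 * m] dimensions on
    [X] and [r * m] on [Y]. *)
Local Notation r1 := (r * m + r)%N.
Local Notation step := (r1 * m + r * m)%N.
Hypotheses (bound_ge0 : 0 <= bound) (mu_le : forall x y, mu x y <= bound).
Hypotheses (eps_gt0 : 0 < eps) (eps_le1 : eps <= 1) (rho_gt0 : 0 < rho).
Hypothesis m_large : 1 < rho / 4 * (1 + eps / 16) ^+ m.
Hypothesis leaf_le0 : forall V x y X Y,
  coset V x \subset coset W 0 -> coset V y \subset coset W 0 ->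
  (\dim W <= \dim V + Kmax)%N ->
  X \subset coset V x -> Y \subset coset V y ->
  alg_spread V x r eps X -> alg_spread V y r eps Y ->
  rho / 32 * #|V|%:R ^+ 2 <= #|X|%:R * #|Y|%:R ->
  \sum_(x in X) \sum_(y in Y) mu x y <= 0.

(* A level keeps at most 3/4 of the main term: boxes of two spread pieces contribute nothing,
   and only cosets on which a piece lost density are decomposed again. *)
Definition tree_bound (t : nat) (X Y : {set E}) (U : {vspace E}) : R :=
  bound * ((3 / 4) ^+ t * (#|X|%:R * #|Y|%:R) + rho * 21 ^+ t * #|U|%:R ^+ 2).

Definition tree_claim t := forall U u v X Y,
  coset U u \subset coset W 0 -> coset U v \subset coset W 0 ->
  (\dim W + t * step <= \dim U + Kmax)%N ->
  X \subset coset U u -> Y \subset coset U v ->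
  \sum_(x in X) \sum_(y in Y) mu x y <= tree_bound t X Y U.

Lemma sum_mu_le X Y : \sum_(x in X) \sum_(y in Y) mu x y <= bound * (#|X|%:R * #|Y|%:R).
Proof.
apply: (@le_trans _ _ (\sum_(x in X) \sum_(y in Y) bound)).
  by apply: ler_sum => x _; apply: ler_sum.
by rewrite !sumr_const -mulrnA -natrM mulnC mulr_natr.
Qed.

(** Upper density bounds pass to subcosets. Relative to a coset that kept a fraction [1 - eps / 4]
    of the density they lose only this factor, and [1 + eps / 16 <= (1 + eps) * (1 - eps / 4)] for
    [eps <= 1]. *)
Lemma good_coset_spread U u V c X : X \subset coset U u -> (V <= U)%VS ->
  c \in coset U u -> (\dim U <= \dim V + r * m)%N ->
  alg_spread U u r1 (eps / 16) X ->
  (1 - eps / 4) * (#|X|%:R * #|V|%:R) <= #|X :&: coset V c|%:R * #|U|%:R ->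
  alg_spread V c r eps (X :&: coset V c).
Proof.
move=> XU VU cU dimV sp good V2 v2 sub2 dim2.
have e0 := eps_gt0; have e1 := eps_le1; have rho0 := rho_gt0.
have sub : coset V c \subset coset U u by exact: coset_sub.
rewrite -setIA (setIidPr sub2).
apply: le_trans (sp V2 v2 (subset_trans sub2 sub) _) _.
  by move: dimV dim2; clear; lia.
rewrite /density !card_coset.
have [U0 V0] := (vspace_gt0 R U, vspace_gt0 R V).
have low : (1 - eps / 4) * (#|X|%:R / #|U|%:R) <= #|X :&: coset V c|%:R / #|V|%:R.
  rewrite ler_pdivlMr // (_ : _ * _ * _ = (1 - eps / 4) * (#|X|%:R * #|V|%:R) / #|U|%:R).
    by rewrite ler_pdivrMr.
  by ring.
have a0 : 0 <= #|X|%:R / #|U|%:R :> R by exact: divr_ge0.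
have eps1 : 0 <= 1 + eps by lra.
apply: le_trans (ler_wpM2l eps1 low); rewrite [X in _ <= X]mulrA ler_wpM2r //; nra.
Qed.

(** Cut [X] along the cosets of [V]. Where the density survives, [good_coset_spread] produces a leaf
    with nonpositive sum; elsewhere the induction hypothesis is used. No coset exceeds the mean [q]
    by more than a factor [1 + eps / 16], so by Markov's inequality the low cosets carry at most a
    quarter of [X]. *)
Lemma tree_spread_pair t U u V v X Y : tree_claim t ->
  coset U u \subset coset W 0 -> coset V v \subset coset W 0 -> (V <= U)%VS ->
  (\dim U <= \dim V + r * m)%N -> (\dim W + t * step <= \dim V + Kmax)%N ->
  X \subset coset U u -> Y \subset coset V v ->
  alg_spread U u r1 (eps / 16) X -> alg_spread V v r eps Y ->
  rho / 16 * (#|U|%:R * #|V|%:R) <= #|X|%:R * #|Y|%:R ->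
  \sum_(x in X) \sum_(y in Y) mu x y <=
    bound * ((3 / 4) ^+ t / 4 * (#|X|%:R * #|Y|%:R) + rho * 21 ^+ t * (#|U|%:R * #|V|%:R)).
Proof.
move=> IH UW VW VU dimV dimW XU YV spX spY dens.
have e0 := eps_gt0; have e1 := eps_le1; have rho0 := rho_gt0.
have [U0 V0] := (vspace_gt0 R U, vspace_gt0 R V).
rewrite -(ler_pM2l V0) (sum_set_cosets (fun x => \sum_(y in Y) mu x y) VU XU).
pose q : R := #|X|%:R * #|V|%:R / #|U|%:R.
pose f c : R := #|X :&: coset V c|%:R.
have q0 : 0 <= q by rewrite divr_ge0 ?mulr_ge0.
have sumf : \sum_(c in coset U u) f c = #|U|%:R * q.
  have := sum_set_cosets (fun=> 1 : R) VU XU; rewrite sumr_const.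
  under [X in _ = X -> _]eq_bigr do rewrite sumr_const.
  rewrite -/f => <-; rewrite /q; field; exact: lt0r_neq0.
have fle c : c \in coset U u -> f c <= (1 + eps / 16) * q.
  move=> cU; have := spX V c (coset_sub VU cU) (leq_trans dimV _).
  rewrite leq_add2l leq_addr => /(_ isT); rewrite /density !card_coset ler_pdivrMr //.
  by move/le_trans; apply; rewrite /q; lra.
(* On a low coset [f c] is at most the weight [((1 + eps / 16) * q - f c) / (eps / 4)]. The weight
   is nonnegative everywhere, and its mean over the cosets is [q / 4]. *)
apply: (@le_trans _ _ (\sum_(c in coset U u)
   bound * ((3 / 4) ^+ t * #|Y|%:R * (((1 + eps / 16) * q - f c) / (eps / 4))
      + rho * 21 ^+ t * #|V|%:R ^+ 2))); last first.
  rewrite -mulr_sumr big_split /= sum_const_coset -mulr_sumr -mulr_suml sumrB sumf.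
  rewrite sum_const_coset le_eqVlt; apply/orP; left; apply/eqP.
  by rewrite /q; field; rewrite !lt0r_neq0.
apply: ler_sum => c cU.
have z0 : 0 <= (3 / 4 : R) ^+ t by rewrite exprn_ge0 //; lra.
have z1 : 0 <= (21 : R) ^+ t by rewrite exprn_ge0.
have fc := fle c cU.
have [good|low] := lerP ((1 - eps / 4) * (#|X|%:R * #|V|%:R)) (f c * #|U|%:R).
  apply: (@le_trans _ _ 0); last first.
    rewrite mulr_ge0 // addr_ge0 ?mulr_ge0 ?sqr_ge0 ?invr_ge0 //; lra.
  apply: (leaf_le0 (V := V) (x := c) (y := v)) => //.
  - exact: subset_trans (coset_sub VU cU) UW.
  - by apply: leq_trans dimW; exact: leq_addr.
  - exact: subsetIr.
  - exact: good_coset_spread spX good.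
  rewrite -/(f c) -(ler_pM2r U0).
  apply: (@le_trans _ _ (1 / 2 * (#|X|%:R * #|V|%:R) * #|Y|%:R)).
    by have := ler_wpM2r (ltW V0) dens; lra.
  rewrite [X in _ <= X]mulrAC ler_wpM2r //; apply: le_trans good.
  by rewrite ler_wpM2r ?mulr_ge0 //; lra.
apply: le_trans (IH V c v (X :&: coset V c) Y
  (subset_trans (coset_sub VU cU) UW) VW dimW (subsetIr _ _) YV) _.
rewrite /tree_bound -/(f c) ler_wpM2l // lerD2r -mulrA ler_wpM2l // [_ * #|Y|%:R]mulrC ler_wpM2l //.
have low' : f c <= (1 - eps / 4) * q.
  by rewrite /q mulrA ler_pdivlMr // ltW.
rewrite ler_pdivlMr; last by lra.
by nra.
Qed.

(** With [X] already spread, [Y] is exhausted by spread pieces of density at least [ly], handled by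
    [tree_spread_pair]; the rest goes to the induction hypothesis. A piece [Y'] on a coset of [V]
    has [#|V|] at most [#|Y'| / ly], whence the division by [ly]. *)
Lemma tree_spread_left t U u v X Y (lx ly : R) : tree_claim t ->
  coset U u \subset coset W 0 -> coset U v \subset coset W 0 ->
  (\dim W + t.+1 * step <= \dim U + r1 * m + Kmax)%N ->
  X \subset coset U u -> Y \subset coset U v ->
  alg_spread U u r1 (eps / 16) X -> lx * #|U|%:R <= #|X|%:R ->
  0 < lx -> 0 < ly -> rho / 16 <= lx * ly -> rho / 4 <= ly ->
  \sum_(x in X) \sum_(y in Y) mu x y <=
    bound * ((3 / 4) ^+ t / 4 * #|X|%:R + rho * 21 ^+ t * #|U|%:R / ly) * #|Y|%:R
    + bound * ((3 / 4) ^+ t * #|X|%:R * (ly * #|U|%:R) + rho * 21 ^+ t * #|U|%:R ^+ 2).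
Proof.
move=> IH UW VW dimW XU YU spX dX lx0 ly0 lxy ly4.
have eps0 := eps_gt0; have eps1 := eps_le1; have rho1 := rho_gt0.
have U0 := vspace_gt0 R U.
have z0 : 0 <= (3 / 4 : R) ^+ t by rewrite exprn_ge0 //; lra.
have z1 : 0 <= (21 : R) ^+ t by rewrite exprn_ge0.
have rho0 := ltW rho_gt0.
rewrite exchange_big /=.
have e1 : 0 < 1 + eps / 16 by lra.
apply: (@sum_over_pieces R n r m eps ly _ _ U v Y) => //.
- exact: ltW.
- apply: lt_le_trans m_large _; apply: ler_pM => //; first by lra.
    by rewrite exprn_ge0 // ltW.
  by apply: lerXn2r; rewrite ?nnegrE //; lra.
- rewrite mulr_ge0 // addr_ge0 // ?mulr_ge0 ?invr_ge0 //; lra.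
- move=> V v' Y' Y'Y sub dimV Y'V spY dY; rewrite exchange_big /=.
  have V0 := vspace_gt0 R V.
  have [VU v'U] := subset_coset sub.
  apply: le_trans (tree_spread_pair IH UW (subset_trans sub VW) VU dimV _ XU Y'V spX spY _) _.
  + by move: dimW dimV; rewrite mulSn; clear; lia.
  + apply: (@le_trans _ _ ((lx * #|U|%:R) * (ly * #|V|%:R))).
      by rewrite [X in _ <= X]mulrACA ler_wpM2r // mulr_ge0.
    by apply: ler_pM => //; rewrite mulr_ge0 // ltW.
  rewrite -[X in _ <= X]mulrA; apply: ler_wpM2l => //.
  rewrite [X in _ <= X]mulrDl; apply: lerD; first by rewrite mulrA.
  apply: (@le_trans _ _ (rho * 21 ^+ t * (#|U|%:R * (#|Y'|%:R / ly)))).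
    by rewrite !ler_wpM2l ?mulr_ge0 // ler_pdivlMr // mulrC.
  by rewrite le_eqVlt; apply/orP; left; apply/eqP; ring.
move=> Y1 Y1Y small; rewrite exchange_big /=.
apply: le_trans (IH U u v X Y1 UW VW _ XU _) _.
- by move: dimW; rewrite mulSn; clear; lia.
- exact: subset_trans YU.
rewrite /tree_bound ler_wpM2l // lerD2r -mulrA ler_wpM2l // ler_wpM2l //.
exact: ltW.
Qed.

(** The thresholds are a quarter of the densities. The main term receives [1 / 4] each from spread
    pairs, from the rest of [Y] and from the rest of [X], in all [3 / 4]. The error term receives
    [(4 + 1) * 4] from the pieces and 1 from the rest of [X], in all 21. *)
Lemma tree_step t : tree_claim t -> tree_claim t.+1.
Proof.
move=> IH U u v X Y UW VW dimW XU YU.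
have eps0 := eps_gt0; have eps1 := eps_le1; have rho1 := rho_gt0.
have U0 := vspace_gt0 R U.
have z0 : 0 <= (3 / 4 : R) ^+ t by rewrite exprn_ge0 //; lra.
have z1 : 1 <= (21 : R) ^+ t by rewrite exprn_ege1 // ler1n.
have rho0 := ltW rho_gt0.
have [small|big] := ltrP (#|X|%:R * #|Y|%:R) (rho * #|U|%:R ^+ 2).
  apply: le_trans (sum_mu_le X Y) _; rewrite /tree_bound ler_wpM2l //.
  apply: le_trans (ltW small) _; rewrite -[X in X <= _]add0r lerD //.
    by rewrite !mulr_ge0 // exprn_ge0 //; lra.
  rewrite ler_wpM2r ?sqr_ge0 // ler_peMr // exprS; lra.
have XleU : #|X|%:R <= #|U|%:R :> R.
  by rewrite ler_nat -(card_coset U u) subset_leq_card.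
have YleU : #|Y|%:R <= #|U|%:R :> R.
  by rewrite ler_nat -(card_coset U v) subset_leq_card.
have dX : rho * #|U|%:R <= #|X|%:R.
  rewrite -(ler_pM2r U0) -mulrA -expr2; apply: le_trans big _.
  by rewrite ler_wpM2l.
have dY : rho * #|U|%:R <= #|Y|%:R.
  rewrite -(ler_pM2r U0) -mulrA -expr2; apply: le_trans big _.
  by rewrite mulrC ler_wpM2l.
have rU : 0 < rho * #|U|%:R by rewrite mulr_gt0.
have X0 : 0 < #|X|%:R :> R by exact: lt_le_trans dX.
have Y0 : 0 < #|Y|%:R :> R by exact: lt_le_trans dY.
pose lx : R := #|X|%:R / (4 * #|U|%:R); pose ly : R := #|Y|%:R / (4 * #|U|%:R).
have U40 : 0 < 4 * #|U|%:R :> R by rewrite mulr_gt0.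
have lx0 : 0 < lx by rewrite divr_gt0.
have ly0 : 0 < ly by rewrite divr_gt0.
have lx4 : rho / 4 <= lx by rewrite ler_pdivlMr //; lra.
have ly4 : rho / 4 <= ly by rewrite ler_pdivlMr //; lra.
have lxy : rho / 16 <= lx * ly.
  have -> : lx * ly = (#|X|%:R * #|Y|%:R / #|U|%:R ^+ 2) / 16.
    by rewrite /lx /ly; field; rewrite lt0r_neq0.
  have : rho <= #|X|%:R * #|Y|%:R / #|U|%:R ^+ 2 by rewrite ler_pdivlMr // exprn_gt0.
  lra.
set b21 := rho * 21 ^+ t.
have b210 : 0 <= b21 by rewrite mulr_ge0 //; lra.
pose k := bound * ((3 / 4) ^+ t / 2 * #|Y|%:R + 20 * b21 * #|U|%:R ^+ 2 / #|X|%:R).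
pose b := bound * ((3 / 4) ^+ t * (#|X|%:R * #|Y|%:R) / 4 + b21 * #|U|%:R ^+ 2).
apply: (@le_trans _ _ (k * #|X|%:R + b)); last first.
  rewrite /tree_bound /k /b -mulrA -mulrDr ler_wpM2l // !exprS -/b21.
  rewrite le_eqVlt; apply/orP; left; apply/eqP; rewrite /b21; field.
  exact: lt0r_neq0.
have e1 : 0 < 1 + eps / 16 by lra.
apply: (@sum_over_pieces R n r1 m (eps / 16) lx _ _ U u X) => //.
- by lra.
- by apply: lt_le_trans m_large _; rewrite ler_wpM2r // exprn_ge0 // ltW.
- rewrite mulr_ge0 // addr_ge0 // ?mulr_ge0 ?invr_ge0 ?exprn_ge0 //; lra.
- move=> U' u' X' X'X sub dimU' X'U' spX' dX'.
  have [U'U u'U] := subset_coset sub.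
  have U'0 := vspace_gt0 R U'.
  rewrite -(ler_pM2l U'0) exchange_big /=.
  rewrite (sum_set_cosets (fun y => \sum_(x in X') mu x y) U'U YU).
  pose k' := bound * ((3 / 4) ^+ t / 4 * #|X'|%:R + b21 * #|U'|%:R / ly).
  pose b' := bound * ((3 / 4) ^+ t * #|X'|%:R * (ly * #|U'|%:R) + b21 * #|U'|%:R ^+ 2).
  apply: (@le_trans _ _ (\sum_(c in coset U v) (k' * #|Y :&: coset U' c|%:R + b'))).
    apply: ler_sum => c cU; rewrite exchange_big /=.
    apply: (@tree_spread_left t U' u' c X' (Y :&: coset U' c) lx ly) => //.
    + exact: subset_trans sub UW.
    + exact: subset_trans (coset_sub U'U cU) VW.
    + by move: dimW dimU'; clear; lia.
    + exact: subsetIr.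
  rewrite big_split /= sum_const_coset -mulr_sumr.
  have -> : \sum_(c in coset U v) #|Y :&: coset U' c|%:R = #|U'|%:R * #|Y|%:R :> R.
    have := sum_set_cosets (fun=> 1 : R) U'U YU; rewrite sumr_const => ->.
    by apply: eq_bigr => c _; rewrite sumr_const.
  have dX'' : #|U'|%:R <= 4 * #|U|%:R * #|X'|%:R / #|X|%:R :> R.
    rewrite ler_pdivlMr //; have := ler_wpM2r (ltW U40) dX'; rewrite /lx.
    rewrite (_ : #|X|%:R / (4 * #|U|%:R) * #|U'|%:R * (4 * #|U|%:R) = #|U'|%:R * #|X|%:R).
      by rewrite mulrC [_ * (4 * _)]mulrC.
    by field; rewrite lt0r_neq0.
  apply: (@le_trans _ _ (#|U'|%:R * (bound * ((3 / 4) ^+ t / 2 * (#|X'|%:R * #|Y|%:R)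
       + 5 * b21 * #|U|%:R * #|U'|%:R)))).
    rewrite le_eqVlt; apply/orP; left; apply/eqP; rewrite /k' /b' /ly; field.
    by rewrite !lt0r_neq0.
  rewrite ler_pM2l // /k -[X in _ <= X]mulrA; apply: ler_wpM2l => //.
  rewrite [X in _ <= X]mulrDl; apply: lerD.
    by rewrite [#|X'|%:R * _]mulrC mulrA.
  apply: (@le_trans _ _ (5 * b21 * #|U|%:R * (4 * #|U|%:R * #|X'|%:R / #|X|%:R))).
    apply: ler_wpM2l => //; apply: mulr_ge0 => //.
    by apply: mulr_ge0; rewrite ?ler0n.
  by rewrite le_eqVlt; apply/orP; left; apply/eqP; ring.
move=> X1 X1X small.
apply: le_trans (IH U u v X1 Y UW VW _ _ YU) _.
- by move: dimW; rewrite mulSn; clear; lia.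
- exact: subset_trans XU.
rewrite /tree_bound /b ler_wpM2l // lerD2r -!mulrA ler_wpM2l //.
have X14 : #|X1|%:R <= #|X|%:R / 4 :> R.
  apply: le_trans (ltW small) _; rewrite /lx le_eqVlt; apply/orP; left; apply/eqP.
  by field; rewrite lt0r_neq0.
by have := ler_wpM2r (ler0n R #|Y|) X14; lra.
Qed.

Lemma tree t : tree_claim t.
Proof.
elim: t => [|t IH]; last exact: tree_step.
move=> U u v X Y _ _ _ _ _; apply: le_trans (sum_mu_le X Y) _.
rewrite /tree_bound !expr0 mul1r mulr1 ler_wpM2l // lerDl.
by rewrite mulr_ge0 ?sqr_ge0 // ltW.
Qed.

End Tree.

(** * Good boxes and their extraction from the tree bound *)

Section Boxes.
Variables (R : realType) (n : nat).
Local Notation E := 'rV['F_2]_n.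
Implicit Types (U V W : {vspace E}) (X Y D : {set E}) (A : {set E * E}).

(* Where D is too thin on a coset it is padded up to density about tau; the pairs of A do
   not see the padding. *)
Lemma set_interpolation D0 D (s : R) : D0 \subset D -> #|D0|%:R < s -> s <= #|D|%:R ->
  exists D', [/\ D0 \subset D', D' \subset D, s <= #|D'|%:R & #|D'|%:R < s + 1].
Proof.
have [k] := ubnP (#|D :\: D0|); elim: k D0 => // k IH D0 cD D0D lt le.
have [z zD] : exists z, z \in D :\: D0.
  apply/set0Pn; apply: contraTneq le => DD0; rewrite -ltNge.
  have /eqP := DD0; rewrite setD_eq0 => DD0'.
  by apply: le_lt_trans lt; rewrite ler_nat subset_leq_card.
have [zD1 zD0] := setDP zD.
have sub1 : z |: D0 \subset D by rewrite subUset sub1set zD1.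
have card1 : #|z |: D0|%:R = #|D0|%:R + 1 :> R by rewrite cardsU1 zD0 natrD addrC.
have [ge|lt1] := lerP s #|z |: D0|%:R.
  by exists (z |: D0); split; rewrite ?subsetUr // card1; lra.
have [||||D' [sub' D'D le' lt']] := IH (z |: D0) => //.
  rewrite -ltnS; apply: leq_trans cD; rewrite ltnS; apply: proper_card.
  have -> : D :\: (z |: D0) = (D :\: D0) :\ z.
    by apply/setP => w; rewrite !inE negb_or andbA.
  exact: properD1.
by exists D'; split=> //; apply: subset_trans sub'; exact: subsetUr.
Qed.

Definition good_box W A (K r : nat) (rho tau beta eps : R)
    (V : {vspace E}) (x y : E) X Y D : Prop :=
  [/\ coset V x \subset coset W 0, coset V y \subset coset W 0 &
      (\dim W <= \dim V + K)%N] /\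
  [/\ X \subset coset V x, Y \subset coset V y & D \subset coset V (x + y)] /\
  [/\ tau * #|V|%:R <= #|D|%:R, rho / 32 * #|V|%:R ^+ 2 <= #|X|%:R * #|Y|%:R,
      alg_spread V x r eps X, alg_spread V y r eps Y &
      beta * (#|X|%:R * #|Y|%:R / #|V|%:R * #|D|%:R) <= #|A :&: triple_set X Y D|%:R].

Definition in_pair A (x y : E) : R := ((x, y) \in A)%:R.

Lemma sum_pair_set A X Y :
  \sum_(x in X) \sum_(y in Y) in_pair A x y = #|A :&: setX X Y|%:R.
Proof.
rewrite pair_big_dep /= -sum1_card natr_sum [LHS]big_mkcond [RHS]big_mkcond /=.
apply: eq_bigr => -[x y] _ /=; rewrite in_setI in_setX /in_pair.
by case: (x \in X) (y \in Y) ((x, y) \in A) => -[] [].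
Qed.

Lemma sum_ind_add X Y D :
  \sum_(x in X) \sum_(y in Y) ind R D (x + y) = #|triple_set X Y D|%:R.
Proof.
rewrite pair_big_dep /= -sum1_card natr_sum [LHS]big_mkcond [RHS]big_mkcond /=.
apply: eq_bigr => -[x y] _ /=; rewrite /ind [in RHS]inE /=.
by case: (x \in X) (y \in Y) (x + y \in D) => -[] [].
Qed.

Lemma triple_set_coset V x y X Y D : X \subset coset V x -> Y \subset coset V y ->
  triple_set X Y (D :&: coset V (x + y)) = triple_set X Y D.
Proof.
move=> XV YV; apply/setP => -[a b]; rewrite !inE /=.
have [aX|//] := boolP (a \in X); have [bY|//] := boolP (b \in Y).
rewrite /= (_ : a + b - (x + y) = (a - x) + (b - y)); last by rewrite opprD addrACA.
by rewrite memvD ?andbT // -mem_coset ?(subsetP XV) ?(subsetP YV).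
Qed.

Lemma box_pairs V x y A X Y D0 D' : A \subset triple_set X Y D0 ->
  forall X' Y', X' \subset coset V x -> Y' \subset coset V y ->
  D0 :&: coset V (x + y) \subset D' ->
  (#|A :&: setX X' Y'| <= #|A :&: triple_set X' Y' D'|)%N.
Proof.
move=> AS X' Y' X'V Y'V D0D'; apply: subset_leq_card; apply/subsetP => -[a b].
rewrite !inE /= => /andP[abA /andP[aX bY]]; rewrite abA aX bY /=.
apply: (subsetP D0D'); rewrite !inE.
have := subsetP AS _ abA; rewrite inE /= => /and3P[_ _ ->] /=.
rewrite (_ : a + b - (x + y) = (a - x) + (b - y)); last by rewrite opprD addrACA.
by rewrite memvD // -mem_coset ?(subsetP X'V) ?(subsetP Y'V).
Qed.

(** Without a good box, every dense box of spread sets contains few points of [A]: directly when [D]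
    is dense enough on its coset, after padding otherwise. [Hleaf] turns this into a nonpositive sum
    of [mu], and [tree] contradicts the lower bound on the whole sum. *)
Lemma find_good_box W A X0 Y0 X Y D (mu : E -> E -> R) (bound eps rho tau beta : R)
    (r m t : nat) :
  let step := ((r * m + r) * m + r * m)%N in
  A \subset triple_set X0 Y0 D ->
  0 <= bound -> (forall x y, mu x y <= bound) ->
  0 < eps -> eps <= 1 -> 0 < rho -> 1 < rho / 4 * (1 + eps / 16) ^+ m ->
  0 < tau -> tau <= 1 / 2 -> 0 <= beta ->
  X \subset coset W 0 -> Y \subset coset W 0 ->
  (forall V x y X' Y', X' \subset coset V x -> Y' \subset coset V y ->
     alg_spread V x r eps X' -> alg_spread V y r eps Y' ->
     rho / 32 * #|V|%:R ^+ 2 <= #|X'|%:R * #|Y'|%:R ->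
     let D' := D :&: coset V (x + y) in
     (tau * #|V|%:R <= #|D'|%:R -> #|A :&: setX X' Y'|%:R <=
        beta * (#|X'|%:R * #|Y'|%:R / #|V|%:R * #|D'|%:R)) ->
     (#|D'|%:R < tau * #|V|%:R -> #|A :&: setX X' Y'|%:R <=
        2 * tau * beta * (#|X'|%:R * #|Y'|%:R)) ->
     \sum_(x in X') \sum_(y in Y') mu x y <= 0) ->
  tree_bound bound rho t X Y W < \sum_(x in X) \sum_(y in Y) mu x y ->
  exists V x y X' Y' D', good_box W A (t * step) r rho tau beta eps V x y X' Y' D'.
Proof.
move=> step AS bound0 mub eps0 eps1 rho0 mlarge tau0 tau2 beta0 XW YW Hleaf Hsum.
apply: contrapT => Hno; move: Hsum; apply/negP; rewrite -leNgt.
apply: (@tree R n W mu bound eps rho r m (t * step)%N) => //.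
move=> V x y X' Y' xW yW dimV X'V Y'V spX spY dens.
have V0 := vspace_gt0 R V.
have none D' : D' \subset coset V (x + y) -> tau * #|V|%:R <= #|D'|%:R ->
    #|A :&: triple_set X' Y' D'|%:R < beta * (#|X'|%:R * #|Y'|%:R / #|V|%:R * #|D'|%:R).
  move=> D'V tD; rewrite ltNge; apply/negP => H; apply: Hno.
  by exists V, x, y, X', Y', D'.
apply: (Hleaf V x y) => // [big|small].
  apply: ltW; apply: le_lt_trans (none _ (subsetIr _ _) big).
  by rewrite ler_nat (box_pairs AS X'V Y'V).
have XY0 : 0 <= 2 * tau * beta * (#|X'|%:R * #|Y'|%:R).
  by rewrite !mulr_ge0 // ltW.
set D0 := D :&: coset V (x + y) in small.
have [D00|D0n] := eqVneq D0 set0.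
  apply: le_trans XY0; have := box_pairs AS X'V Y'V (subxx D0).
  rewrite -/D0 D00 (_ : triple_set X' Y' set0 = set0); last first.
    by apply/setP => p; rewrite !inE !andbF.
  by rewrite setI0 cards0 leqn0 => /eqP ->.
(* A thin nonempty [D0] forces this, so the excess of less than 1 in [set_interpolation] keeps the
   padded set below [2 * tau * #|V|%:R]. This is why the empty case is separate. *)
have tauV : 1 < tau * #|V|%:R.
  by apply: le_lt_trans small; rewrite ler1n card_gt0.
have [||D' [D0D' D'V leD' ltD']] := @set_interpolation D0 (coset V (x + y)) (tau * #|V|%:R) _ small.
- exact: subsetIr.
- by rewrite card_coset ler_piMl //; clear -tau2; lra.
have := none D' D'V leD'.
have : #|A :&: setX X' Y'|%:R <= #|A :&: triple_set X' Y' D'|%:R :> R.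
  by rewrite ler_nat (box_pairs AS X'V Y'V).
move=> /le_lt_trans H /H /ltW /le_trans; apply.
have h : #|D'|%:R / #|V|%:R <= 2 * tau by rewrite ler_pdivrMr //; clear -ltD' tauV; lra.
have bXY : 0 <= beta * (#|X'|%:R * #|Y'|%:R) by rewrite !mulr_ge0.
by have := ler_wpM2l bXY h; clear; lra.
Qed.

End Boxes.

(** * The two choices of the functional [mu] *)

Section Cores.
Variables (R : realType) (n : nat).
Local Notation E := 'rV['F_2]_n.
Implicit Types (W V : {vspace E}) (X Y D : {set E}) (A : {set E * E}).

Lemma card_sub_triple A X Y D : A \subset triple_set X Y D ->
  #|A|%:R <= #|X|%:R * #|Y|%:R :> R.
Proof.
move=> AS.
rewrite -natrM ler_nat -cardsX subset_leq_card //; apply: subset_trans AS _.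
by apply/subsetP => p; rewrite !inE => /and3P[-> ->].
Qed.

Lemma sum_all_A A X Y D : A \subset triple_set X Y D ->
  \sum_(x in X) \sum_(y in Y) in_pair R A x y = #|A|%:R.
Proof.
move=> AS; rewrite sum_pair_set; congr (_%:R); apply: eq_card => p; rewrite in_setI.
case pA: (p \in A) => //=; have := subsetP AS _ pA.
by rewrite !inE => /and3P[-> ->].
Qed.

Lemma sum_sum_const (X' Y' : {set E}) (k : R) :
  \sum_(x in X') \sum_(y in Y') k = k * (#|X'|%:R * #|Y'|%:R).
Proof. by rewrite !sumr_const -mulrnA -natrM mulnC mulr_natr. Qed.

Lemma box_side_lb (V : {vspace E}) x (X' Y' : {set E}) (c : R) : X' \subset coset V x ->
  c * #|V|%:R ^+ 2 <= #|X'|%:R * #|Y'|%:R -> c * #|V|%:R <= #|Y'|%:R.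
Proof.
move=> X'V; have V0 := vspace_gt0 R V; rewrite expr2 mulrA => H.
rewrite -(ler_pM2r V0); apply: le_trans H _; rewrite mulrC ler_wpM2l //.
by rewrite ler_nat -(card_coset V x) subset_leq_card.
Qed.

Lemma lb_exp (V : {vspace E}) (Z : {set E}) (c : R) k : 1 <= c * 2 ^+ k ->
  c * #|V|%:R <= #|Z|%:R -> #|V|%:R <= #|Z|%:R * 2 ^+ k :> R.
Proof.
move=> ck /(ler_wpM2r (exprn_ge0 k (ler0n R 2))); apply: le_trans.
by rewrite mulrAC ler_peMl.
Qed.

Lemma card_triple_setCD D (X' Y' : {set E}) :
  #|triple_set X' Y' D|%:R + #|triple_set X' Y' (~: D)|%:R = #|X'|%:R * #|Y'|%:R :> R.
Proof.
rewrite -natrM -natrD -cardsX -(cardsID (triple_set X' Y' D) (setX X' Y')).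
congr (_ + _)%:R; apply: eq_card => -[a b]; rewrite !inE /=;
  by case: (a \in X') (b \in Y') (a + b \in D) => -[] [].
Qed.

Lemma in_pair_ge0 A (x y : E) : 0 <= in_pair R A x y <= 1.
Proof. by rewrite /in_pair; case: (_ \in A); rewrite ?lexx ?ler01. Qed.

(** Budget for the slack [5 * eps]: the upper count on [W] and the lower count on boxes together
    lose a factor [1 + 5 / 2 * eps], valid for [eps <= 1 / 5]. The two terms [2 * tau], one inside
    [mu] and one bounding the tree, are each of order [eps]. *)
Lemma core_sparse W X Y D A (eps alpha rho N P d tau beta : R) (r m t e l J M1 M2 : nat) :
  N = #|W|%:R -> P = #|X|%:R * #|Y|%:R -> d = #|D|%:R / N ->
  tau = eps * alpha / 2 * d -> beta = (1 - 5 * eps) * alpha ->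
  X \subset coset W 0 -> Y \subset coset W 0 -> D \subset coset W 0 ->
  A \subset triple_set X Y D -> alpha * d * P <= #|A|%:R ->
  0 < #|X|%:R :> R -> 0 < #|Y|%:R :> R -> 0 < #|D|%:R :> R ->
  0 < eps -> eps < 1 / 5 -> 0 < alpha ->
  alg_spread W 0 r (eps / 8) X \/ alg_spread W 0 r (eps / 8) Y ->
  0 < rho -> 1 < rho / 4 * (1 + eps / 50 / 16) ^+ m ->
  (sift_codim e M1 M2 <= r)%N -> (lower_codim e l J J <= r)%N ->
  1 <= e%:R * eps -> (e <= 2 ^ l)%N -> (0 < J)%N -> (0 < M1)%N -> (0 < M2)%N ->
  20 * e%:R * N <= #|D|%:R * 2 ^+ M1 -> N ^+ 2 <= P * 2 ^+ M2 ->
  1 <= rho / 32 * 2 ^+ J -> 1 <= tau * 2 ^+ J -> tau <= 1 / 2 ->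
  (3 / 4) ^+ t <= tau -> rho * 21 ^+ t * N ^+ 2 <= tau * P ->
  exists V x y X' Y' D',
    good_box W A (t * ((r * m + r) * m + r * m)) r rho tau beta (eps / 50) V x y X' Y' D'.
Proof.
move=> NE PE dE tauE betaE XW YW DW AS HA X0 Y0 D0 eps0 eps5 al0 spread rho0 m_large.
move=> siftr lowr e1 el J0 M10 M20 DM1 PM2 rhoJ tauJ tau2 tt rt.
have N0 : 0 < N by rewrite NE vspace_gt0.
have P0 : 0 < P by rewrite PE mulr_gt0.
have d0 : 0 < d by rewrite dE divr_gt0.
have tau0 : 0 < tau by rewrite tauE mulr_gt0 // divr_gt0 // mulr_gt0.
have e_lt1 : 0 < 1 - eps by clear -eps5; lra.
have eps5' : eps <= 1 / 5 by exact: ltW.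
have beta0 : 0 <= beta by rewrite betaE mulr_ge0 ?(ltW al0) //; clear -eps5; lra.
have tau20 : 0 <= 2 * tau by rewrite mulr_ge0 // ltW.
have Pd : 0 < P * d by exact: mulr_gt0.
pose S : R := #|triple_set X Y D|%:R.
have S_le : S <= (1 + eps) * (P * d).
  have DW' : D \subset coset W (0 + 0) by rewrite addr0.
  rewrite NE in DM1; rewrite NE PE in PM2.
  have -> : (1 + eps) * (P * d) = (1 + eps) * (#|X|%:R * #|Y|%:R / #|W|%:R) * #|D|%:R.
    by rewrite PE dE NE; ring.
  apply: (spread_upper_count XW YW DW' spread siftr _ eps0 eps5' e1 M10 M20 DM1 PM2).
  by clear -eps0; lra.
(* [alpha] may exceed 1, but [A] lies in the triple set, whose size the upper count controls. *)
have al12 : alpha <= 1 + eps.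
  rewrite -(ler_pM2r Pd); apply: le_trans S_le; apply: (@le_trans _ _ #|A|%:R).
    by apply: le_trans HA; clear; lra.
  by rewrite /S ler_nat subset_leq_card.
(* The lower count turns 1_D / (1 - eps) into at least |X'||Y'||D'|/|V| on a spread box; the
   term 2 tau covers the boxes on which D' is thin. *)
pose mu a b := in_pair R A a b - beta * (ind R D (a + b) / (1 - eps) + 2 * tau).
have sum_mu (X' Y' : {set E}) : \sum_(a in X') \sum_(b in Y') mu a b =
    #|A :&: setX X' Y'|%:R
     - beta * (#|triple_set X' Y' D|%:R / (1 - eps) + 2 * tau * (#|X'|%:R * #|Y'|%:R)).
  rewrite -sum_pair_set -sum_ind_add -sum_sum_const mulr_suml -big_split mulr_sumr -sumrB.
  apply: eq_bigr => a _; rewrite mulr_suml -big_split mulr_sumr -sumrB.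
  by apply: eq_bigr => b _.
(* Spreadness [eps / 50] because the lower count at accuracy [eps] needs spreadness below
   [eps / 40]. *)
apply: (@find_good_box R n W A X Y X Y D mu 1 (eps / 50) rho tau beta r m t) => //.
- move=> a b; have /andP[_ p1] := in_pair_ge0 A a b.
  rewrite /mu lerBlDr; apply: le_trans p1 _; rewrite lerDl mulr_ge0 // addr_ge0 //.
  by rewrite divr_ge0 ?ind_ge0 // ltW.
- by rewrite divr_gt0.
- by clear -eps5; lra.
- move=> V x y X' Y' X'V Y'V spX spY dens D' big small.
  have V0 := vspace_gt0 R V.
  rewrite sum_mu subr_le0; set p := _ * #|Y'|%:R in big small *.
  have p0 : 0 <= p by exact: mulr_ge0.
  set S' := _%:R / (1 - eps).
  have S0 : 0 <= S' by rewrite divr_ge0 // ltW.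
  have [ge|lt] := lerP (tau * #|V|%:R) #|D'|%:R; last first.
    apply: le_trans (small lt) _; have := mulr_ge0 beta0 S0; clear; lra.
  apply: le_trans (big ge) _; apply: ler_wpM2l => //.
  apply: (@le_trans _ _ S'); last by rewrite lerDl mulr_ge0.
  rewrite /S' -(triple_set_coset D X'V Y'V) -/D' ler_pdivlMr // mulrC mulrA.
  have dX : rho / 32 * #|V|%:R <= #|X'|%:R.
    by apply: (box_side_lb Y'V); rewrite [#|Y'|%:R * _]mulrC.
  apply: (@spread_lower_count R n V x y X' Y' D' r (eps / 50) eps e l J J) => //.
  + exact: subsetIr.
  + by clear -eps0; lra.
  + exact: lb_exp tauJ ge.
  + exact: lb_exp rhoJ dX.
  + exact: lb_exp rhoJ (box_side_lb X'V dens).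
rewrite sum_mu -sum_pair_set (sum_all_A AS) -PE -/S.
have tb : tree_bound 1 rho t X Y W <= 2 * tau * P.
  rewrite /tree_bound mul1r -PE -NE; have := ler_wpM2r (ltW P0) tt.
  by clear -rt; lra.
apply: (le_lt_trans tb).
have S1 : S / (1 - eps) <= (1 + 5 / 2 * eps) * (P * d).
  rewrite ler_pdivrMr //; apply: le_trans S_le _; rewrite [X in _ <= X]mulrAC.
  apply: ler_wpM2r; first exact: ltW.
  by clear -eps5 eps0; nra.
have tauP : 2 * tau * P = eps * alpha * (P * d) by rewrite tauE; field.
have S2 : beta * (S / (1 - eps) + 2 * tau * P) <=
    beta * ((1 + 5 / 2 * eps) * (P * d) + eps * (1 + eps) * (P * d)).
  apply: ler_wpM2l => //; apply: lerD => //; rewrite tauP.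
  by apply: ler_wpM2r; [exact: ltW | rewrite ler_pM2l].
apply: lt_le_trans (lerB HA S2); rewrite tauP betaE -subr_gt0.
have -> : alpha * d * P - (1 - 5 * eps) * alpha *
   ((1 + 5 / 2 * eps) * (P * d) + eps * (1 + eps) * (P * d)) - eps * alpha * (P * d) =
   alpha * (P * d) * (eps / 2 + 33 / 2 * eps ^+ 2 + 5 * eps ^+ 3) by field.
apply: mulr_gt0; first exact: mulr_gt0.
have := exprn_gt0 2 eps0; have := exprn_gt0 3 eps0; clear -eps0; lra.
Qed.

(** Budget: on [W] the Fourier count with spreadness [eps / 8] is accurate to [7 / 50 * eps]; on
    boxes there is an additive [eps / 10], and the relative error [et] costs little more than
    [et * h = eps / 10]. The tree bound adds [eps * P]. All of this fits within [5 * eps] because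
    the densities are at least [9 / 10]. *)
Lemma core_dense W X Y D A (eps alpha rho N P d tau beta h : R) (r m t e J M1 : nat) :
  N = #|W|%:R -> P = #|X|%:R * #|Y|%:R -> d = #|D|%:R / N ->
  tau = eps * alpha / 2 * d -> beta = (1 - 5 * eps) * alpha ->
  X \subset coset W 0 -> Y \subset coset W 0 -> D \subset coset W 0 ->
  A \subset triple_set X Y D -> alpha * d * P <= #|A|%:R ->
  0 < #|X|%:R :> R -> 0 < #|Y|%:R :> R -> 0 < #|D|%:R :> R ->
  0 < eps -> eps < 1 / 5 -> 0 < alpha ->
  alg_spread W 0 r (eps / 8) X \/ alg_spread W 0 r (eps / 8) Y ->
  0 < rho -> 1 < rho / 4 * (1 + eps / 50 / 16) ^+ m ->
  5 * eps <= h -> h <= 1 / 10 -> 1 - h <= d -> 1 - h <= alpha ->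
  1 - h <= #|X|%:R / N -> 1 - h <= #|Y|%:R / N ->
  (0 < r)%N -> (sift_codim e M1 J <= r)%N -> 1 <= e%:R * (eps / (10 * h)) ->
  (0 < J)%N -> (0 < M1)%N -> 1 <= rho / 32 * 2 ^+ J -> 20 * e%:R <= rho / 32 * 2 ^+ M1 ->
  (3 / 4) ^+ t <= eps / (4 * h) -> rho * 21 ^+ t * N ^+ 2 <= eps / (4 * h) * P ->
  exists V x y X' Y' D',
    good_box W A (t * ((r * m + r) * m + r * m)) r rho tau beta (eps / 50) V x y X' Y' D'.
Proof.
move=> NE PE dE tauE betaE XW YW DW AS HA X0 Y0 D0 eps0 eps5 al0 spread rho0 m_large.
move=> eh h10 dh ah Xh Yh r0 siftr e1 J0 M10 rhoJ rhoM1 tt rt.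
have N0 : 0 < N by rewrite NE vspace_gt0.
have P0 : 0 < P by rewrite PE mulr_gt0.
have d0 : 0 < d by rewrite dE divr_gt0.
have tau0 : 0 < tau by rewrite tauE mulr_gt0 // divr_gt0 // mulr_gt0.
have h0 : 0 < h by clear -eh eps0; lra.
have h40 : 0 < 4 * h by rewrite mulr_gt0.
have DleN : #|D|%:R <= N by rewrite NE ler_nat -(card_coset W 0) subset_leq_card.
have ad1 : alpha * d <= 1.
  by rewrite -(ler_pM2r P0) mul1r; apply: le_trans HA _; rewrite PE (card_sub_triple AS).
have tau2 : tau <= eps / 2.
  rewrite tauE (_ : eps * alpha / 2 * d = eps / 2 * (alpha * d)); last by ring.
  by rewrite ler_piMr //; clear -eps0; lra.
have tau12 : tau <= 1 / 2 by apply: le_trans tau2 _; clear -eps5; lra.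
have tau20 : 0 <= 2 * tau by rewrite mulr_ge0 // ltW.
have beta0 : 0 <= beta by rewrite betaE mulr_ge0 ?(ltW al0) //; clear -eps5; lra.
have betah : 1 - 2 * h <= beta by rewrite betaE; clear -ah eh h10 eps0 eps5; nra.
pose et := eps / (10 * h).
have et0 : 0 < et by rewrite divr_gt0 // mulr_gt0.
have et50 : et <= 1 / 50.
  by rewrite ler_pdivrMr; [clear -eh; lra | rewrite mulr_gt0].
have eth : et * h = eps / 10 by rewrite /et; field; rewrite lt0r_neq0.
have et1 : 0 < 1 + et by clear -et0; lra.
pose u := (1 + et)^-1.
have u0 : 0 < u by rewrite invr_gt0.
have u1 : u <= 1 by rewrite invf_le1 //; clear -et0; lra.
have uet : u * (1 + et) = 1 by rewrite mulVf // lt0r_neq0.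
have eps10 : 0 <= eps / 10 by rewrite divr_ge0 // ltW.
have ueps0 : 0 <= u * (eps / 10) by rewrite mulr_ge0 // ltW.
pose C := ~: D.
(* Counting the complement C of D from above needs only relative error eps / (10 h), and
   makes mu <= 2 h, which absorbs the factor eps / h lost in the decomposition. *)
pose mu a b := in_pair R A a b - beta * (1 + 2 * tau - u * (ind R C (a + b) - eps / 10)).
have sum_mu (X' Y' : {set E}) : \sum_(a in X') \sum_(b in Y') mu a b =
    #|A :&: setX X' Y'|%:R - beta * ((1 + 2 * tau + u * (eps / 10)) * (#|X'|%:R * #|Y'|%:R)
      - u * #|triple_set X' Y' C|%:R).
  rewrite -sum_pair_set -sum_ind_add -sum_sum_const mulr_sumr -sumrB mulr_sumr -sumrB.
  apply: eq_bigr => a _; rewrite mulr_sumr -sumrB mulr_sumr -sumrB.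
  by apply: eq_bigr => b _; rewrite /mu; ring.
apply: (@find_good_box R n W A X Y X Y D mu (2 * h) (eps / 50) rho tau beta r m t) => //.
- by rewrite mulr_ge0 // ltW.
- move=> a b; rewrite /mu /in_pair; have [abA|abA] := boolP ((a, b) \in A) => /=.
    have abD : a + b \in D by have := subsetP AS _ abA; rewrite inE => /and3P[].
    have -> : ind R C (a + b) = 0 by rewrite /ind /C in_setC abD.
    have := mulr_ge0 beta0 (addr_ge0 tau20 ueps0); clear -betah; lra.
  rewrite sub0r; apply: le_trans (_ : 0 <= _); last by rewrite mulr_ge0 // ltW.
  rewrite oppr_le0 mulr_ge0 //.
  have : u * ind R C (a + b) <= 1 by rewrite mulr_ile1 ?ind_ge0 ?ind_le1 // ltW.
  by clear -tau20 ueps0; lra.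
- by rewrite divr_gt0.
- by clear -eps5; lra.
- move=> V x y X' Y' X'V Y'V spX spY dens D' big small.
  have V0 := vspace_gt0 R V.
  rewrite sum_mu subr_le0.
  have : exists p, p = #|X'|%:R * #|Y'|%:R :> R by eexists.
  move=> [p pE]; rewrite -pE in big small dens *.
  have p0 : 0 <= p by rewrite pE mulr_ge0.
  pose C' := C :&: coset V (x + y).
  have cardC' : #|D'|%:R + #|C'|%:R = #|V|%:R :> R.
    rewrite -natrD -(card_coset V (x + y)) -(cardsID D (coset V (x + y))).
    by congr (_ + _)%:R; apply: eq_card => z; rewrite !inE andbC.
  have pC0 : 0 <= p / #|V|%:R * #|C'|%:R by rewrite mulr_ge0 // divr_ge0.
  have countC : #|triple_set X' Y' C|%:R <= (1 + et) * (p / #|V|%:R * #|C'|%:R) + eps / 10 * p.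
    rewrite -(triple_set_coset C X'V Y'V) -/C'.
    have C'V : C' \subset coset V (x + y) by exact: subsetIr.
    (* A complement no larger than [Y'] may be too thin for the sieve, but then the square root in
       the Fourier bound is at most [#|Y'|]. Otherwise [C'] inherits the density [rho / 32] of [Y']
       and the sieve applies. *)
    have [le|gt] := lerP (#|C'|%:R : R) #|Y'|%:R.
      have eps50 : 0 <= eps / 50 by rewrite divr_ge0 // ltW.
      have := spread_fourier_count X'V Y'V C'V spX r0 eps50.
      rewrite ler_norml => /andP[_]; rewrite lerBlDr -pE => /le_trans; apply.
      have sq : Num.sqrt (#|Y'|%:R * #|C'|%:R) <= #|Y'|%:R :> R.
        rewrite -[X in _ <= X]ger0_norm // -sqrtr_sqr ler_wsqrtr // expr2.
        exact: ler_wpM2l.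
      have xe : 0 <= eps / 50 * #|X'|%:R by rewrite mulr_ge0.
      have := ler_wpM2l xe sq.
      have -> : eps / 50 * #|X'|%:R * #|Y'|%:R = eps / 50 * p by rewrite pE mulrA.
      have := mulr_ge0 (ltW et0) pC0; have := mulr_ge0 (ltW eps0) p0; clear; lra.
    have dY : rho / 32 * #|V|%:R <= #|Y'|%:R by apply: (box_side_lb X'V); rewrite -pE.
    apply: (@le_trans _ _ ((1 + et) * (p / #|V|%:R) * #|C'|%:R)); last first.
      by rewrite -[X in X <= _]mulrA lerDl mulr_ge0.
    rewrite pE; apply: (@spread_upper_count R n V x y X' Y' C' r (eps / 50) et e M1 J) => //.
    + by left.
    + by rewrite /et !ltr_pdivlMr ?mulr_gt0 //; clear -h10 eps0; nra.
    + by clear -et50; lra.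
    + have h1 : 20 * e%:R * #|V|%:R <= rho / 32 * #|V|%:R * 2 ^+ M1.
        by rewrite [X in _ <= X]mulrAC ler_pM2r.
      apply: le_trans h1 _; rewrite ler_pM2r ?exprn_gt0 //.
      by apply: le_trans dY (ltW gt).
    + rewrite -pE; apply: le_trans (_ : rho / 32 * #|V|%:R ^+ 2 * 2 ^+ J <= _).
        by rewrite mulrAC ler_peMl // sqr_ge0.
      by rewrite ler_pM2r ?exprn_gt0.
  have uC : u * #|triple_set X' Y' C|%:R <= p / #|V|%:R * #|C'|%:R + u * (eps / 10 * p).
    apply: le_trans (ler_wpM2l (ltW u0) countC) _.
    by rewrite mulrDr [u * ((1 + et) * _)]mulrA uet mul1r.
  have bracket : p / #|V|%:R * #|D'|%:R + 2 * tau * p <=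
      (1 + 2 * tau + u * (eps / 10)) * p - u * #|triple_set X' Y' C|%:R.
    have : p = p / #|V|%:R * #|D'|%:R + p / #|V|%:R * #|C'|%:R.
      by rewrite -mulrDr cardC' divfK // lt0r_neq0.
    by clear -uC; lra.
  have [ge|lt] := lerP (tau * #|V|%:R) #|D'|%:R.
    apply: le_trans (big ge) _; apply: ler_wpM2l => //; apply: le_trans bracket.
    by rewrite lerDl mulr_ge0.
  apply: le_trans (small lt) _; rewrite [2 * tau * beta]mulrC -mulrA; apply: ler_wpM2l => //.
  by apply: le_trans bracket; rewrite lerDr mulr_ge0 ?divr_ge0.
rewrite sum_mu -sum_pair_set (sum_all_A AS).
have top : `|#|triple_set X Y D|%:R - P * d| <= 7 / 50 * eps * P.
  have r8 : 0 <= eps / 8 by rewrite divr_ge0 // ltW.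
  have DW' : D \subset coset W (0 + 0) by rewrite addr0.
  (* [784 / 625] is the square of [28 / 25] and exceeds [10 / 9]; then
     [eps / 8 * (28 / 25) = 7 / 50 * eps]. *)
  have sq (Z : {set E}) : 1 - h <= #|Z|%:R / N ->
      Num.sqrt (#|Z|%:R * #|D|%:R) <= 28 / 25 * #|Z|%:R :> R.
    rewrite ler_pdivlMr // => Zh.
    have Z28 : 0 <= 28 / 25 * #|Z|%:R :> R by rewrite mulr_ge0 // divr_ge0.
    rewrite -[X in _ <= X]ger0_norm // -sqrtr_sqr ler_wsqrtr //.
    have N9 : 9 / 10 * N <= (1 - h) * N by rewrite ler_pM2r //; clear -h10; lra.
    have DZ : #|D|%:R <= 784 / 625 * #|Z|%:R :> R.
      by have := ler0n R #|Z|; clear -N9 Zh DleN; lra.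
    by have := ler_wpM2l (ler0n R #|Z|) DZ; rewrite expr2; clear; lra.
  have -> : P * d = #|X|%:R * #|Y|%:R / #|W|%:R * #|D|%:R by rewrite PE dE NE; ring.
  have -> : 7 / 50 * eps * P = eps / 8 * #|X|%:R * (28 / 25 * #|Y|%:R) by rewrite PE; field.
  case: spread => sp.
    apply: le_trans (spread_fourier_count XW YW DW' sp r0 r8) _.
    by apply: ler_wpM2l; [rewrite mulr_ge0 | exact: sq].
  rewrite -card_triple_setC [#|X|%:R * #|Y|%:R]mulrC.
  apply: le_trans (spread_fourier_count YW XW DW' sp r0 r8) _.
  rewrite [X in _ <= X](_ : _ = eps / 8 * #|Y|%:R * (28 / 25 * #|X|%:R)); last by ring.
  by apply: ler_wpM2l; [rewrite mulr_ge0 | exact: sq].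
have SC := card_triple_setCD D X Y; rewrite -/C -PE in SC.
rewrite -PE; move: top SC; rewrite ler_norml => /andP[].
move: (#|triple_set X Y D|%:R : R) (ler0n R #|triple_set X Y C|).
move: (#|triple_set X Y C|%:R : R) => T S T0 top1 top2 SC.
have T_ub : T <= (h + 7 / 50 * eps) * P.
  by have := ler_wpM2r (ltW P0) dh; clear -top1 SC; lra.
have uT : T - 11 / 100 * eps * P <= u * T.
  have h1 : (1 - et) * T <= u * T.
    apply: ler_wpM2r => //; rewrite -(ler_pM2r et1) uet; clear; nra.
  have h2 : et * T <= 11 / 100 * eps * P.
    apply: le_trans (ler_wpM2l (ltW et0) T_ub) _.
    rewrite mulrA; apply: ler_wpM2r; first exact: ltW.
    by rewrite mulrDr eth; clear -et50 eps0; nra.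
  by clear -h1 h2; lra.
have ueps : u * (eps / 10) <= eps / 10 by rewrite ler_piMl.
have upper : (1 + 2 * tau + u * (eps / 10)) * P - u * T <= (d + 135 / 100 * eps) * P.
  have := ler_wpM2r (ltW P0) ueps; have := ler_wpM2r (ltW P0) tau2.
  by clear -uT SC top2; lra.
have tb : tree_bound (2 * h) rho t X Y W <= eps * P.
  rewrite /tree_bound -PE -NE.
  have H : (3 / 4) ^+ t * P + rho * 21 ^+ t * N ^+ 2 <= eps / (2 * h) * P.
    have := ler_wpM2r (ltW P0) tt.
    have -> : eps / (2 * h) = eps / (4 * h) + eps / (4 * h) by field; rewrite lt0r_neq0.
    by clear -rt; lra.
  apply: le_trans (ler_wpM2l (_ : 0 <= 2 * h) H) _; first by rewrite mulr_ge0 // ltW.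
  by rewrite le_eqVlt; apply/orP; left; apply/eqP; field; rewrite lt0r_neq0.
apply: (le_lt_trans tb).
apply: lt_le_trans (lerB HA (ler_wpM2l beta0 upper)); rewrite betaE -subr_gt0.
have -> : alpha * d * P - (1 - 5 * eps) * alpha * ((d + 135 / 100 * eps) * P) - eps * P =
   eps * P * (alpha * (5 * d - 135 / 100 + 675 / 100 * eps) - 1) by field.
apply: mulr_gt0; first exact: mulr_gt0.
have : 9 / 10 * 2 <= alpha * (5 * d - 135 / 100 + 675 / 100 * eps).
  by apply: ler_pM; clear -ah dh h10 eps0; lra.
by clear; lra.
Qed.

End Cores.

(** * Rounding, logarithms and codimension bounds *)

Section Numerics.
Variable R : realType.

Lemma nat_ceil (x : R) : 0 <= x -> exists k : nat, [/\ (0 < k)%N, x <= k%:R & k%:R <= x + 1].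
Proof.
move=> x0; have /andP[lo hi] := Num.Theory.truncn_itv x0.
exists (Num.truncn x).+1; split => //; first exact: ltW.
by rewrite -natr1 lerD2r.
Qed.

Lemma expR_half_le2 : expR (1 / 2 : R) <= 2.
Proof. by apply: le_trans (expR_quadratic _) _ => //; rewrite expr2; lra. Qed.

Lemma pow2_ceil (y : R) : 1 <= y ->
  exists k : nat, [/\ (0 < k)%N, y <= 2 ^+ k & k%:R <= 2 * ln y + 1].
Proof.
move=> y1; have y0 : 0 < y by lra.
have l0 : 0 <= 2 * ln y by rewrite mulr_ge0 // ln_ge0.
have [k [k0 lo hi]] := nat_ceil l0; exists k; split=> //.
apply: (@le_trans _ _ (expR (1 / 2) ^+ k)).
  by rewrite -expRM_natr -[X in X <= _]lnK ?posrE // ler_expR; lra.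
by apply: lerXn2r; rewrite ?nnegrE ?expR_ge0 // expR_half_le2.
Qed.

Lemma geo_ceil (y : R) : 0 < y -> y <= 1 ->
  exists t : nat, (3 / 4) ^+ t <= y /\ t%:R <= 4 * ln y^-1 + 1.
Proof.
move=> y0 y1; have l0 : 0 <= 4 * ln y^-1 by rewrite mulr_ge0 // ln_ge0 // invf_ge1.
have [t [_ lo hi]] := nat_ceil l0; exists t; split=> //.
apply: (@le_trans _ _ (expR (- (1 / 4)) ^+ t)).
  apply: lerXn2r; rewrite ?nnegrE ?expR_ge0 //; first by lra.
  by apply: le_trans (expR_ge1Dx _); lra.
rewrite -expRM_natr -[X in _ <= X]lnK ?posrE // ler_expR.
by move: lo; rewrite lnV ?posrE //; lra.
Qed.

Lemma ln_le_pow2 (y : R) k : 0 < y -> y <= 2 ^+ k -> ln y <= k%:R.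
Proof.
move=> y0 yk; apply: (@le_trans _ _ (ln (2 ^+ k))); first by rewrite ler_ln ?posrE // exprn_gt0.
rewrite lnXn // -[_ *+ _]mulr_natr ler_piMl //.
by rewrite (_ : 2 = 1 + 1) ?le_ln1Dx //; lra.
Qed.

Lemma ln_inv_ge1 (eps : R) : 0 < eps -> eps < 1 / 5 -> 1 <= ln eps^-1.
Proof.
move=> e0 e5; rewrite -[X in X <= _]expRK ler_ln ?posrE ?expR_gt0 ?invr_gt0 //.
apply: (@le_trans _ _ 4).
  have -> : expR (1 : R) = expR (1 / 2) ^+ 2.
    by rewrite -expRM_natr; congr expR; field.
  apply: (@le_trans _ _ (2 ^+ 2)); last by rewrite expr2; lra.
  by apply: lerXn2r; rewrite ?nnegrE ?expR_ge0 // expR_half_le2.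
by rewrite -[X in X <= _]invrK lef_pV2 ?posrE //; lra.
Qed.

(** A logarithm is at most [k] times the [k]-th root. This trades high powers of a logarithm for a
    square, and is the source of the exponent [8 = 6 + 2] of [eps^-1]. *)
Lemma ln_pow_le (y : R) k n : (0 < k)%N -> 1 <= y -> ln y ^+ (k * n) <= k%:R ^+ (k * n) * y ^+ n.
Proof.
move=> k0 y1; have y0 : 0 < y by lra.
have k0' : 0 < k%:R :> R by rewrite ltr0n.
rewrite [X in X <= _]exprM [k%:R ^+ _]exprM -exprMn.
apply: lerXn2r; rewrite ?nnegrE ?mulr_ge0 ?exprn_ge0 ?ln_ge0 // ?(ltW y0) //.
rewrite mulrC -ler_pdivrMr ?exprn_gt0 // -expr_div_n.
rewrite -[X in _ <= X](lnK (_ : y \is Num.pos)) ?posrE //.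
have -> : expR (ln y) = expR (ln y / k%:R) ^+ k.
  by rewrite -expRM_natr divfK // lt0r_neq0.
apply: lerXn2r; rewrite ?nnegrE ?expR_ge0 //.
  by rewrite divr_ge0 ?ln_ge0.
by apply: le_trans (expR_ge1Dx _); rewrite lerDr.
Qed.

(** [800 = 50 * 16]: by Bernoulli a block of [800 * e] factors gives at least 2, and [2 ^+ J] from
    [J] blocks beats [4 / rho]. *)
Lemma large_exponent (rho eps : R) (e J : nat) :
  0 < rho -> 0 < eps -> 1 <= e%:R * eps -> 32 <= rho * 2 ^+ J ->
  1 < rho / 4 * (1 + eps / 50 / 16) ^+ (800 * e * J).
Proof.
move=> rho0 eps0 e1 rJ.
have two : 2 <= (1 + eps / 50 / 16) ^+ (800 * e).
  have b := @bernoulli_tangent R (1 + eps / 50 / 16) 1 (800 * e).-1.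
  have e0 : (0 < e)%N by case: e e1 {rJ b} => //; rewrite mul0r ler10.
  have pos : (0 < 800 * e)%N by rewrite muln_gt0.
  rewrite prednK // in b.
  have h1 : 0 <= 1 + eps / 50 / 16 by clear -eps0; lra.
  apply: le_trans _ (b h1 ler01); rewrite !expr1n mulr1 natrM.
  by clear -e1; lra.
have two' : 2 ^+ J <= (1 + eps / 50 / 16) ^+ (800 * e * J).
  by rewrite [X in _ <= X]exprM; apply: lerXn2r; rewrite ?nnegrE ?exprn_ge0 //; clear -eps0; lra.
apply: (@lt_le_trans _ _ (rho / 4 * 2 ^+ J)); first by clear -rJ; lra.
by rewrite ler_pM2l // divr_gt0.
Qed.

End Numerics.

Lemma bogolyubov_codim_le : exists c : nat, forall e q, (0 < e)%N -> (0 < q)%N ->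
  (bogolyubov_codim e q <= c * (e ^ 2 * q ^ 4))%N.
Proof.
exists (2 * 88 * 18 ^ 2 + 2)%N => e q e0 q0; rewrite mulnDl leq_add //.
  rewrite leq_eqVlt; apply/orP; left; apply/eqP.
  by rewrite !expnMn !expnS !expn0; ring.
by rewrite leq_pmulr // muln_gt0 !expn_gt0 e0 q0.
Qed.

(** The sieve feeds [q] of order [e * M1 * M2] into [e ^ 2 * q ^ 4], giving
    [e ^ 6 * M1 ^ 4 * M2 ^ 4]: this is where the eighth power of the logarithm in the hypothesis on
    [r] arises. The 78 is [2 * 3 * 13]. *)
Lemma codim_le : exists c : nat, forall e l J, (0 < e)%N -> (0 < l)%N -> (0 < J)%N ->
  (sift_codim e J J <= c * (e ^ 6 * J ^ 8))%N /\ (lower_codim e l J J <= c * (e ^ 6 * l ^ 4 * J ^ 8))%N.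
Proof.
have [c0 H] := bogolyubov_codim_le.
exists (c0 * (10 ^ 2 * 4 ^ 4) * (8 ^ 6 * (78 * 2) ^ 4))%N => e l J e0 l0 J0.
have sift_le e' M1 M2 : (0 < e')%N -> (0 < M1)%N -> (0 < M2)%N ->
    (sift_codim e' M1 M2 <= c0 * (10 ^ 2 * 4 ^ 4) * (e' ^ 6 * M1 ^ 4 * M2 ^ 4))%N.
  move=> e'0 M10 M20; apply: leq_trans (H _ _ _ _) _; rewrite ?muln_gt0 ?e'0 ?M10 //.
  rewrite leq_eqVlt; apply/orP; left; apply/eqP; rewrite !expnMn (expnD e' 2 4); ring.
split.
  apply: leq_trans (sift_le _ _ _ e0 J0 J0) _.
  rewrite (_ : e ^ 6 * J ^ 4 * J ^ 4 = e ^ 6 * J ^ 8)%N; last by rewrite -mulnA -expnD.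
  by rewrite leq_mul // leq_pmulr // muln_gt0 !expn_gt0.
apply: leq_trans (sift_le _ _ _ _ _ _) _; rewrite ?muln_gt0 ?addn_gt0 ?orbT //.
rewrite -[X in (_ <= X)%N]mulnA leq_mul2l; apply/orP; right.
apply: (@leq_trans ((8 * e) ^ 6 * (78 * J * l) ^ 4 * (2 * J) ^ 4)).
  rewrite leq_mul2r; apply/orP; right; rewrite leq_mul2l; apply/orP; right.
  rewrite leq_exp2r //; move: l0 J0; clear; nia.
rewrite leq_eqVlt; apply/orP; left; apply/eqP; rewrite !expnMn (expnD J 4 4); ring.
Qed.

(** * Choice of parameters in the two regimes *)

Section ParameterChoice.
Variable R : realType.

Lemma tree_cost (t r m : nat) : (0 < m)%N ->
  (t * ((r * m + r) * m + r * m))%:R <= 3 * (t%:R * r%:R * m%:R ^+ 2) :> R.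
Proof.
move=> m0; have m1 : 1 <= m%:R :> R by rewrite ler1n.
have tr0 : 0 <= t%:R * r%:R :> R by rewrite mulr_ge0.
have mm : m%:R <= m%:R ^+ 2 :> R by rewrite expr2 ler_peMl.
have -> : (t * ((r * m + r) * m + r * m))%:R =
    t%:R * r%:R * (m%:R ^+ 2 + m%:R + m%:R) :> R.
  by rewrite natrM natrD natrM natrD natrM; ring.
have -> : 3 * (t%:R * r%:R * m%:R ^+ 2) = t%:R * r%:R * (3 * m%:R ^+ 2) :> R by ring.
by rewrite ler_wpM2l //; clear -mm; lra.
Qed.

Lemma ln_tower_le (t : nat) (w : R) : 0 < w -> ln (32 * 21 ^+ t * w) <= 5 + 5 * t%:R + ln w.
Proof.
move=> w0; have t0 : 0 < 21 ^+ t :> R by rewrite exprn_gt0.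
have z0 : 0 < 32 :> R by [].
rewrite !lnM ?posrE ?mulr_gt0 // lnXn // lerD2r -[_ *+ t]mulr_natr; apply: lerD.
  by apply: (@ln_le_pow2 R 32 5) => //; rewrite -natrX ler_nat.
by rewrite ler_wpM2r //; apply: (@ln_le_pow2 R 21 5) => //; rewrite -natrX ler_nat.
Qed.

Lemma expR_ln_inv_le (y b : R) : 0 < y -> ln y <= b -> expR (- b) <= y^-1.
Proof.
move=> y0 yb; rewrite -[X in _ <= X]lnK ?posrE ?invr_gt0 // ler_expR lnV ?posrE //.
by rewrite lerN2.
Qed.

(** Here [a] is [alpha * dD] and [q] is [dX * dY]. [t], of order [LD], brings the main term of the
    tree down to [tau = eps * a / 2]; [rho] brings the error to [tau * q]; [2 ^+ J] exceeds
    [32 / rho], so [J] is of order [L]. With [lam = ln eps^-1], [H >= 1 / 10] gives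
    [L <= 11 * (lam * H)], so [r] must exceed a multiple of [eps^-1 ^+ 6 * lam ^+ 12 * H ^+ 8], and
    [lam ^+ 12] is at most a multiple of [eps^-1 ^+ 2]. *)
Lemma sparse_parameters (c : nat) (eps a q H L LD : R) (r : nat) :
  (forall e l J, (0 < e)%N -> (0 < l)%N -> (0 < J)%N ->
     (sift_codim e J J <= c * (e ^ 6 * J ^ 8))%N /\
     (lower_codim e l J J <= c * (e ^ 6 * l ^ 4 * J ^ 8))%N) ->
  0 < eps -> eps < 1 / 5 -> 0 < a -> a <= 1 -> 0 < q -> q <= 1 ->
  H = ln (a * q)^-1 -> L = ln (eps * (a * q))^-1 -> LD = ln (eps * a)^-1 ->
  1 / 10 <= H ->
  c%:R * (2 ^+ 6 * 5 ^+ 4 * 1155 ^+ 8 * 6 ^+ 12) * (eps^-1 ^+ 8 * H ^+ 8) <= r%:R ->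
  exists (t m e l J : nat) (rho : R),
  [/\ [/\ 0 < rho, 1 < rho / 4 * (1 + eps / 50 / 16) ^+ m,
      (sift_codim e J J <= r)%N & (lower_codim e l J J <= r)%N] ,
      [/\ 1 <= e%:R * eps, e%:R <= 2 / eps, (e <= 2 ^ l)%N & (0 < J)%N],
      [/\ 64 <= eps * a * q * 2 ^+ J, 1 <= rho / 32 * 2 ^+ J,
          (3 / 4) ^+ t <= eps * a / 2 & rho * 21 ^+ t = eps * a / 2 * q] &
      (t * ((r * m + r) * m + r * m))%:R <=
        27 * (1600 * 105) ^+ 2 * (r%:R * eps^-1 ^+ 2 * L ^+ 2 * LD) /\
      q * expR (- (52 * LD ^+ 2)) <= rho / 32].
Proof.
move=> Hc eps0 eps5 a0 a1 q0 q1 HE LE LDE H10 Hr.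
have lam1 := ln_inv_ge1 eps0 eps5; set lam := ln eps^-1 in lam1.
have epsV : 1 <= eps^-1 by rewrite invf_ge1 //; clear -eps5; lra.
have epsV0 : 0 < eps^-1 by rewrite invr_gt0.
have lna : 0 <= ln a^-1 by rewrite ln_ge0 // invf_ge1.
have lnq : 0 <= ln q^-1 by rewrite ln_ge0 // invf_ge1.
have HE' : H = ln a^-1 + ln q^-1 by rewrite HE invfM lnM ?posrE ?invr_gt0.
have LDE' : LD = lam + ln a^-1 by rewrite LDE invfM lnM ?posrE ?invr_gt0.
have LE' : L = lam + (ln a^-1 + ln q^-1).
  by rewrite LE !invfM !lnM ?posrE ?mulr_gt0 ?invr_gt0.
have LD1 : 1 <= LD by clear -LDE' lam1 lna; lra.
have LLD : LD <= L by clear -LDE' LE' lnq; lra.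
have ea0 : 0 < eps * a / 2 by rewrite divr_gt0 ?mulr_gt0.
have ea1 : eps * a / 2 <= 1.
  have : eps * a <= 1 * 1 by apply: ler_pM => //; [exact: ltW | exact: ltW | clear -eps5; lra].
  by clear; lra.
have [t [tt tle]] := geo_ceil ea0 ea1.
have lntau : ln (eps * a / 2)^-1 <= LD + 1.
  rewrite invf_div mulrC lnM ?posrE ?invr_gt0 ?mulr_gt0 // -LDE lerD2l.
  by apply: (@ln_le_pow2 R 2 1).
have t9 : t%:R <= 9 * LD by clear -tle lntau LD1; lra.
pose rho := eps * a / 2 * q / 21 ^+ t.
have t0 : 0 < 21 ^+ t :> R by rewrite exprn_gt0.
have rho0 : 0 < rho by rewrite divr_gt0 // mulr_gt0.
pose y := 32 * 21 ^+ t * ((eps * a / 2)^-1 * q^-1).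
have yE : 32 / rho = y by rewrite /rho /y; field; rewrite !lt0r_neq0.
have y0 : 0 < y by rewrite -yE divr_gt0.
have lny : ln y <= 52 * L.
  apply: le_trans (ln_tower_le _ _) _; first by rewrite mulr_gt0 ?invr_gt0.
  rewrite lnM ?posrE ?invr_gt0 //; move: lntau t9 LLD LD1; rewrite LE' LDE'; clear; lra.
have y1 : 1 <= y.
  rewrite -yE ler_pdivlMr // mul1r /rho; apply: (@le_trans _ _ 1); last by rewrite ler1n.
  rewrite ler_pdivrMr // mul1r; apply: (@le_trans _ _ 1); last by rewrite exprn_ege1 // ler1n.
  by apply: mulr_ile1 => //; exact: ltW.
have [J [J0 yJ Jle]] := pow2_ceil y1.
have J105 : J%:R <= 105 * L by clear -Jle lny LLD LD1; lra.
have [e [e0 elo ehi]] := nat_ceil (ltW epsV0).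
have ehi' : e%:R <= 2 / eps by clear -ehi epsV; lra.
have e1 : 1 <= e%:R :> R by rewrite ler1n.
have [l [l0 elR lle]] := pow2_ceil e1.
have el : (e <= 2 ^ l)%N by rewrite -(ler_nat R) natrX.
have l5 : l%:R <= 5 * lam.
  have : ln e%:R <= ln (2 / eps) by rewrite ler_ln ?posrE ?divr_gt0 // (lt_le_trans _ e1).
  have ln2 := @ln_le_pow2 R 2 1 (ltr0n R 2) (lexx _).
  rewrite lnM ?posrE ?invr_gt0 // -/lam; move: ln2 lle lam1; clear; lra.
have [c1 c2] := Hc e l J e0 l0 J0.
have rJ : 32 <= rho * 2 ^+ J by rewrite mulrC -ler_pdivrMr // yE.
have lowr : (c * (e ^ 6 * l ^ 4 * J ^ 8) <= r)%N.
  rewrite -(ler_nat R); apply: le_trans Hr; have -> : (c * (e ^ 6 * l ^ 4 * J ^ 8))%:R = c%:R * (e%:R ^+ 6 * l%:R ^+ 4 * J%:R ^+ 8) :> R.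
    by rewrite -!natrX -!natrM.
  rewrite -[X in _ <= X]mulrA ler_wpM2l //.
  have H0 : 0 < H by clear -H10; lra.
  have L11 : L <= 11 * (lam * H).
    have -> : L = lam + H by rewrite LE' HE'.
    have h1 : lam * (1 / 10) <= lam * H by rewrite ler_pM2l //; clear -lam1; lra.
    have h2 : 1 * H <= lam * H by rewrite ler_pM2r.
    by clear -h1 h2; lra.
  have J11 : J%:R <= 1155 * (lam * H) by clear -J105 L11; lra.
  have lamp : lam ^+ 12 <= 6 ^+ 12 * eps^-1 ^+ 2 by exact: (@ln_pow_le R eps^-1 6 2).
  apply: (@le_trans _ _ ((2 / eps) ^+ 6 * (5 * lam) ^+ 4 * (1155 * (lam * H)) ^+ 8)).
    apply: ler_pM; rewrite ?mulr_ge0 ?exprn_ge0 //.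
      by apply: ler_pM; rewrite ?exprn_ge0 //; apply: lerXn2r; rewrite ?nnegrE ?(le_trans _ ehi') ?(le_trans _ l5).
    by apply: lerXn2r; rewrite ?nnegrE ?(le_trans _ J11).
  apply: (@le_trans _ _ (2 ^+ 6 * 5 ^+ 4 * 1155 ^+ 8 * (eps^-1 ^+ 6 * H ^+ 8) * lam ^+ 12)).
    rewrite le_eqVlt; apply/orP; left; apply/eqP; rewrite !exprMn (exprD lam 4 8).
    by move: (1155 ^+ 8 : R) => w; ring.
  have pos : 0 <= 2 ^+ 6 * 5 ^+ 4 * 1155 ^+ 8 * (eps^-1 ^+ 6 * H ^+ 8).
    by rewrite !mulr_ge0 ?exprn_ge0 // ltW.
  apply: le_trans (ler_wpM2l pos lamp) _.
  rewrite le_eqVlt; apply/orP; left; apply/eqP; rewrite (exprD eps^-1 6 2).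
  by move: (1155 ^+ 8 : R) (6 ^+ 12 : R) => w w'; ring.
exists t, (800 * e * J)%N, e, l, J, rho; split.
- split=> //.
  + apply: large_exponent => //.
    by rewrite -[X in X <= _](mulVf (lt0r_neq0 eps0)) ler_pM2r.
  + apply: leq_trans c1 (leq_trans _ lowr); rewrite leq_mul2l; apply/orP; right.
    by rewrite leq_mul2r leq_pmulr ?orbT // expn_gt0 l0.
  + exact: leq_trans c2 lowr.
- split=> //.
  by rewrite -[X in X <= _](mulVf (lt0r_neq0 eps0)) ler_pM2r.
- split=> //.
  + have := yJ; rewrite -yE ler_pdivrMr // /rho mulrA ler_pdivlMr // => h32.
    have h21 : 32 * 1 <= 32 * 21 ^+ t :> R by rewrite ler_pM2l // exprn_ege1 // ler1n.
    by move: (le_trans h21 h32); clear; lra.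
  + by rewrite -(ler_pM2l (_ : 0 < 32 :> R)) //; move: rJ; clear; lra.
  + by rewrite /rho divfK // lt0r_neq0.
- split.
    have m0 : (0 < 800 * e * J)%N by rewrite !muln_gt0 e0 J0.
    apply: le_trans (tree_cost _ _ m0) _.
    have mle : (800 * e * J)%:R <= (1600 * 105) * (eps^-1 * L) :> R.
      rewrite !natrM (_ : (1600 * 105) * _ = 800 * (2 / eps) * (105 * L)); last by ring.
      by apply: ler_pM => //; rewrite ?mulr_ge0 // ler_pM2l.
    apply: (@le_trans _ _ (3 * (9 * LD * r%:R * ((1600 * 105) * (eps^-1 * L)) ^+ 2))).
      rewrite ler_pM2l //; apply: ler_pM; rewrite ?mulr_ge0 ?sqr_ge0 //.
        by rewrite ler_wpM2r.
      by apply: lerXn2r; rewrite ?nnegrE // (le_trans _ mle).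
    by rewrite le_eqVlt; apply/orP; left; apply/eqP; rewrite !exprMn; move: ((1600 * 105) ^+ 2 : R) => w; ring.
have y'0 : 0 < 32 * 21 ^+ t * (eps * a / 2)^-1 by rewrite !mulr_gt0 // invr_gt0.
rewrite (_ : rho / 32 = q * (32 * 21 ^+ t * (eps * a / 2)^-1)^-1); last first.
  by rewrite /rho; field; rewrite !lt0r_neq0.
rewrite ler_pM2l //; apply: expR_ln_inv_le => //.
apply: le_trans (ln_tower_le _ _) _; first by rewrite invr_gt0.
(* The exponent obtained is linear in [LD]; [LD >= 1] allows the square. *)
have : LD <= LD ^+ 2 by rewrite expr2 ler_peMl //; clear -LD1; lra.
by move: lntau t9 LD1; clear; lra.
Qed.

(** All that enters [r] is a function of [z = 4 * H / eps]: [t] and [J] are of order [ln z] and [e]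
    of order [z], so [e ^ 6 * J ^ 8] is at most a multiple of [z ^+ 8]. The hypothesis
    [5 * eps <= H] gives [z >= 20], hence [ln z >= 1]. *)
Lemma dense_parameters (c : nat) (eps q H L LD : R) (r : nat) :
  (forall e l J, (0 < e)%N -> (0 < l)%N -> (0 < J)%N ->
     (sift_codim e J J <= c * (e ^ 6 * J ^ 8))%N /\
     (lower_codim e l J J <= c * (e ^ 6 * l ^ 4 * J ^ 8))%N) ->
  0 < eps -> eps < 1 / 5 -> 1 / 2 <= q -> q <= 1 ->
  5 * eps <= H -> H <= 1 / 10 -> ln eps^-1 <= L -> ln eps^-1 <= LD ->
  c%:R * (3 ^+ 6 * 80 ^+ 8 * 4 ^+ 8 * 4 ^+ 8) * (eps^-1 ^+ 8 * H ^+ 8) <= r%:R ->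
  exists (t m e J : nat) (rho : R),
  [/\ [/\ 0 < rho, 1 < rho / 4 * (1 + eps / 50 / 16) ^+ m,
      (sift_codim e J J <= r)%N, 1 <= e%:R * (eps / (10 * H)) & (0 < J)%N],
      [/\ 1 <= rho / 32 * 2 ^+ J, 20 * e%:R <= rho / 32 * 2 ^+ J,
          (3 / 4) ^+ t <= eps / (4 * H) & rho * 21 ^+ t = eps / (4 * H) * q] &
      (t * ((r * m + r) * m + r * m))%:R <=
        27 * (1600 * 105) ^+ 2 * (r%:R * eps^-1 ^+ 2 * L ^+ 2 * LD) /\
      q * expR (- (52 * LD ^+ 2)) <= rho / 32].
Proof.
move=> Hc eps0 eps5 q2 q1 eH H10 lamL lamLD Hr.
have lam1 := ln_inv_ge1 eps0 eps5; set lam := ln eps^-1 in lam1 lamL lamLD.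
have epsV : 1 <= eps^-1 by rewrite invf_ge1 //; clear -eps5; lra.
have epsV0 : 0 < eps^-1 by rewrite invr_gt0.
have q0 : 0 < q by clear -q2; lra.
have H0 : 0 < H by clear -eH eps0; lra.
have H40 : 0 < 4 * H by rewrite mulr_gt0.
pose z := 4 * H / eps.
have z0 : 0 < z by rewrite divr_gt0.
have zV : eps / (4 * H) = z^-1 by rewrite invf_div.
have z20 : 20 <= z by rewrite ler_pdivlMr //; clear -eH; lra.
have zle : z <= eps^-1 by rewrite ler_piMl //; [exact: ltW | clear -H10; lra].
have zV0 : 0 < z^-1 by rewrite invr_gt0.
have zV5 : z^-1 < 1 / 5.
  by rewrite div1r ltf_pV2 ?posrE //; clear -z20; lra.
have qq1 := ln_inv_ge1 zV0 zV5; rewrite invrK in qq1; set qq := ln z in qq1.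
have qqlam : qq <= lam by rewrite ler_ln ?posrE.
have [t [tt tle]] := geo_ceil zV0 (ltW (lt_trans zV5 (ltac:(lra) : 1 / 5 < 1))).
rewrite invrK -/qq in tle.
have t5 : t%:R <= 5 * qq by clear -tle qq1; lra.
pose rho := z^-1 * q / 21 ^+ t.
have t0 : 0 < 21 ^+ t :> R by rewrite exprn_gt0.
have rho0 : 0 < rho by rewrite divr_gt0 // mulr_gt0.
pose y := 32 * 21 ^+ t * (z * q^-1).
have yE : 32 / rho = y by rewrite /rho /y; field; rewrite !lt0r_neq0.
have y0 : 0 < y by rewrite -yE divr_gt0.
have lnq : ln q^-1 <= 1.
  apply: (@ln_le_pow2 R q^-1 1); first by rewrite invr_gt0.
  by rewrite expr1 -[X in _ <= X]invrK lef_pV2 ?posrE //; clear -q2; lra.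
have lny : ln y <= 32 * qq.
  apply: le_trans (ln_tower_le _ _) _; first by rewrite mulr_gt0 ?invr_gt0.
  by rewrite lnM ?posrE ?invr_gt0 // -/qq; move: lnq t5 qq1; clear; lra.
have y1 : 1 <= y.
  rewrite -yE ler_pdivlMr // mul1r /rho; apply: (@le_trans _ _ 1); last by rewrite ler1n.
  rewrite ler_pdivrMr // mul1r; apply: (@le_trans _ _ 1); last by rewrite exprn_ege1 // ler1n.
  by apply: mulr_ile1 => //; [exact: ltW | exact: ltW | clear -zV5; lra].
have [J1 [J10 yJ J1le]] := pow2_ceil y1.
have z40 : 0 <= 10 * (z / 4) by clear -z0; lra.
have [e [e0 elo ehi]] := nat_ceil z40.
have e3z : e%:R <= 3 * z by clear -ehi z20; lra.
have e1 : 1 <= e%:R :> R by rewrite ler1n.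
have e20 : 1 <= 20 * e%:R :> R by clear -e1; lra.
have [J2 [J20 eJ J2le]] := pow2_ceil e20.
have lne : ln (20 * e%:R) <= 6 + qq.
  apply: (@le_trans _ _ (ln (60 * z))).
    by rewrite ler_ln ?posrE ?mulr_gt0 ?(lt_le_trans ltr01 e1) //; clear -e3z; lra.
  rewrite lnM ?posrE // lerD2r; apply: (@ln_le_pow2 R 60 6) => //.
  by rewrite -natrX ler_nat.
(* [J1] pays for [rho] and [J2] for [20 * e]; the sum serves as both bit counts of the sieve. *)
pose J := (J1 + J2)%N.
have J80 : J%:R <= 80 * qq by rewrite natrD; clear -J1le J2le lny lne qq1; lra.
have J0 : (0 < J)%N by rewrite addn_gt0 J10.
have rJ1 : 32 <= rho * 2 ^+ J1 by rewrite mulrC -ler_pdivrMr // yE.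
have rJ : 32 * (20 * e%:R) <= rho * 2 ^+ J.
  by rewrite exprD [X in _ <= X]mulrA; apply: ler_pM => //; rewrite mulr_ge0.
have rJ' : 32 <= rho * 2 ^+ J by apply: le_trans rJ; clear -e20; lra.
(* The pieces are spread at scale [eps], so [m] needs a second integer near [1 / eps]. It enters the
   cost of the tree but not the sieve. *)
have [e2 [e20' e2lo e2hi]] := nat_ceil (ltW epsV0).
have e2eps : 1 <= e2%:R * eps by rewrite -[X in X <= _](mulVf (lt0r_neq0 eps0)) ler_pM2r.
have [c1 _] := Hc e 1%N J e0 isT J0.
have siftr : (sift_codim e J J <= r)%N.
  apply: leq_trans c1 _; rewrite -(ler_nat R); apply: le_trans Hr.
  have -> : (c * (e ^ 6 * J ^ 8))%:R = c%:R * (e%:R ^+ 6 * J%:R ^+ 8) :> R.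
    by rewrite -!natrX -!natrM.
  rewrite -[X in _ <= X]mulrA ler_wpM2l //.
  have qp : qq ^+ 8 <= 4 ^+ 8 * z ^+ 2 by apply: (@ln_pow_le R z 4 2) => //; clear -z20; lra.
  have qq0 : 0 <= qq by clear -qq1; lra.
  apply: (@le_trans _ _ ((3 * z) ^+ 6 * (80 * qq) ^+ 8)).
    apply: ler_pM; rewrite ?exprn_ge0 //.
      by apply: lerXn2r; rewrite ?nnegrE ?(le_trans _ e3z).
    by apply: lerXn2r; rewrite ?nnegrE ?(le_trans _ J80).
  apply: (@le_trans _ _ (3 ^+ 6 * 80 ^+ 8 * z ^+ 6 * qq ^+ 8)).
    rewrite le_eqVlt; apply/orP; left; apply/eqP; rewrite !exprMn.
    by move: (3 ^+ 6 : R) (80 ^+ 8 : R) => w w'; ring.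
  have pos : 0 <= 3 ^+ 6 * 80 ^+ 8 * z ^+ 6 by rewrite !mulr_ge0 ?exprn_ge0 // ltW.
  apply: le_trans (ler_wpM2l pos qp) _.
  rewrite le_eqVlt; apply/orP; left; apply/eqP.
  have z8 : z ^+ 6 * z ^+ 2 = 4 ^+ 8 * (eps^-1 ^+ 8 * H ^+ 8).
    by rewrite -exprD /z !exprMn; ring.
  rewrite -[X in _ = X]mulrA -z8.
  by move: (3 ^+ 6 : R) (80 ^+ 8 : R) (4 ^+ 8 : R) => w w' w''; ring.
exists t, (800 * e2 * J)%N, e, J, rho; split.
- split=> //; first exact: large_exponent.
  have -> : eps / (10 * H) = (10 * (z / 4))^-1 by rewrite /z; field; rewrite !lt0r_neq0.
  by rewrite ler_pdivlMr ?mul1r // mulr_gt0 // divr_gt0.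
- split.
  + by rewrite -(ler_pM2l (_ : 0 < 32 :> R)) //; move: rJ'; clear; lra.
  + by rewrite -(ler_pM2l (_ : 0 < 32 :> R)) //; move: rJ; clear; lra.
  + by rewrite zV.
  + by rewrite zV /rho divfK // lt0r_neq0.
have LD1 : 1 <= LD by exact: le_trans lam1 lamLD.
have L1 : 1 <= L by exact: le_trans lam1 lamL.
have tLD : t%:R <= 9 * LD by clear -t5 qqlam lamLD LD1; lra.
split.
  have m0 : (0 < 800 * e2 * J)%N by rewrite !muln_gt0 e20' J0.
  apply: le_trans (tree_cost _ _ m0) _.
  have e2hi' : e2%:R <= 2 / eps by clear -e2hi epsV; lra.
  have JL : J%:R <= 105 * L by clear -J80 qqlam lamL L1; lra.
  have mle : (800 * e2 * J)%:R <= 1600 * 105 * (eps^-1 * L) :> R.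
    rewrite !natrM (_ : 1600 * 105 * _ = 800 * (2 / eps) * (105 * L)); last by ring.
    by apply: ler_pM => //; rewrite ?mulr_ge0 // ler_pM2l.
  apply: (@le_trans _ _ (3 * (9 * LD * r%:R * (1600 * 105 * (eps^-1 * L)) ^+ 2))).
    rewrite ler_pM2l //; apply: ler_pM; rewrite ?mulr_ge0 ?sqr_ge0 //.
      by rewrite ler_wpM2r.
    by apply: lerXn2r; rewrite ?nnegrE // (le_trans _ mle).
  by rewrite le_eqVlt; apply/orP; left; apply/eqP; rewrite !exprMn; move: ((1600 * 105) ^+ 2 : R) => w; ring.
rewrite (_ : rho / 32 = q * (32 * 21 ^+ t * z)^-1); last first.
  by rewrite /rho; field; rewrite !lt0r_neq0.
rewrite ler_pM2l //; apply: expR_ln_inv_le; first by rewrite !mulr_gt0.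
apply: le_trans (ln_tower_le _ z0) _; rewrite -/qq.
have : LD <= LD ^+ 2 by rewrite expr2 ler_peMl //; clear -LD1; lra.
by move: qqlam lamLD tLD LD1; clear; lra.
Qed.

End ParameterChoice.

(** * Packaging of the conclusion *)

Section Main.
Variables (R : realType) (n : nat).
Notation E := 'rV['F_2]_n.
Implicit Types (W V : {vspace E}) (X Y D : {set E}) (A : {set E * E}).

(** A pair is determined by [x] and [x + y]. This is what bounds [alpha * dY] by 1, as counting
    pairs [(x, y)] bounds [alpha * dD]. *)
Lemma card_sub_triple_sum A X Y D : A \subset triple_set X Y D ->
  #|A|%:R <= #|X|%:R * #|D|%:R :> R.
Proof.
move=> AS; have inj : injective (fun p : E * E => (p.1, p.1 + p.2)).
  by move=> [x y] [x' y'] [-> /addrI ->].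
rewrite -(card_imset _ inj) -natrM ler_nat -cardsX subset_leq_card //.
apply/subsetP => _ /imsetP[p /(subsetP AS) pA ->]; move: pA.
by rewrite !inE => /and3P[-> _ ->].
Qed.

Lemma alg_spread_whole W r (eps : R) : 0 <= eps -> alg_spread W 0 r eps (coset W 0).
Proof.
move=> eps0 U v UW _.
rewrite (setIidPr UW) /density !card_coset !divff ?lt0r_neq0 ?vspace_gt0 //.
by rewrite mulr1 lerDl.
Qed.

Lemma alg_spread_weaken V x r (eps eps' : R) X :
  eps <= eps' -> alg_spread V x r eps X -> alg_spread V x r eps' X.
Proof.
move=> ee H U v UV dU; apply: le_trans (H U v UV dU) _.
by apply: ler_wpM2r; [rewrite divr_ge0 | rewrite lerD2l].
Qed.

Definition structured_piece W A (eps alpha p tau K : R) r : Prop :=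
  exists V x y X Y D,
  [/\ (V <= W)%VS, x \in W & y \in W] /\
  [/\ X \subset coset V x, Y \subset coset V y & D \subset coset V (x + y)] /\
  [/\ (\dim W)%:R - K <= (\dim V)%:R, tau <= density R D V,
      p <= (#|X| * #|Y|)%:R / #|V|%:R ^+ 2,
      alg_spread V x r eps X /\ alg_spread V y r eps Y &
      (1 - 5 * eps) * alpha * density R X V * density R Y V * density R D V
        * #|V|%:R ^+ 2 <= #|A :&: triple_set X Y D|%:R].

Lemma good_box_structured_piece W A K r (rho tau eps alpha p K' : R) V x y X Y D :
  good_box W A K r rho tau ((1 - 5 * eps) * alpha) (eps / 50) V x y X Y D ->
  0 < eps -> K%:R <= K' -> p <= rho / 32 ->
  structured_piece W A eps alpha p tau K' r.
Proof.
move=> [[Vx Vy dimV] [XYD [Dtau XYrho sX sY HA]]] eps0 KK prho.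
exists V, x, y, X, Y, D; split; [|split=> //].
  have [VW xW] := subset_coset Vx; have [_ yW] := subset_coset Vy.
  by split=> //; rewrite -coset0.
have V0 := vspace_gt0 R V.
have ee : eps / 50 <= eps by clear -eps0; lra.
split.
- by move: dimV; rewrite -(ler_nat R) natrD; move: KK; clear; lra.
- by rewrite ler_pdivlMr.
- by apply: le_trans prho _; rewrite ler_pdivlMr ?exprn_gt0 // natrM.
- by split; [exact: alg_spread_weaken sX | exact: alg_spread_weaken sY].
apply: le_trans HA; rewrite /density le_eqVlt; apply/orP; left; apply/eqP.
by field; rewrite lt0r_neq0.
Qed.

(** The degenerate answer with both sets equal to [W]. It serves [eps >= 1 / 5], where the count
    demanded is nonpositive, and [dX * dY >= 1 - 5 * eps], where enlarging [X] and [Y] to [W] costs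
    no more than the allowed factor. *)
Lemma whole_structured_piece W A r (eps alpha p tau K : R) D :
  0 <= eps -> D \subset coset W 0 -> tau <= density R D W -> p <= 1 -> 0 <= K ->
  (1 - 5 * eps) * alpha * density R D W * #|W|%:R ^+ 2
    <= #|A :&: triple_set (coset W 0) (coset W 0) D|%:R ->
  structured_piece W A eps alpha p tau K r.
Proof.
move=> eps0 DW Dtau p1 K0 HA; have W0 := vspace_gt0 R W.
exists W, 0, 0, (coset W 0), (coset W 0), D; split; first by rewrite subvv mem0v.
rewrite addr0; split=> //; split=> //.
- by rewrite gerBl.
- by rewrite natrM card_coset -expr2 divff // lt0r_neq0 // exprn_gt0.
- by split; exact: alg_spread_whole.
by rewrite {1 2}/density card_coset divff ?lt0r_neq0 // !mulr1.
Qed.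

Lemma powR2_le_expR (b : R) : 0 <= b -> 2 `^ (- (104 * b)) <= expR (- (52 * b)).
Proof.
move=> b0; rewrite /powR pnatr_eq0 /= ler_expR.
have : 1 / 2 <= ln 2 :> R.
  by rewrite -[X in X <= _]expRK ler_ln ?posrE ?expR_gt0 // expR_half_le2.
by clear -b0; nra.
Qed.

End Main.

(** * Case distinction on [eps] and on the densities *)

Section Density.
Variable R : realType.

Lemma structured_piece_exists (c n : nat) (W : {vspace 'rV['F_2]_n}) (X Y D : {set 'rV['F_2]_n})
    (A : {set 'rV['F_2]_n * 'rV['F_2]_n}) (eps alpha dX dY dD L LD H : R) (r : nat) :
  (0 < c)%N ->
  (forall e l J, (0 < e)%N -> (0 < l)%N -> (0 < J)%N ->
     (sift_codim e J J <= c * (e ^ 6 * J ^ 8))%N /\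
     (lower_codim e l J J <= c * (e ^ 6 * l ^ 4 * J ^ 8))%N) ->
  dX = density R X W -> dY = density R Y W -> dD = density R D W ->
  X \subset coset W 0 -> Y \subset coset W 0 -> D \subset coset W 0 ->
  0 < dX -> 0 < dY -> 0 < dD -> 0 < eps -> 0 < alpha -> eps * alpha * dD <= 1 ->
  H = ln (alpha * dD * (dX * dY))^-1 -> L = ln (eps * (alpha * dD * (dX * dY)))^-1 ->
  LD = ln (eps * (alpha * dD))^-1 ->
  c%:R * (2 ^+ 6 * 5 ^+ 4 * 1155 ^+ 8 * 6 ^+ 12 + 3 ^+ 6 * 80 ^+ 8 * 4 ^+ 8 * 4 ^+ 8)
    * (eps^-1 ^+ 8 * H ^+ 8) <= r%:R ->
  alg_spread W 0 r (eps / 8) X \/ alg_spread W 0 r (eps / 8) Y ->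
  A \subset triple_set X Y D ->
  alpha * dD * (dX * dY) * #|W|%:R ^+ 2 <= #|A|%:R ->
  structured_piece W A eps alpha (2 `^ (- (104 * LD ^+ 2)) * (dX * dY)) (eps * alpha / 2 * dD)
    (27 * (1600 * 105) ^+ 2 * (r%:R * eps^-1 ^+ 2 * L ^+ 2 * LD + r%:R * eps^-1 ^+ 2 * LD ^+ 5)) r.
Proof.
move=> c0 Hc XE YE DE XW YW DW X0 Y0 D0 eps0 al0 ead HE LE LDE Hr spread AS HA.
have N0 := vspace_gt0 R W.
have dens_le1 Z : Z \subset coset W 0 -> density R Z W <= 1.
  by move=> ZW; rewrite ler_pdivrMr // mul1r ler_nat -(card_coset W 0) subset_leq_card.
have dens_card Z z : z = density R Z W -> #|Z|%:R = z * #|W|%:R :> R.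
  by move=> ->; rewrite divfK // lt0r_neq0.
have [XN YN DN] := And3 (dens_card _ _ XE) (dens_card _ _ YE) (dens_card _ _ DE).
have X1 : dX <= 1 by rewrite XE dens_le1.
have Y1 : dY <= 1 by rewrite YE dens_le1.
have D1 : dD <= 1 by rewrite DE dens_le1.
set N : R := #|W|%:R in N0 XN YN DN HA *.
have N20 : 0 < N ^+ 2 by rewrite exprn_gt0.
have aD1 : alpha * dD <= 1.
  rewrite -(ler_pM2r (_ : 0 < dX * dY * N ^+ 2)); last by rewrite !mulr_gt0.
  rewrite mul1r mulrA; apply: le_trans HA (le_trans (card_sub_triple R AS) _).
  by rewrite XN YN le_eqVlt; apply/orP; left; apply/eqP; ring.
have aY1 : alpha * dY <= 1.
  rewrite -(ler_pM2r (_ : 0 < dX * dD * N ^+ 2)); last by rewrite !mulr_gt0.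
  rewrite mul1r; apply: (@le_trans _ _ (#|X|%:R * #|D|%:R)).
    apply: le_trans (card_sub_triple_sum R AS); apply: le_trans HA.
    by rewrite le_eqVlt; apply/orP; left; apply/eqP; ring.
  by rewrite XN DN le_eqVlt; apply/orP; left; apply/eqP; ring.
have XY0 : 0 < dX * dY by exact: mulr_gt0.
have XY1 : dX * dY <= 1 by apply: mulr_ile1 => //; exact: ltW.
have aD0 : 0 < alpha * dD by exact: mulr_gt0.
have aXY1 : alpha * (dX * dY) <= 1.
  by rewrite mulrCA; apply: mulr_ile1 => //; [exact: ltW | rewrite mulr_ge0 // ltW].
have p0 : 0 < alpha * dD * (dX * dY) by exact: mulr_gt0.
have p1 : alpha * dD * (dX * dY) <= 1 by apply: mulr_ile1 => //; exact: ltW.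
have eaD0 : 0 < eps * (alpha * dD) by exact: mulr_gt0.
have eaD1 : eps * (alpha * dD) <= 1 by rewrite mulrA.
have LD0 : 0 <= LD by rewrite LDE ln_ge0 // invf_ge1.
have cost0 : 0 <= r%:R * eps^-1 ^+ 2 * LD ^+ 5 :> R.
  by rewrite !mulr_ge0 ?exprn_ge0 // invr_ge0 ltW.
have cost1 : 0 <= r%:R * eps^-1 ^+ 2 * L ^+ 2 * LD :> R.
  by rewrite mulr_ge0 // mulr_ge0 ?sqr_ge0 // mulr_ge0 ?sqr_ge0.
have C10 : 0 <= 27 * (1600 * 105) ^+ 2 :> R by rewrite mulr_ge0 ?sqr_ge0.
have K0 : 0 <= 27 * (1600 * 105) ^+ 2 *
    (r%:R * eps^-1 ^+ 2 * L ^+ 2 * LD + r%:R * eps^-1 ^+ 2 * LD ^+ 5) :> R.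
  by rewrite mulr_ge0 // addr_ge0.
have pw1 : 2 `^ (- (104 * LD ^+ 2)) * (dX * dY) <= 1.
  apply: mulr_ile1 => //; rewrite ?powR_ge0 ?(ltW XY0) //.
  apply: le_trans (powR2_le_expR (sqr_ge0 LD)) _.
  by rewrite -[X in _ <= X](expR0 R) ler_expR oppr_le0 mulr_ge0 ?sqr_ge0.
have [e5|e5] := lerP (1 / 5) eps.
  apply: (@whole_structured_piece _ _ _ _ _ _ _ _ _ _ (coset W 0)) => //; first exact: ltW.
    rewrite /density card_coset divff ?lt0r_neq0 // mulrAC.
    by rewrite ler_pdivrMr //; move: ead e5 eaD0; rewrite mulrA; clear; lra.
  apply: (@le_trans _ _ 0) => //; rewrite /density card_coset divff ?lt0r_neq0 // mulr1.
  apply: mulr_le0_ge0; last exact: ltW.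
  by apply: mulr_le0_ge0; [clear -e5; lra | exact: ltW].
have epsV0 : 0 < eps^-1 by rewrite invr_gt0.
have lam1 := ln_inv_ge1 eps0 e5.
have cost_le K : K <= 27 * (1600 * 105) ^+ 2 * (r%:R * eps^-1 ^+ 2 * L ^+ 2 * LD) ->
    K <= 27 * (1600 * 105) ^+ 2 *
      (r%:R * eps^-1 ^+ 2 * L ^+ 2 * LD + r%:R * eps^-1 ^+ 2 * LD ^+ 5).
  by move=> /le_trans; apply; rewrite ler_wpM2l // lerDl.
have pw_le rho : dX * dY * expR (- (52 * LD ^+ 2)) <= rho / 32 ->
    2 `^ (- (104 * LD ^+ 2)) * (dX * dY) <= rho / 32.
  move=> /(le_trans _); apply; rewrite [X in X <= _]mulrC ler_pM2l //.
  exact: powR2_le_expR (sqr_ge0 LD).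
have PE : #|X|%:R * #|Y|%:R = dX * dY * N ^+ 2 :> R by rewrite XN YN; ring.
have HA' : alpha * dD * (#|X|%:R * #|Y|%:R) <= #|A|%:R.
  by rewrite PE mulrA.
have X0' : 0 < #|X|%:R :> R by rewrite XN mulr_gt0.
have Y0' : 0 < #|Y|%:R :> R by rewrite YN mulr_gt0.
have D0' : 0 < #|D|%:R :> R by rewrite DN mulr_gt0.
have H0 : 0 <= H by rewrite HE ln_ge0 // invf_ge1.
have Hr0 : 0 <= eps^-1 ^+ 8 * H ^+ 8 by rewrite mulr_ge0 ?exprn_ge0 // ltW.
have Hr_le (K1 K2 : R) : 0 <= K2 -> c%:R * (K1 + K2) * (eps^-1 ^+ 8 * H ^+ 8) <= r%:R ->
    c%:R * K1 * (eps^-1 ^+ 8 * H ^+ 8) <= r%:R.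
  move=> K20; apply: le_trans; apply: ler_wpM2r; first exact: Hr0.
  by rewrite ler_wpM2l // lerDl.
have K1_0 : 0 <= 2 ^+ 6 * 5 ^+ 4 * 1155 ^+ 8 * 6 ^+ 12 :> R by rewrite !mulr_ge0 ?exprn_ge0.
have K2_0 : 0 <= 3 ^+ 6 * 80 ^+ 8 * 4 ^+ 8 * 4 ^+ 8 :> R by rewrite !mulr_ge0 ?exprn_ge0.
have [H10|H10] := lerP (1 / 10) H.
  have [t [m [e [l [J [rho [[rho0 mlarge siftr lowr] [e1 ehi el J0] [h64 rJ tt rt]
    [cost prho]]]]]]]] :=
    sparse_parameters Hc eps0 e5 aD0 aD1 XY0 XY1 HE LE LDE H10 (Hr_le _ _ K2_0 Hr).
  have [V [x [y [X' [Y' [D' G]]]]]] :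
    exists V x y X' Y' D', good_box W A (t * ((r * m + r) * m + r * m)) r rho
      (eps * alpha / 2 * dD) ((1 - 5 * eps) * alpha) (eps / 50) V x y X' Y' D'.
    have J2 : 0 < 2 ^+ J :> R by rewrite exprn_gt0.
    have tauE : eps * (alpha * dD) / 2 = eps * alpha / 2 * dD by ring.
    have h1 : 64 <= eps * dD * 2 ^+ J.
      apply: le_trans h64 _.
      rewrite (_ : _ * 2 ^+ J = eps * dD * 2 ^+ J * (alpha * (dX * dY))); last by ring.
      by rewrite ler_piMr // !mulr_ge0 // ltW.
    have h2 : 1 <= dX * dY * 2 ^+ J.
      apply: (@le_trans _ _ (eps * (alpha * dD) * (dX * dY) * 2 ^+ J)); first by move: h64; clear; lra.
      rewrite -[X in X <= _]mulrA ler_piMl //.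
      by rewrite mulr_ge0 // ltW.
    have h3 : 64 <= eps * (alpha * dD) * 2 ^+ J.
      apply: le_trans h64 _; rewrite mulrAC ler_piMr //.
      by rewrite mulr_ge0 // ltW.
    apply: (@core_sparse _ _ W X Y D A eps alpha rho N _ dD _ _ r m t e l J J J) => //.
    + rewrite DN (_ : dD * N * 2 ^+ J = dD * 2 ^+ J * N); last by ring.
      rewrite ler_pM2r //.
      apply: (@le_trans _ _ (20 * (2 / eps))); first by rewrite ler_pM2l.
      rewrite mulrA ler_pdivrMr //; move: h1; rewrite (_ : eps * dD * _ = dD * 2 ^+ J * eps); last by ring.
      by clear; lra.
    + rewrite PE mulrAC; apply: ler_peMl => //; exact: ltW.
    + by rewrite -tauE; move: h3; clear; lra.
    + by rewrite -tauE; move: eaD1; clear; lra.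
    + by rewrite -tauE.
    + by rewrite rt tauE PE !mulrA.
  exact: good_box_structured_piece G eps0 (cost_le _ cost) (pw_le _ prho).
(* [expR (- H) >= 1 - H]. Each of [dD], [alpha], [dX] and [dY] is at least this product, because the
   other three factors multiply to at most 1; so all four are within [H] of 1 from below. *)
have Hexp : 1 - H <= alpha * dD * (dX * dY).
  have := expR_ge1Dx (- H); rewrite HE lnV ?posrE // opprK lnK ?posrE //.
have pD : alpha * dD * (dX * dY) <= dD.
  by rewrite -mulrA mulrCA ler_piMr // ltW.
have pa : alpha * dD * (dX * dY) <= alpha.
  rewrite -mulrA ler_piMr ?(ltW al0) //; apply: mulr_ile1 => //; exact: ltW.
have pX : alpha * dD * (dX * dY) <= dX.
  rewrite (_ : _ * (dX * dY) = dX * (dD * (alpha * dY))); last by ring.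
  rewrite ler_piMr ?(ltW X0) //; apply: mulr_ile1 => //; first exact: ltW.
  by rewrite mulr_ge0 // ltW.
have pY : alpha * dD * (dX * dY) <= dY.
  rewrite (_ : _ * (dX * dY) = dY * (dX * (alpha * dD))); last by ring.
  rewrite ler_piMr ?(ltW Y0) //; apply: mulr_ile1 => //; exact: ltW.
have [dense|sparse] := lerP (1 - 5 * eps) (dX * dY).
  apply: (@whole_structured_piece _ _ _ _ _ _ _ _ _ _ D) => //; first exact: ltW.
    rewrite -DE ler_piMl ?(ltW D0) // mulrAC.
    have a2 : alpha <= 10 / 9.
      have dY9 : 9 / 10 <= dY by move: Hexp pY H10; clear; lra.
      have : alpha * (9 / 10) <= 1 by apply: le_trans aY1; rewrite ler_pM2l.
      by clear; lra.
    by move: a2 e5 al0 eps0; clear; nra.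
  have -> : A :&: triple_set (coset W 0) (coset W 0) D = A.
    apply/setIidPl; apply: subset_trans AS _; apply/subsetP => p.
    by rewrite !in_set => /and3P[/(subsetP XW) + /(subsetP YW) + ->]; rewrite !in_set => -> ->.
  apply: le_trans HA; rewrite -DE ler_pM2r //.
  rewrite [X in _ <= X]mulrC [X in _ <= X]mulrA ler_pM2r //.
  by rewrite ler_pM2r.
have eH : 5 * eps <= H.
  have h : 1 - H <= dX * dY.
    by apply: le_trans Hexp _; rewrite ler_piMl // ltW.
  by move: h sparse; clear; lra.
have H0' : 0 < H by move: eH eps0; clear; lra.
have r0 : (0 < r)%N.
  rewrite -(ltr_nat R); apply: lt_le_trans Hr; rewrite mulr_gt0 ?mulr_gt0 ?exprn_gt0 ?ltr0n //.
  by apply: ltr_pwDl => //; rewrite !mulr_gt0 ?exprn_gt0.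
have lamD : ln eps^-1 <= LD.
  by rewrite LDE ler_ln ?posrE ?invr_gt0 // lef_pV2 ?posrE // ler_piMr // ltW.
have lamL : ln eps^-1 <= L.
  by rewrite LE ler_ln ?posrE ?invr_gt0 ?mulr_gt0 // lef_pV2 ?posrE ?mulr_gt0 // ler_piMr // ltW.
have q2 : 1 / 2 <= dX * dY.
  have h : 1 - H <= dX * dY.
    by apply: le_trans Hexp _; rewrite ler_piMl // ltW.
  by move: h H10; clear; lra.
rewrite [_ + 3 ^+ 6 * _ * _ * _]addrC in Hr.
have [t [m [e [J [rho [[rho0 mlarge siftr e1 J0] [rJ eJ tt rt] [cost prho]]]]]]] :=
  dense_parameters Hc eps0 e5 q2 XY1 eH (ltW H10) lamL lamD (Hr_le _ _ K1_0 Hr).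
have [V [x [y [X' [Y' [D' G]]]]]] :
    exists V x y X' Y' D', good_box W A (t * ((r * m + r) * m + r * m)) r rho
      (eps * alpha / 2 * dD) ((1 - 5 * eps) * alpha) (eps / 50) V x y X' Y' D'.
  apply: (@core_dense _ _ W X Y D A eps alpha rho N _ dD _ _ H r m t e J J) => //.
  + exact: ltW.
  + exact: le_trans Hexp pD.
  + exact: le_trans Hexp pa.
  + by rewrite -/(density R X W) -XE; exact: le_trans Hexp pX.
  + by rewrite -/(density R Y W) -YE; exact: le_trans Hexp pY.
  + by rewrite rt PE !mulrA.
exact: good_box_structured_piece G eps0 (cost_le _ cost) (pw_le _ prho).
Qed.

End Density.

(* The hypothesis eps * alpha * dD <= 1 follows from eps <= 1; without it LD
   may be negative and the lower bound on dD' may exceed 1. *)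
Theorem theorem5p7 (R : realType) :
  exists C0 C1 C2 : R, [/\ 0 < C0, 0 < C1 & 0 < C2] /\
  forall (n : nat) (W : {vspace 'rV['F_2]_n}) (X Y D : {set 'rV['F_2]_n})
    (A : {set 'rV['F_2]_n * 'rV['F_2]_n}) (eps alpha : R) (r : nat),
  let dX := density R X W in
  let dY := density R Y W in
  let dD := density R D W in
  let delta := dX * dY * dD in
  X \subset W -> Y \subset W -> D \subset W ->
  0 < delta -> 0 < eps -> 0 < alpha -> eps * alpha * dD <= 1 ->
  C0 * (eps ^- 8 * ln (1 / (alpha * delta)) ^+ 8
        + eps ^- 8 * ln (1 / dD) ^+ 16) <= r%:R ->
  alg_spread W 0 r (eps / 8) X \/ alg_spread W 0 r (eps / 8) Y ->
  A \subset triple_set X Y D ->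
  alpha * delta * #|W|%:R ^+ 2 <= #|A|%:R ->
  exists (W' : {vspace 'rV['F_2]_n}) (x y : 'rV['F_2]_n)
    (X' Y' D' : {set 'rV['F_2]_n}),
  let A' := A :&: triple_set X' Y' D' in
  let dX' := density R X' W' in
  let dY' := density R Y' W' in
  let dD' := density R D' W' in
  let L := ln (1 / (eps * alpha * delta)) in
  let LD := ln (1 / (eps * alpha * dD)) in
  [/\ (W' <= W)%VS, x \in W & y \in W] /\
  [/\ X' \subset coset W' x, Y' \subset coset W' y
    & D' \subset coset W' (x + y)] /\
  [/\ (\dim W)%:R - C1 * (r%:R * eps ^- 2 * L ^+ 2 * LD
                          + r%:R * eps ^- 2 * LD ^+ 5) <= (\dim W')%:R,
      eps * alpha / 2 * dD <= dD',
      2 `^ (- (C2 * LD ^+ 2)) * (dX * dY)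
        <= (#|X'| * #|Y'|)%:R / #|W'|%:R ^+ 2,
      alg_spread W' x r eps X' /\ alg_spread W' y r eps Y'
    & (1 - 5 * eps) * alpha * dX' * dY' * dD' * #|W'|%:R ^+ 2 <= #|A'|%:R].
Proof.
have [c Hc] := codim_le.
(* Passing from [c] to [c.+1] makes [C0] positive. *)
have Hc1 e l J (e0 : (0 < e)%N) (l0 : (0 < l)%N) (J0 : (0 < J)%N) :
    (sift_codim e J J <= c.+1 * (e ^ 6 * J ^ 8))%N /\
    (lower_codim e l J J <= c.+1 * (e ^ 6 * l ^ 4 * J ^ 8))%N.
  have [h1 h2] := Hc e l J e0 l0 J0.
  by split; [apply: leq_trans h1 _ | apply: leq_trans h2 _]; rewrite leq_mul2r leqnSn orbT.
pose C0 : R := c.+1%:R *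
  (2 ^+ 6 * 5 ^+ 4 * 1155 ^+ 8 * 6 ^+ 12 + 3 ^+ 6 * 80 ^+ 8 * 4 ^+ 8 * 4 ^+ 8).
have C0_gt0 : 0 < C0.
  rewrite mulr_gt0 ?ltr0n //; apply: addr_gt0; rewrite mulr_gt0 ?exprn_gt0 //.
    by rewrite !mulr_gt0 ?exprn_gt0.
  by rewrite !mulr_gt0 ?exprn_gt0.
exists C0, (27 * (1600 * 105) ^+ 2), 104; split.
  by split=> //; rewrite mulr_gt0 // exprn_gt0 // mulr_gt0.
move=> n W X Y D A eps alpha r dX dY dD delta XW YW DW delta0 eps0 al0 ead Hr spread AS HA.
have in_coset (Z : {set 'rV['F_2]_n}) : Z \subset W -> Z \subset coset W 0.
  by move=> /subsetP ZW; apply/subsetP => z /ZW; rewrite coset0.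
have dens_ge0 (Z : {set 'rV['F_2]_n}) : 0 <= density R Z W by rewrite divr_ge0.
have dens_gt0 (Z : {set 'rV['F_2]_n}) : density R Z W != 0 -> 0 < density R Z W.
  by rewrite lt_def dens_ge0 => ->.
have := lt0r_neq0 delta0; rewrite (mulf_eq0 (dX * dY) dD) (mulf_eq0 dX dY) !negb_or => /andP[/andP[X0 Y0] D0].
have deltaE : alpha * delta = alpha * dD * (dX * dY) by rewrite /delta; ring.
have HrH : C0 * (eps^-1 ^+ 8 * ln (alpha * dD * (dX * dY))^-1 ^+ 8) <= r%:R.
  apply: le_trans Hr; rewrite ler_pM2l // deltaE !div1r -exprVn lerDl.
  by rewrite mulr_ge0 ?exprn_even_ge0 // invr_ge0 ltW.
have := @structured_piece_exists R c.+1 n W X Y D A eps alpha dX dY dD _ _ _ r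
  (ltn0Sn c) Hc1 erefl erefl erefl (in_coset _ XW) (in_coset _ YW) (in_coset _ DW)
  (dens_gt0 _ X0) (dens_gt0 _ Y0) (dens_gt0 _ D0) eps0 al0 ead erefl erefl erefl HrH spread AS.
rewrite -deltaE => /(_ HA) [V [x [y [X' [Y' [D' H]]]]]].
exists V, x, y, X', Y', D'.
by rewrite /= -(exprVn eps) !div1r -(mulrA eps alpha delta) -(mulrA eps alpha dD).
Qed.
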